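(* Let $P\in\mathbb{Z}[X]$ be a polynomial of degree $2$ with positive leading coefficient, let $1<\alpha\le 2$, and let $F(x)=\sum_{n=1}^\infty e\big(P(n)x\big)n^{-\alpha}$ with $e(t)=e^{2\pi i t}$. Then \[ d_F\Big(\beta+\frac{\alpha-1}{2}\Big)=4\beta\qquad\text{for }0\le\beta\le\frac14 . \] Moreover, $\beta_F(x)\le \frac{\alpha-1}{2}+\frac14$ for every irrational $x$; in particular, for $\beta>1/4$, $d_F\big(\beta+\frac{\alpha-1}{2}\big)$ is either $0$ or undefined.
   Context: For a continuous $f:[0,1]\to\mathbb{C}$ and $x\in[0,1]$, $C^\gamma(x)$ is the set of $f$ such that $|f(x+h)-Q(h)|=O(|h|^\gamma)$ as $h\to0$ for some polynomial $Q\in\mathbb{C}[X]$ with $\deg Q\le\gamma$; the Hölder exponent is $\beta_f(x)=\sup\{\gamma: f\in C^\gamma(x)\}$. The spectrum of singularities is $d_f(\beta)=\dim_H\{x\in[0,1]:\beta_f(x)=\beta\}$ ($\dim_H$ = Hausdorff dimension), undefined when this set is empty. *)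

(* Defs.v *)
From HB Require Import structures.
From mathcomp Require Import all_boot all_order all_algebra.
From mathcomp Require Import all_classical all_reals all_analysis.
From mathcomp Require Import complex.

Set Implicit Arguments.
Unset Strict Implicit.
Unset Printing Implicit Defensive.

Import Order.TTheory GRing.Theory Num.Theory.
Import numFieldNormedType.Exports.

Local Open Scope classical_set_scope.
Local Open Scope ring_scope.
Local Open Scope complex_scope.

Section HausdorffDimension.
Variable R : realType.
Implicit Types (A U : set R) (s d : R).

(* The value on the empty set is -oo, the supremum of the empty set. *)
Definition diam U : \bar R :=
  ereal_sup [set z | exists x y, [/\ U x, U y & z = `|x - y|%:E]].

(* |U|^s, with |set0|^s = 0 for every s; since x `^ 0 = 1 for all x, the case
   s = 0 counts the nonempty sets of a cover. *)
Definition diam_pow s U : \bar R :=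
  if `[< U = set0 >] then 0%E else (diam U `^ s)%E.

Definition hausdorff_premeasure s d A : \bar R :=
  ereal_inf [set (\sum_(0 <= i <oo) diam_pow s (U i))%E | U in
    [set U : (set R)^nat |
      A `<=` \bigcup_i U i /\ forall i, (diam (U i) <= d%:E)%E]].

Definition hausdorff_measure s A : \bar R :=
  ereal_sup [set hausdorff_premeasure s d A | d in [set d | 0 < d]].

Definition hausdorff_dim A : \bar R :=
  ereal_inf [set s%:E | s in [set s | 0 <= s /\ hausdorff_measure s A = 0%E]].

End HausdorffDimension.

Section Multifractal.
Variable R : realType.
Implicit Types (f : R -> R[i]) (x g b : R).

(* f stands for a function on [0, 1]: its values elsewhere are never used, so
   the condition is one-sided at the endpoints.  As g >= 0, the bound
   (size Q).-1 <= g is deg Q <= g, the zero polynomial included. *)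
Definition pointwise_holder f g x : Prop :=
  0 <= g /\
  exists Q : {poly R[i]}, ((size Q).-1)%:R <= g /\
  exists M : R, \forall h \near (0 : R)^',
    x + h \in `[0, 1] -> `|f (x + h) - Q.[h%:C]| <= (M * `|h| `^ g)%:C.

Definition holder_exponent f x : \bar R :=
  ereal_sup [set g%:E | g in [set g | pointwise_holder f g x]].

Definition holder_level f b : set R :=
  [set x | x \in `[0, 1] /\ holder_exponent f x = b%:E].

(* None means undefined. *)
Definition spectrum f b : option (\bar R) :=
  if `[< holder_level f b = set0 >] then None
  else Some (hausdorff_dim (holder_level f b)).

(* exp(2 pi i t) *)
Definition e2pi (t : R) : R[i] := cos (2 * pi * t) +i* sin (2 * pi * t).

(* The ascription to R[i]^o provides the norm topology used by the limit. *)
Definition poly_fourier (P : {poly int}) (a x : R) : R[i] :=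
  limn (fun N => \sum_(1 <= n < N.+1)
    e2pi ((P.[n%:Z])%:~R * x) * (n%:R `^ (- a))%:C : R[i]^o).

End Multifractal.

(* Main.v *)
(** Let a be the leading coefficient of P.  If |x - p/q| >= c q^(-tau) for all
    p/q, where tau >= 2, then Weyl's inequality, applied at the points y near x,
    bounds the sum of e(P(n) y) over n <= N by N^(1+eps) max(|y - x|^(1/2), 1/N)^(1/tau),
    and summation by parts turns this into
    beta_F(x) >= (alpha - 1)/2 + 1/(2 tau).
    Conversely, for q coprime to 2a, F(p/q) minus the mean of F over
    [p/q - y, p/q + y] is a sum of e(P(n) p/q) against the nonnegative weights
    n^(-alpha) (1 - sinc(2 pi P(n) y)); since the Gauss sum has modulus sqrt q, it
    is at least c q^(-1/2) y^((alpha-1)/2) for small y.  So infinitely many such p/q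
    with |x - p/q| <= K q^(-tau) force beta_F(x) <= (alpha - 1)/2 + 1/(2 tau); every
    irrational x has them with tau = 2.

    Hence the level set for beta consists of points approximable to every order
    below tau = 1/(2 beta), and the natural covers by neighbourhoods of p/q give
    dimension at most 2/tau = 4 beta.  For the lower bound, counting reduced
    fractions in short intervals yields a Cantor-type map phi from [0, 1[ to points
    approximable to order tau, with |t - t'| <= C |phi t - phi t'|^s for each
    s < 2/tau.  Preimages of H^s-null sets under phi are Lebesgue null.  The points
    approximable to some order above tau are H^s-null for some s < 2/tau, so if the
    level set were H^s-null then all of [0, 1[ would be Lebesgue null. *)

Require Import Defs.
From HB Require Import structures.
From mathcomp Require Import all_boot all_order all_algebra.
From mathcomp Require Import all_classical all_reals all_analysis.
From mathcomp Require Import complex.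
From mathcomp Require Import ring lra zify.

Set Implicit Arguments.
Unset Strict Implicit.
Unset Printing Implicit Defensive.

Import Order.TTheory GRing.Theory Num.Theory.
Import numFieldNormedType.Exports.

Local Open Scope classical_set_scope.
Local Open Scope ring_scope.

(** The upper bound on the exponent needs a Gauss sum that cannot vanish, hence q coprime to 2a, and
    this constraint shapes the arithmetic. Dirichlet's theorem says nothing about the prime factors
    of q, so for irrational x its fractions have to be modified, and the Cantor construction uses
    only denominators congruent to 1 modulo 2a. Replacing e(P(n) p/q) by its mean over a period
    costs about q^(1/2+eps) y^th with th just below alpha/2, against a main term q^(-1/2)
    y^((alpha-1)/2). The cost is the smaller of the two only once y is slightly below q^(-2), so the
    radius is taken to be q^(-tau') with tau' slightly above tau. The upper bounds sought are at
    most 3/4, so Taylor polynomials can be replaced by constants. No measure is built on the level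
    sets: the inverse Hoelder property of phi pulls covers back to the line, where Lebesgue measure
    plays the part of a mass distribution. At beta = 0 the order tau would be infinite, but there
    only nonemptiness is at stake, and a rational point supplies it. *)

Local Arguments e2pi {R} t : simpl never.

(** * Exponential sums *)

Section Exponentials.
Variable R : realType.
Implicit Types (x y t s : R).
Local Notation C := R[i].
Local Notation cabs := (@ComplexField.Normc.normc R).
Local Notation e := (@e2pi R).

Lemma cabsE (z : C) : `|z| = (cabs z)%:C%C.
Proof. by rewrite normc_def; case: z. Qed.

Lemma cabs_ge0 (z : C) : 0 <= cabs z.
Proof. by case: z => a b /=; rewrite sqrtr_ge0. Qed.

Lemma cabs_sum (I : Type) (r : seq I) (Q : pred I) (F : I -> C) :
  cabs (\sum_(i <- r | Q i) F i) <= \sum_(i <- r | Q i) cabs (F i).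
Proof.
elim/big_rec2: _ => [|i y z _ h]; first by rewrite ComplexField.Normc.normc0.
exact: le_trans (le_normcD _ _) (lerD (lexx _) h).
Qed.

Lemma cabsD (z w : C) : cabs (z + w) <= cabs z + cabs w.
Proof. exact: le_normcD. Qed.

Lemma cabsN (z : C) : cabs (- z) = cabs z.
Proof. exact: normcN. Qed.

Lemma cabsB (z w : C) : cabs (z - w) <= cabs z + cabs w.
Proof. by rewrite -[cabs w]cabsN cabsD. Qed.

Lemma cabsBC (z w : C) : cabs (z - w) = cabs (w - z).
Proof. by rewrite -cabsN opprB. Qed.

Lemma cabs_le_dist (z w v : C) : cabs (z - v) <= cabs (z - w) + cabs (w - v).
Proof. by rewrite -[z - v](subrKA w) cabsD. Qed.

Lemma cabsC (a : R) : cabs a%:C%C = `|a|.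
Proof. by rewrite /= expr0n/= addr0 sqrtr_sqr. Qed.

Lemma cabs_sqr (z : C) : cabs z ^+ 2 = complex.Re z ^+ 2 + complex.Im z ^+ 2.
Proof. by case: z => a b /=; rewrite sqr_sqrtr// addr_ge0 ?sqr_ge0. Qed.

Lemma Re_le_cabs (z : C) : `|complex.Re z| <= cabs z.
Proof.
case: z => a b /=; rewrite -sqrtr_sqr ler_wsqrtr// lerDl sqr_ge0//.
Qed.

Lemma Im_le_cabs (z : C) : `|complex.Im z| <= cabs z.
Proof.
case: z => a b /=; rewrite -sqrtr_sqr ler_wsqrtr// lerDr sqr_ge0//.
Qed.

Lemma cabs_le_ReIm (z : C) : cabs z <= `|complex.Re z| + `|complex.Im z|.
Proof.
rewrite -(ler_pXn2r (_ : 0 < 2)%N)// ?nnegrE ?cabs_ge0 ?addr_ge0//.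
rewrite cabs_sqr -(real_normK (num_real (complex.Re z))) -(real_normK (num_real (complex.Im z))).
have := normr_ge0 (complex.Re z); have := normr_ge0 (complex.Im z); nra.
Qed.

Lemma e2piD s t : e (s + t) = e s * e t.
Proof.
rewrite /e2pi mulrDr cosD sinD; apply/eqP; rewrite eq_complex /=.
by rewrite eqxx /= addrC.
Qed.

Lemma e2pi0 : e 0 = 1.
Proof. by rewrite /e2pi mulr0 cos0 sin0. Qed.

Lemma cabs_e2pi t : cabs (e t) = 1.
Proof. by rewrite /e2pi /= cos2Dsin2 sqrtr1. Qed.

Lemma e2piN t : e (- t) = conjc (e t).
Proof. by rewrite /e2pi mulrN cosN sinN. Qed.

Lemma e2piB s t : e (s - t) = e s * conjc (e t).
Proof. by rewrite e2piD e2piN. Qed.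

Lemma e2piNK t : e t * conjc (e t) = 1.
Proof. by rewrite -e2piB subrr e2pi0. Qed.

Lemma e2pi_nat n : e n%:R = 1.
Proof.
elim: n => [|n IH]; first exact: e2pi0.
rewrite -natr1 e2piD IH mul1r /e2pi mulr1.
by rewrite [2 * pi]mulr_natl cos2pi sin2pi.
Qed.

Lemma e2pi_int (z : int) : e z%:~R = 1.
Proof.
case: z => n; first exact: e2pi_nat.
by rewrite NegzE mulrNz e2piN -pmulrn e2pi_nat /= oppr0.
Qed.

Lemma e2piDint t (z : int) : e (t + z%:~R) = e t.
Proof. by rewrite e2piD e2pi_int mulr1. Qed.

Lemma sin_le x : 0 <= x -> sin x <= x.
Proof.
rewrite le_eqVlt => /orP[/eqP<-|x0]; first by rewrite sin0.
have [|c _] := MVT x0 (fun z _ => is_derive_sin z).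
  by apply: continuous_subspaceT => z; exact: continuous_sin.
rewrite sin0 !subr0 => ->.
by rewrite ler_piMl ?cos_le1// ltW.
Qed.

Lemma normr_sin_le x : `|sin x| <= `|x|.
Proof.
wlog x0 : x / 0 <= x.
  move=> H; case: (leP 0 x) => [/H//|x0].
  by rewrite -normrN -sinN -[`|x|]normrN H// oppr_ge0 ltW.
rewrite (ger0_norm x0) ler_norml sin_le//.
rewrite andbT; case: (leP x 1) => x1; last first.
  by rewrite (le_trans _ (sin_geN1 _))// lerN2 ltW.
rewrite (le_trans (_ : _ <= 0))// ?oppr_le0//.
rewrite sin_ge0_pi// x0 (le_trans x1)// (le_trans _ (@pi_ge2 R))//.
by rewrite ler1n.
Qed.

Lemma cabs_e2pi_sub1 t : cabs (e t - 1) = 2 * `|sin (pi * t)|.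
Proof.
apply/eqP; rewrite -(eqrXn2 (_ : 0 < 2)%N) ?cabs_ge0 ?mulr_ge0//.
rewrite cabs_sqr exprMn real_normK ?num_real// /e2pi /=.
have -> : 2 * pi * t = (pi * t) *+ 2 by rewrite -[RHS]mulr_natl mulrA.
rewrite cos_mulr2n sin_mulr2n subr0.
have := cos2Dsin2 (pi * t); set c := cos _; set d := sin _ => H.
have -> : c ^+ 2 = 1 - d ^+ 2 by rewrite -H addrK.
have -> : (c * d *+ 2) ^+ 2 = 4 * c ^+ 2 * d ^+ 2 by ring.
have -> : c ^+ 2 = 1 - d ^+ 2 by rewrite -H addrK.
by apply/eqP; ring.
Qed.

Lemma cabs_e2pi_sub1_le t : cabs (e t - 1) <= 2 * pi * `|t|.
Proof.
rewrite cabs_e2pi_sub1 -mulrA ler_pM2l// (le_trans (normr_sin_le _))//.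
by rewrite normrM (ger0_norm (pi_ge0 R)).
Qed.

Lemma cos_ge x : 1 - x ^+ 2 / 2 <= cos x.
Proof.
have -> : x = (x / 2) *+ 2 by rewrite -mulr_natr divfK.
rewrite cos_mulr2n cos2sin2 -[(x / 2) *+ 2]mulr_natr divfK//.
have : `|sin (x / 2)| ^+ 2 <= `|x / 2| ^+ 2.
  by rewrite lerXn2r ?nnegrE// normr_sin_le.
rewrite !real_normK ?num_real// -mulr_natr expr_div_n; nra.
Qed.

(** On [0, 1] the derivative cos is at least 1/2, which gives x / 2. From 1 to pi / 2 the sine stays
    above sin 1 >= 1/2 while x / 4 < 1/2. *)
Lemma sin_ge x : 0 <= x <= pi / 2 -> x / 4 <= sin x.
Proof.
have h x1 : 0 <= x1 <= 1 -> x1 / 2 <= sin x1.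
  move=> /andP[]; rewrite le_eqVlt => /orP[/eqP<-|x0 xle1]; first by rewrite sin0 mul0r.
  have [|c /itvP cI] := MVT x0 (fun z _ => is_derive_sin z).
    by apply: continuous_subspaceT => z; exact: continuous_sin.
  rewrite sin0 !subr0 => ->; rewrite mulrC ler_pM2r//.
  apply: le_trans (cos_ge c).
  have : c <= 1 by rewrite (le_trans _ xle1)// cI.
  have : 0 <= c by rewrite cI.
  nra.
move=> /andP[x0 xpi]; case: (leP x 1) => x1.
  by apply: le_trans (h _ _); [lra | rewrite x0].
have p1 := @pihalf_ge1 R; have p2 := @pihalf_lt2 R.
have : sin 1 <= sin x.
  rewrite le_eqVlt ltr_sin ?x1 ?orbT// in_itv/=; apply/andP; split; lra.
have := h 1; rewrite ler01 lexx => /(_ isT); lra.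
Qed.

(** A chord of the unit circle against the distance of t to the nearest integer: by symmetry t <=
    1/2, where 2 sin (pi t) >= pi t / 2 >= t. *)
Lemma cabs_e2pi_sub1_ge t : 0 <= t <= 1 -> Num.min t (1 - t) <= cabs (e t - 1).
Proof.
have h u : 0 <= u <= 2^-1 -> u <= cabs (e u - 1).
  move=> /andP[u0 u1]; rewrite cabs_e2pi_sub1.
  have := @sin_ge (pi * u).
  have p := @pi_ge2 R.
  rewrite mulr_ge0 ?pi_ge0//= ler_pM2l ?pi_gt0// => /(_ u1) h.
  apply: le_trans (ler_wpM2l _ (ler_norm _)) => //.
  apply: le_trans (ler_wpM2l _ h) => //.
  nra.
move=> /andP[t0 t1]; case: (leP t 2^-1) => ht.
  by apply: le_trans (h t _); rewrite ?ge_min ?lexx ?t0.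
have -> : e t = e (- (1 - t)).
  by rewrite opprB -[RHS](e2piDint _ 1) subrK.
have -> : cabs (e (- (1 - t)) - 1) = cabs (e (1 - t) - 1).
  by rewrite !cabs_e2pi_sub1 mulrN sinN normrN.
by apply: le_trans (h _ _); rewrite ?ge_min ?lexx ?orbT//; lra.
Qed.

Lemma geometric_e2pi L (u w : R) :
  (\sum_(n < L) e (n%:R * u + w)) * (e u - 1) = e (L%:R * u + w) - e w.
Proof.
elim: L => [|L IH]; first by rewrite big_ord0 !mul0r add0r subrr.
have -> : L.+1%:R * u + w = (L%:R * u + w) + u by rewrite -natr1; ring.
by rewrite big_ord_recr /= mulrDl IH [e (_ + u)]e2piD; ring.
Qed.

Lemma cabs_geometric_e2pi L (u w : R) :
  cabs (\sum_(n < L) e (n%:R * u + w)) * cabs (e u - 1) <= 2.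
Proof.
rewrite -ComplexField.Normc.normcM geometric_e2pi (le_trans (cabsB _ _))//.
by rewrite !cabs_e2pi.
Qed.

Lemma cabs_sum_e2pi_le L (f : nat -> R) : cabs (\sum_(n < L) e (f n)) <= L%:R.
Proof.
rewrite (le_trans (cabs_sum _ _ _))//.
under eq_bigr do rewrite cabs_e2pi.
by rewrite sumr_const card_ord.
Qed.

(* [u] is the distance of the frequency of a linear exponential sum of length
   at most [N] to the nearest integer. *)
Definition lin_bound (N : nat) (u : R) : R := if u * N%:R <= 1 then N%:R else u^-1.

Lemma lin_bound_ge0 N u : 0 <= u -> 0 <= lin_bound N u.
Proof. by move=> u0; rewrite /lin_bound; case: ifP => // _; rewrite invr_ge0. Qed.

Lemma lin_bound_le N (u v : R) : 0 <= u -> 0 < v -> v <= u -> lin_bound N u <= v^-1.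
Proof.
move=> u0 v0 vu; rewrite /lin_bound; case: ifP => h; last by rewrite lef_pV2// posrE (lt_le_trans v0).
rewrite -[v^-1]mul1r ler_pdivlMr// mulrC.
by rewrite (le_trans _ h)// ler_wpM2r.
Qed.

Lemma lin_bound_leN N u : 0 <= u -> lin_bound N u <= N%:R.
Proof.
move=> u0; rewrite /lin_bound; case: ifPn => // ; rewrite -ltNge => h.
have up : 0 < u.
  by rewrite lt_def u0 andbT; apply: contraTneq h => ->; rewrite mul0r ltr10.
by rewrite -[_^-1]mul1r ler_pdivrMr// mulrC ltW.
Qed.

Definition fracpart x : R := x - (Num.floor x)%:~R.

Lemma fracpart_itv x : 0 <= fracpart x < 1.
Proof.
by have /andP[h1 h2] := floor_itv x; rewrite intrD in h2; rewrite /fracpart subr_ge0 h1 ltrBlDl.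
Qed.

(** The bound depends on N and not on L, so that the inner sums of different lengths produced by
    Weyl differencing share it. Adding the bounds for the fractional part and for its complement,
    instead of using the distance to the nearest integer, leaves two sequences that are each
    separated on the line, without wrapping around. *)
Lemma linear_sum_bound L N (u w : R) : (L <= N)%N ->
  cabs (\sum_(n < L) e (n%:R * u + w)) <=
  2 * (lin_bound N (fracpart u) + lin_bound N (1 - fracpart u)).
Proof.
move=> LN; have /andP[f0 f1] := fracpart_itv u.
have eE : e u = e (fracpart u).
  by rewrite -[in LHS](subrK (Num.floor u)%:~R u) e2piDint.
have h1 := cabs_geometric_e2pi L u w; rewrite eE in h1.
have h2 : cabs (\sum_(n < L) e (n%:R * u + w)) <= N%:R.
  by rewrite (le_trans (@cabs_sum_e2pi_le L (fun n => n%:R * u + w)))// ler_nat.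
have h3 := @cabs_e2pi_sub1_ge (fracpart u); rewrite f0 (ltW f1) in h3.
move: h1 h2 (h3 isT).
set S := cabs _; set f := fracpart u; set E := cabs _ => h1 h2 h4.
have S0 : 0 <= S by exact: cabs_ge0.
have f1' : 0 <= 1 - f by rewrite subr_ge0 ltW.
have key v : 0 <= v -> v <= E -> S <= 2 * lin_bound N v.
  move=> v0 vE; rewrite /lin_bound; case: ifPn => h.
    by rewrite (le_trans h2)// ler_peMl// ler1n.
  have vp : 0 < v.
    rewrite lt_def v0 andbT; apply: contraNneq h => ->; by rewrite mul0r ler01.
  by rewrite ler_pdivlMr// (le_trans _ h1)// ler_wpM2l.
rewrite mulrDr; move: h4; rewrite ge_min => /orP[] h.
  by rewrite (le_trans (key _ f0 h))// lerDl mulr_ge0// lin_bound_ge0.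
by rewrite (le_trans (key _ f1' h))// lerDr mulr_ge0// lin_bound_ge0.
Qed.

End Exponentials.

(** * Power sums and summation by parts *)

Section PowerSums.
Variable R : realType.
Implicit Types (x y s : R).

Lemma ln_div_ge x y : 0 < x -> 0 < y -> 1 - x / y <= ln y - ln x.
Proof.
move=> x0 y0; have h : -1 < x / y - 1 by rewrite ltrBrDl subrr divr_gt0.
have := le_ln1Dx h; rewrite addrC subrK ln_div ?posrE//; lra.
Qed.

Lemma powR_expR x s : 0 < x -> x `^ s = expR (s * ln x).
Proof. by move=> x0; rewrite /powR gt_eqF. Qed.

Lemma powRNS x s : 0 < x -> x `^ (- (1 + s)) = x `^ (- s) / x.
Proof.
move=> x0; rewrite opprD addrC powRD; last by rewrite (gt_eqF x0) implybT.
by rewrite powR_inv1// ltW.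
Qed.

(** Convexity of x^(-s): its graph lies above the tangent at y. Written through exp and ln this is
    exp u >= 1 + u together with 1 - x/y <= ln (y/x), and x, y may come in either order. *)
Lemma powRN_sub_ge x y s : 0 < x -> 0 < y -> 0 < s ->
  s * (y - x) * y `^ (- (1 + s)) <= x `^ (- s) - y `^ (- s).
Proof.
move=> x0 y0 s0.
have -> : x `^ (- s) = y `^ (- s) * expR (s * (ln y - ln x)).
  by rewrite !powR_expR// -expRD; congr expR; ring.
have -> : y `^ (- (1 + s)) = y `^ (- s) / y by exact: powRNS.
have h1 := ln_div_ge x0 y0.
have h2 := expR_ge1Dx (s * (ln y - ln x)).
have h3 : s * (1 - x / y) <= s * (ln y - ln x) by rewrite ler_pM2l.
have p0 : 0 <= y `^ (- s) by exact: powR_ge0.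
have -> : s * (y - x) * (y `^ (- s) / y) = y `^ (- s) * (s * (1 - x / y)).
  by field; rewrite gt_eqF.
rewrite -[X in _ <= _ - X]mulr1 -[X in _ <= X]mulrBr ler_wpM2l//; lra.
Qed.

Lemma powRN_sub_le x y s : 0 < x -> 0 < y -> 0 < s ->
  x `^ (- s) - y `^ (- s) <= s * (y - x) * x `^ (- (1 + s)).
Proof.
move=> x0 y0 s0.
have -> : y `^ (- s) = x `^ (- s) * expR (- (s * (ln y - ln x))).
  by rewrite !powR_expR// -expRD; congr expR; ring.
have -> : x `^ (- (1 + s)) = x `^ (- s) / x by exact: powRNS.
have h1 := ln_div_ge y0 x0.
have h2 := expR_ge1Dx (- (s * (ln y - ln x))).
have h3 : s * (1 - y / x) <= s * (ln x - ln y) by rewrite ler_pM2l.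
have p0 : 0 <= x `^ (- s) by exact: powR_ge0.
have -> : s * (y - x) * (x `^ (- s) / x) = x `^ (- s) * (- (s * (1 - y / x))).
  by field; rewrite gt_eqF.
rewrite -[X in X - _ <= _]mulr1 -[X in X <= _]mulrBr ler_wpM2l//; lra.
Qed.

(** The upper bound for zeta(1 + s) given by comparison with an integral. *)
Definition zeta_bound s : R := 1 + s^-1.

Lemma zeta_bound_ge0 s : 0 < s -> 0 <= zeta_bound s.
Proof. by move=> s0; rewrite addr_ge0// invr_ge0 ltW. Qed.

Lemma sum_powRN_le s (N : nat) : 0 < s ->
  \sum_(n < N) n.+1%:R `^ (- (1 + s)) <= zeta_bound s.
Proof.
move=> s0; case: N => [|N]; first by rewrite big_ord0 zeta_bound_ge0.
(* Strengthened to keep the telescoping remainder, which makes the induction go through. *)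
suff : \sum_(n < N.+1) n.+1%:R `^ (- (1 + s)) <= 1 + (1 - N.+1%:R `^ (- s)) / s.
  move/le_trans; apply; rewrite /zeta_bound lerD2l -[X in _ <= X]mul1r ler_pM2r ?invr_gt0//.

elim: N => [|N IH]; first by rewrite big_ord_recr big_ord0 /= !powR1 subrr mul0r addr0 add0r.
rewrite big_ord_recr /= (le_trans (lerD IH (lexx _)))// -addrA lerD2l.
have := @powRN_sub_ge N.+1%:R N.+2%:R s (ltr0Sn _ _) (ltr0Sn _ _) s0.
have -> : N.+2%:R - N.+1%:R = 1 :> R by rewrite -(natr1 N.+1); ring.
rewrite mulr1 -lerBrDl -mulrBl ler_pdivlMr// mulrC => /le_trans; apply.
lra.
Qed.

Lemma sum_by_parts (V : comPzRingType) (g z : nat -> V) N :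
  \sum_(n < N.+1) g n * z n =
  g N * (\sum_(n < N.+1) z n) + \sum_(n < N) (g n - g n.+1) * \sum_(k < n.+1) z k.
Proof.
elim: N => [|N IH]; first by rewrite big_ord0 addr0 !big_ord_recr !big_ord0 /= !add0r.
rewrite big_ord_recr /= IH.
rewrite [X in _ = _ * X + _](big_ord_recr N.+1) [X in _ = _ + X]big_ord_recr /=.
by ring.
Qed.

Lemma sum_by_parts_bound (g z : nat -> R[i]) (B : nat -> R) N :
  (forall n, (n <= N)%N -> ComplexField.Normc.normc (\sum_(k < n.+1) z k) <= B n) ->
  ComplexField.Normc.normc (\sum_(n < N.+1) g n * z n) <=
  ComplexField.Normc.normc (g N) * B N +
  \sum_(n < N) ComplexField.Normc.normc (g n - g n.+1) * B n.
Proof.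
move=> h; rewrite sum_by_parts.
apply: le_trans (cabsD _ _) _; apply: lerD.
  by rewrite ComplexField.Normc.normcM ler_wpM2l ?cabs_ge0// h.
apply: le_trans (cabs_sum _ _ _) _; apply: ler_sum => n _.
by rewrite ComplexField.Normc.normcM ler_wpM2l ?cabs_ge0// h// ltnW.
Qed.

End PowerSums.

(** * Weyl's inequality and quadratic Gauss sums *)

Section WeylSums.
Variable R : realType.
Local Notation C := R[i].
Local Notation cabs := (@ComplexField.Normc.normc R).
Local Notation e := (@e2pi R).

Lemma ler_sum_inj (N M : nat) (J : 'I_N -> 'I_M) (F : 'I_N -> R) (G : 'I_M -> R) :
  injective J -> (forall j, 0 <= G j) -> (forall i, F i <= G (J i)) ->
  \sum_(i < N) F i <= \sum_(j < M) G j.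
Proof.
move=> Jinj G0 FG; apply: le_trans (ler_sum _ (fun i _ => FG i)) _.
have -> : \sum_(i < N) G (J i) = \sum_(i in [set: 'I_N]%SET) G (J i).
  by apply: eq_bigl => i; rewrite finset.in_setT.
rewrite -(@big_imset _ _ _ _ _ J [set: 'I_N]%SET G) /=; last by move=> i j _ _; exact: Jinj.
rewrite [X in _ <= X](bigID (fun j => j \in J @: [set: 'I_N]%SET)) /=.
by rewrite lerDl sumr_ge0.
Qed.

(* [v k] lies in a bin of width [1 / (2 q)], and no two of them in the same. *)
Lemma separated_sum_bound (v : nat -> R) (q k0 L N : nat) :
  (0 < q)%N -> (forall k, 0 <= v k <= 1) ->
  (forall k l : nat, (k0 <= k < l)%N -> (l < k0 + L)%N -> (2 * q%:R)^-1 <= `|v k - v l|) ->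
  \sum_(k0 <= k < k0 + L) lin_bound N (v k) <=
  N%:R + \sum_(j < 2 * q) 2 * q%:R / j.+1%:R.
Proof.
move=> q0 v01 sep.
have q2 : 0 < 2 * q%:R :> R by rewrite mulr_gt0// ltr0n.
pose bin k := Num.truncn (2 * q%:R * v k).
have binP k : (bin k)%:R <= 2 * q%:R * v k < (bin k).+1%:R.
  by apply: truncn_itv; rewrite mulr_ge0 ?(ltW q2)//; case/andP: (v01 k).
have bin_lt k : (bin k < (2 * q).+1)%N.
  have /andP[h _] := binP k; rewrite ltnS -(ler_nat R) (le_trans h)// natrM.
  by rewrite ler_piMr ?(ltW q2)//; case/andP: (v01 k).
rewrite -{1}[k0]add0n big_addn addKn big_mkord.
(* Bin 0 may hold a value arbitrarily close to 0 and costs N; a value in bin j + 1 is at least (j +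
   1) / (2 q). The value 1 falls into bin 2 q, whence 2 q + 1 bins. *)
pose G (j : nat) : R := if j is j'.+1 then 2 * q%:R / j'.+1%:R else N%:R.
apply: le_trans (_ : \sum_(j < (2 * q).+1) G j <= _); last first.
  by rewrite big_ord_recl /=.
apply: (@ler_sum_inj L (2 * q).+1 (fun i => Ordinal (bin_lt (i + k0)%N))).
- have main (i j : 'I_L) : (i < j)%N -> bin (i + k0)%N <> bin (j + k0)%N.
    move=> ij eqb; have := sep (i + k0)%N (j + k0)%N.
    rewrite leq_addl ltn_add2r ij addnC ltn_add2l ltn_ord => /(_ isT isT).
    rewrite leNgt => /negP; apply.
    have /andP[a1 a2] := binP (i + k0)%N; have /andP[b1 b2] := binP (j + k0)%N.
    rewrite -eqb in b1 b2; rewrite ![(k0 + _)%N]addnC.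
    rewrite -[X in _ < X]mul1r ltr_pdivlMr// -[2 * q%:R]gtr0_norm// -normrM mulrBl.
    rewrite -(natr1 (bin _)) in a2; rewrite -(natr1 (bin _)) in b2.
    rewrite ltr_norml ![v _ * _]mulrC.
    by apply/andP; split; lra.
  move=> i j /(congr1 val) /= eqb; apply: val_inj; apply: contrapT => /eqP.
  by rewrite neq_ltn => /orP[] h; [exact: (main _ _ h) | exact: (main _ _ h)].
- by case=> -[|j] ? //=; rewrite divr_ge0// ltW.
move=> i; have /andP[h _] := binP (i + k0)%N; rewrite /G /=.
have v0 : 0 <= v (i + k0)%N by case/andP: (v01 (i + k0)%N).
case E : (bin _) h => [|j] h; first exact: lin_bound_leN.
rewrite -invf_div; apply: lin_bound_le => //; first by rewrite divr_gt0.
by rewrite ler_pdivrMr// mulrC.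
Qed.

(** Since 0 < l - k < q and p is coprime to q, (l - k) p / q is at distance at least 1/q from every
    integer, and replacing p / q by x moves it by at most (l - k) / q^2 <= 1 / (2 q). *)
Lemma fracpart_sep (x : R) (p : int) (q k l : nat) :
  (0 < q)%N -> coprimez p q%:Z -> `|x - p%:~R / q%:R| <= (q%:R ^+ 2)^-1 ->
  (k < l)%N -> ((l - k) * 2 <= q)%N -> (1 < q)%N ->
  (2 * q%:R)^-1 <= `|fracpart (k%:R * x) - fracpart (l%:R * x)|.
Proof.
move=> q0 cpq xpq kl klq q1.
have qR : 0 < q%:R :> R by rewrite ltr0n.
set d := (l - k)%N; have d0 : (0 < d)%N by rewrite subn_gt0.
set z : int := Num.floor (l%:R * x) - Num.floor (k%:R * x).
have -> : fracpart (k%:R * x) - fracpart (l%:R * x) =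
   (z%:~R * q%:R - d%:R * p%:~R) / q%:R - d%:R * (x - p%:~R / q%:R).
  have -> : d%:R = l%:R - k%:R :> R by rewrite /d natrB // ltnW.
  rewrite /fracpart /z intrB.
  move: (_ : int)%:~R (_ : int)%:~R qR => P1 P2; move: (q%:R : R) (k%:R : R) (l%:R : R) p%:~R => Q K K' P1' Q0.
  by field; rewrite gt_eqF.
have nz : z * q%:Z - d%:Z * p != 0.
  apply/negP => /eqP h.
  have : (q%:Z %| d%:Z * p)%Z by rewrite -(subr0_eq h) dvdz_mull.
  rewrite Gauss_dvdzl; last by rewrite coprimez_sym.
  rewrite dvdzE !absz_nat => /(dvdn_leq d0); lia.
have h1 : q%:R^-1 <= `|(z%:~R * q%:R - d%:R * p%:~R) / q%:R| :> R.
  rewrite normrM normfV (gtr0_norm qR) ler_peMl ?invr_ge0 ?(ltW qR)//.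
  have -> : z%:~R * q%:R - d%:R * p%:~R = (z * q%:Z - d%:Z * p)%:~R :> R.
    by rewrite [RHS]intrB !intrM.
  by rewrite -intr_norm -[1]/(1%:~R) ler_int -gtz0_ge1 normr_gt0.
have h2 : `|d%:R * (x - p%:~R / q%:R)| <= (2 * q%:R)^-1.
  rewrite normrM normr_nat; apply: le_trans (ler_wpM2l _ xpq) _ => //.
  rewrite expr2 ler_pdivrMr ?mulr_gt0// invfM mulrA mulfVK ?gt_eqF//.
  rewrite -[_ * q%:R]mulrC ler_pdivlMr// -natrM ler_nat//.
have h3 := lerB_dist ((z%:~R * q%:R - d%:R * p%:~R) / q%:R) (d%:R * (x - p%:~R / q%:R)).
apply: le_trans h3; rewrite lerBrDr; apply: le_trans (lerD (lexx _) h2) _.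
apply: le_trans h1; rewrite invfM -mulrDl; lra.
Qed.

Lemma linear_phase_total_bound (x : R) (p : int) (q K N : nat) :
  (0 < q)%N -> coprimez p q%:Z -> `|x - p%:~R / q%:R| <= (q%:R ^+ 2)^-1 ->
  \sum_(k < K) (lin_bound N (fracpart (k%:R * x)) + lin_bound N (1 - fracpart (k%:R * x)))
  <= (2 * K%:R / q%:R + 1) * (2 * (N%:R + \sum_(j < 2 * q) 2 * q%:R / j.+1%:R)).
Proof.
move=> q0 cpq xpq.
have qR : 0 < q%:R :> R by rewrite ltr0n.
(* Separation is available only for indices differing by at most q / 2, so the range is cut into
   blocks of this length. *)
pose L := uphalf q.
have L0 : (0 < L)%N by rewrite /L; lia.
set A := N%:R + _.
have A0 : 0 <= A by rewrite addr_ge0 ?sumr_ge0// => j _; rewrite divr_ge0// mulr_ge0.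
pose v1 k := fracpart (k%:R * x : R); pose v2 k := 1 - v1 k.
have v1P k : 0 <= v1 k <= 1.
  by have /andP[h1 h2] := fracpart_itv (k%:R * x : R); rewrite h1 ltW.
have v2P k : 0 <= v2 k <= 1.
  by have := v1P k; rewrite /v2 => /andP[h1 h2]; rewrite subr_ge0 h2 lerBlDr lerDl.
have sep1 k0 k l : (k0 <= k < l)%N -> (l < k0 + L)%N -> (2 * q%:R)^-1 <= `|v1 k - v1 l|.
  move=> /andP[h1 h2] h3.
  by apply: (@fracpart_sep x p) => //; rewrite /L in h3; lia.
have sep2 k0 k l : (k0 <= k < l)%N -> (l < k0 + L)%N -> (2 * q%:R)^-1 <= `|v2 k - v2 l|.
  move=> h1 h2; have := sep1 _ _ _ h1 h2; rewrite /v2 distrC.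
  by have -> : v1 l - v1 k = 1 - v1 k - (1 - v1 l) by ring.
have blocks B : \sum_(0 <= k < B * L) (lin_bound N (v1 k) + lin_bound N (v2 k)) <= B%:R * (2 * A).
  elim: B => [|B IH]; first by rewrite mul0n big_geq// mul0r.
  rewrite (@big_cat_nat _ _ _ (B * L)%N) ?leq_mul2r ?leqnSn ?orbT//=.
  rewrite -natr1 mulrDl mul1r lerD// mulSn [(L + _)%N]addnC big_split /=.
  have := separated_sum_bound N q0 v1P (sep1 (B * L)%N).
  have := separated_sum_bound N q0 v2P (sep2 (B * L)%N).
  rewrite -/A; lra.
pose B := (K %/ L).+1.
have KB : (K <= B * L)%N by rewrite /B ltnW// ltn_ceil.
apply: le_trans (_ : _ <= B%:R * (2 * A)) _.
  apply: le_trans (blocks B); rewrite -(big_mkord xpredT (fun k => lin_bound N (v1 k) + lin_bound N (v2 k))).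
  rewrite [X in _ <= X](@big_cat_nat _ _ _ K)//= lerDl sumr_ge0// => k _.
  by rewrite addr_ge0// lin_bound_ge0//; [case/andP: (v1P k) | case/andP: (v2P k)].
rewrite ler_wpM2r ?mulr_ge0// /B -natr1 lerD2r ler_pdivlMr//.
rewrite -natrM -natrM ler_nat.
have : (q <= 2 * L)%N by rewrite /L; lia.
move=> qL; apply: leq_trans (leq_mul (leqnn _) qL) _.
by rewrite mulnCA leq_mul2l /= leq_trunc_div.
Qed.

Lemma sum_triangle (V : nmodType) (g : nat -> nat -> V) N :
  \sum_(h < N.+1) \sum_(j < N.+1 - h.+1) g (j + h.+1)%N j =
  \sum_(h < N) \sum_(j < N - h.+1) g (j + h.+1)%N j + \sum_(j < N) g N j.
Proof.
rewrite big_ord_recr /= subnn big_ord0 addr0.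
rewrite [X in _ = _ + X](reindex_inj rev_ord_inj) -big_split /=.
apply: eq_bigr => h _; rewrite subSn// big_ord_recr /=; congr (_ + g _ _).
by rewrite subnK.
Qed.

(** Weyl differencing: in the expanded square the diagonal gives N, and the other pairs, sorted by
    the difference h + 1 of their indices, come with their conjugates. *)
Lemma sqr_sum_e2pi (f : nat -> R) N :
  cabs (\sum_(n < N) e (f n)) ^+ 2 <=
  N%:R + 2 * \sum_(h < N) cabs (\sum_(j < N - h.+1) e (f (j + h.+1)%N - f j)).
Proof.
set T : C := \sum_(n < N) e (f n).
pose g i j := e (f i - f j).
pose S M := \sum_(h < M) \sum_(j < M - h.+1) g (j + h.+1)%N j.
have key M : (\sum_(n < M) e (f n)) * conjc (\sum_(n < M) e (f n)) =
    M%:R + S M + conjc (S M).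
  elim: M => [|M IH]; first by rewrite /S !big_ord0 conjc0 mul0r !addr0.
  rewrite /S sum_triangle -/(S M) big_ord_recr /=; set A := \sum_(i < M) e _ in IH *.
  have -> : \sum_(j < M) g M j = e (f M) * conjc A.
    rewrite /A rmorph_sum mulr_sumr; apply: eq_bigr => j _.
    by rewrite /g e2piB.
  have cD (z1 z2 : C) : conjc (z1 + z2) = conjc z1 + conjc z2 by exact: rmorphD.
  have cM (z1 z2 : C) : conjc (z1 * z2) = conjc z1 * conjc z2 by exact: rmorphM.
  rewrite !cD cM conjcK -natr1.
  move: (e2piNK (f M)) IH.
  move: (M%:R : C) (A : C) (e (f M)) (S M : C) (conjc (S M)) (conjc A) (conjc (e (f M))).
  move=> n A1 z S1 S' B w zz IH.
  have -> : (A1 + z) * (B + w) = A1 * B + z * w + A1 * w + z * B by ring.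
  by rewrite IH zz; ring.
have -> : cabs T ^+ 2 = N%:R + 2 * complex.Re (S N).
  apply: (@complexI R); rewrite rmorphXn /= -cabsE sqr_normc /T key.
  by rewrite -addrA addcJ rmorphD rmorphM /= !rmorph_nat.
rewrite lerD2l ler_pM2l// (le_trans (ler_norm _))// (le_trans (Re_le_cabs _))//.
exact: cabs_sum.
Qed.

(** A power M^s replaces the logarithm, since 1/j <= M^s j^(-1-s) for j <= M. An arbitrarily small
    loss in the exponent is harmless in what follows. *)
Lemma sum_harmonic_le (s : R) M : 0 < s -> (0 < M)%N ->
  \sum_(j < M) j.+1%:R^-1 <= zeta_bound s * M%:R `^ s.
Proof.
move=> s0 M0; apply: le_trans (ler_wpM2r (powR_ge0 _ _) (sum_powRN_le M s0)).
rewrite mulr_suml; apply: ler_sum => j _.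
rewrite powRNS// mulrAC -[X in X <= _]mul1r ler_wpM2r ?invr_ge0//.
rewrite powRN mulrC ler_pdivlMr ?powR_gt0// mul1r ge0_ler_powR ?nnegrE ?ler_nat ?ltn_ord ?(ltW s0)//.
Qed.

(** Differencing turns the phase into a linear one of slope 2 a (h + 1) x. The coefficients v and w
    only contribute a factor of modulus 1, so the constant depends on a and s alone. *)
Lemma weyl_quadratic (a : nat) (s : R) : (0 < a)%N -> 0 < s ->
  exists2 K : R, 0 <= K & forall (x v w : R) (p : int) (q N : nat),
    (0 < q)%N -> coprimez p q%:Z -> `|x - p%:~R / q%:R| <= (q%:R ^+ 2)^-1 ->
    cabs (\sum_(n < N) e (a%:R * x * n%:R ^+ 2 + v * n%:R + w)) ^+ 2
      <= K * q%:R `^ s * (N%:R ^+ 2 / q%:R + N%:R + q%:R).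
Proof.
move=> a0 s0.
pose Z := zeta_bound s * 2 `^ s.
have Z1 : 1 <= Z.
  have h1 : 1 <= zeta_bound s by rewrite lerDl invr_ge0 ltW.
  have h2 : 1 <= 2 `^ s :> R by rewrite -[X in X <= _](powRr0 2) ler_powR ?ler1n ?ltW.
  by rewrite -[1]mulr1 ler_pM.
exists (1 + 64 * (2 * a%:R + 3) * Z); first by have : 0 <= a%:R :> R by []; nra.
move=> x v w p q N q0 cpq xpq.
have qR : 1 <= q%:R :> R by rewrite ler1n.
have qs1 : 1 <= q%:R `^ s by rewrite -[X in X <= _](powRr0 q%:R) ler_powR// ltW.
case: N => [|N'].
  rewrite big_ord0 ComplexField.Normc.normc0 expr0n/= mulr_ge0// ?addr_ge0//.
  by rewrite mulr_ge0 ?powR_ge0//; have : 0 <= a%:R :> R by []; nra.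
set N := N'.+1.
have NR : 1 <= N%:R :> R by rewrite ler1n.
pose f n := a%:R * x * n%:R ^+ 2 + v * n%:R + w : R.
apply: le_trans (sqr_sum_e2pi f N) _.
pose LB k := lin_bound N (fracpart (k%:R * x)) + lin_bound N (1 - fracpart (k%:R * x)).
have LB0 k : 0 <= LB k.
  have /andP[h1 h2] := fracpart_itv (k%:R * x : R).
  by rewrite addr_ge0// lin_bound_ge0// subr_ge0 ltW.
have step1 : \sum_(h < N) cabs (\sum_(j < N - h.+1) e (f (j + h.+1)%N - f j)) <=
   2 * \sum_(k < 2 * a * N + 1) LB k.
  rewrite mulr_sumr.
  have lt1 (h : 'I_N) : (2 * a * h.+1 < 2 * a * N + 1)%N.
    by rewrite addn1 ltnS leq_mul2l ltn_ord orbT.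
  (* The frequencies 2 a (h + 1) are distinct, so the sum over h is extended to all multiples k x
     with k <= 2 a N. *)
  apply: (@ler_sum_inj N _ (fun h => Ordinal (lt1 h)) _ (fun k => 2 * LB k)).
  - move=> i j /(congr1 val)/= /eqP; rewrite eqn_pmul2l ?muln_gt0// => /eqP[].
    exact: val_inj.
  - by move=> k; rewrite mulr_ge0.
  move=> h /=.
  have -> : \sum_(j < N - h.+1) e (f (j + h.+1)%N - f j) =
    \sum_(j < N - h.+1) e (j%:R * ((2 * a * h.+1)%:R * x) + (a%:R * x * h.+1%:R ^+ 2 + v * h.+1%:R)).
    apply: eq_bigr => j _; congr (e _); rewrite /f natrD !natrM.
    by move: (h.+1%:R : R) (j%:R : R) (a%:R : R) => ???; ring.
  by apply: linear_sum_bound; rewrite leq_subr.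
have step2 := linear_phase_total_bound (2 * a * N + 1) N q0 cpq xpq.
have H : \sum_(j < 2 * q) 2 * q%:R / j.+1%:R <= 2 * q%:R * (Z * q%:R `^ s).
  rewrite -mulr_sumr ler_wpM2l ?mulr_ge0//.
  have := @sum_harmonic_le s (2 * q)%N s0; rewrite muln_gt0 q0 => /(_ isT) /le_trans; apply.
  by rewrite natrM powRM// mulrA.
set W := Z * q%:R `^ s in H *.
have W1 : 1 <= W by rewrite -[1]mulr1 ler_pM.
apply: le_trans (lerD (lexx _) (ler_wpM2l _ (le_trans step1 (ler_wpM2l _ step2)))) _ => //.
set SS := \sum_(j < _) _ in H *.
have q1 : 0 < q%:R :> R by lra.
have -> : (1 + 64 * (2 * a%:R + 3) * Z) * q%:R `^ s = q%:R `^ s + 64 * (2 * a%:R + 3) * W.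
  by rewrite /W; ring.
have aux : 2 * (2 * a * N + 1)%:R / q%:R + 1 <= 2 * (2 * a%:R + 3) * (N%:R / q%:R + 1) :> R.
  rewrite natrD !natrM; have q1i : q%:R^-1 <= 1 :> R by rewrite invf_le1.
  have : 0 <= q%:R^-1 :> R by rewrite invr_ge0 ltW.
  have : 0 <= a%:R :> R by [].
  move: (q%:R^-1 : R) q1i (a%:R : R) (N%:R : R) NR => i ? aa n n1 *.
  have : 0 <= n * i by rewrite mulr_ge0//; lra.
  have : 0 <= aa * (n * i) by rewrite !mulr_ge0//; lra.
  rewrite -!mulrA; lra.
have aux2 : 2 * (N%:R + SS) <= 4 * W * (N%:R + q%:R).
  apply: le_trans (_ : 2 * (N%:R + 2 * q%:R * W) <= _); first by rewrite ler_pM2l// lerD2l.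
  have : N%:R <= W * N%:R by rewrite ler_peMl//; lra.
  by move: (N%:R : R) NR (q%:R : R) q1 W W1 {H} => n n1 Q Q0 w' w1 h; nra.
have SS0 : 0 <= SS by rewrite sumr_ge0// => j _; rewrite divr_ge0// mulr_ge0// ltW.
have p1 : 0 <= N%:R / q%:R + 1 :> R by rewrite addr_ge0// divr_ge0// ltW.
have a0R : 0 <= a%:R :> R by [].
apply: le_trans (_ : N%:R + 2 * (2 * ((2 * (2 * a%:R + 3) * (N%:R / q%:R + 1)) * (4 * W * (N%:R + q%:R)))) <= _).
  rewrite lerD2l ler_pM2l// ler_pM2l// ler_pM//; last by rewrite mulr_ge0// addr_ge0//; lra.
rewrite -(mulrA (2 * (2 * a%:R + 3))).
have -> : (N%:R / q%:R + 1) * (4 * W * (N%:R + q%:R)) = 4 * W * (N%:R ^+ 2 / q%:R + 2 * N%:R + q%:R).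
  by field; rewrite gt_eqF.
have nq0 : 0 <= N%:R ^+ 2 / q%:R :> R by rewrite divr_ge0 ?exprn_ge0// ltW.
have -> : 2 * (2 * (2 * (2 * a%:R + 3) * (4 * W * (N%:R ^+ 2 / q%:R + 2 * N%:R + q%:R)))) =
   32 * ((2 * a%:R + 3) * W) * (N%:R ^+ 2 / q%:R + 2 * N%:R + q%:R) by ring.
set X := N%:R ^+ 2 / q%:R in nq0 *.
have W0 : 0 <= (2 * a%:R + 3) * W by rewrite mulr_ge0//; lra.
rewrite [X in _ <= X]mulrDl lerD//.
  apply: le_trans (_ : 1 * (X + N%:R + q%:R) <= _); first by lra.
  by rewrite ler_wpM2r//; lra.
have -> : 64 * (2 * a%:R + 3) * W * (X + N%:R + q%:R) =
  32 * ((2 * a%:R + 3) * W) * (2 * (X + N%:R + q%:R)) by ring.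
by rewrite ler_wpM2l//; [rewrite mulr_ge0 | lra].
Qed.

Lemma sum_shift_periodic (V : nmodType) (g : nat -> V) (q m : nat) :
  (forall n, g (n + q)%N = g n) -> \sum_(n < q) g (n + m)%N = \sum_(n < q) g n.
Proof.
move=> gq; elim: m => [|m IH]; first by apply: eq_bigr => n _; rewrite addn0.
rewrite -{}IH; case: q gq => [|q] gq; first by rewrite !big_ord0.
rewrite big_ord_recr big_ord_recl /= addrC; congr (_ + _); last first.
  by apply: eq_bigr => n _; rewrite addSnnS.
by rewrite addnS addnC -addnS gq.
Qed.

Lemma e2pi_eq1 (u : R) : e u = 1 -> u = (Num.floor u)%:~R.
Proof.
move=> eu; have /andP[f0 f1] := fracpart_itv u.
have := @cabs_e2pi_sub1_ge R (fracpart u).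
rewrite f0 (ltW f1) => /(_ isT).
have -> : e (fracpart u) = 1 by rewrite -eu -[in RHS](subrK (Num.floor u)%:~R u) e2piDint.
have /negbTE f2' : ~~ (1 - fracpart u <= 0) by rewrite subr_le0 -ltNge.
rewrite subrr ComplexField.Normc.normc0 ge_min f2' orbF => f2.
by apply/eqP; rewrite -subr_eq0 eq_le f0 f2.
Qed.

(** By periodicity the squared modulus is a sum over shifts h of sums over m whose phase is linear
    in m, of slope 2 a h p / q. For h = 0 this gives q; for 0 < h < q the slope is not an integer,
    because q is coprime to 2 a p, and the geometric sum over a full period vanishes. *)
Lemma gauss_sum_modulus (a : nat) (v w p : int) (q : nat) :
  (0 < q)%N -> coprime (2 * a) q -> coprimez p q%:Z ->
  cabs (\sum_(n < q) e ((a%:Z * n%:Z ^+ 2 + v * n%:Z + w)%:~R * (p%:~R / q%:R))) ^+ 2 = q%:R.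
Proof.
move=> q0 caq cpq.
have qR : q%:R != 0 :> R by rewrite pnatr_eq0 -lt0n.
pose k (n : nat) : int := a%:Z * n%:Z ^+ 2 + v * n%:Z + w.
pose z n := e ((k n)%:~R * (p%:~R / q%:R)).
have zq n : z (n + q)%N = z n.
  rewrite /z -[RHS](e2piDint _ ((2 * a%:Z * n%:Z + a%:Z * q%:Z + v) * p)); congr e.
  have -> : k (n + q)%N = k n + q%:Z * (2 * a%:Z * n%:Z + a%:Z * q%:Z + v).
    by rewrite /k PoszD; ring.
  rewrite intrD !intrM; move: (k n)%:~R (_ + v)%:~R p%:~R => A B D.
  have -> : (q%:Z)%:~R = q%:R :> R by [].
  by field.
set T : C := \sum_(n < q) _; have TE : T = \sum_(n < q) z n by [].
apply: (@complexI R); rewrite rmorphXn /= -cabsE sqr_normc.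
have -> : T * conjc T = \sum_(h < q) \sum_(m < q) z (h + m)%N * conjc (z m).
  rewrite exchange_big /= TE rmorph_sum mulr_sumr; apply: eq_bigr => m _.
  by rewrite -mulr_suml (sum_shift_periodic m zq).
rewrite (bigD1 (Ordinal q0)) //= [X in _ + X]big1 ?addr0.
  under eq_bigr do rewrite add0n e2piNK.
  by rewrite sumr_const card_ord rmorph_nat.
move=> h hn0.
have h0 : (0 < h)%N by rewrite lt0n; apply: contraNneq hn0 => hh; apply/eqP/val_inj.
pose u : R := (2 * a%:Z * h%:Z * p)%:~R / q%:R.
pose c : R := (a%:Z * h%:Z ^+ 2 + v * h%:Z)%:~R * (p%:~R / q%:R).
have -> : \sum_(m < q) z (h + m)%N * conjc (z m) = \sum_(m < q) e (m%:R * u + c).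
  apply: eq_bigr => m _; rewrite -e2piB /u /c; congr e.
  have -> : k (h + m)%N = k m + m%:Z * (2 * a%:Z * h%:Z) + (a%:Z * h%:Z ^+ 2 + v * h%:Z).
    by rewrite /k PoszD; ring.
  move: (k m) => A; rewrite !intrD !intrM; move: A%:~R => {}A.
  have -> : (m%:Z)%:~R = m%:R :> R by [].
  by field.
(* As q u is an integer, the sum times [e u - 1] is zero; [e u = 1] would make q divide h. *)
have := geometric_e2pi q u c.
have -> : q%:R * u + c = c + (2 * a%:Z * h%:Z * p)%:~R by rewrite /u mulrC divfK// addrC.
rewrite e2piDint subrr => /eqP; rewrite mulf_eq0 => /orP[/eqP//|].
rewrite subr_eq0 => /eqP /e2pi_eq1 uE; exfalso.
have : (2 * a%:Z * h%:Z * p) = Num.floor u * q%:Z.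
  apply/eqP; rewrite -(eqr_int R) [X in _ == X]intrM -uE /u; apply/eqP.
  by rewrite -[(q%:Z)%:~R]/(q%:R) divfK.
move=> E; have : (q%:Z %| 2 * a%:Z * h%:Z * p)%Z by rewrite E dvdz_mull.
rewrite Gauss_dvdzl; last by rewrite coprimez_sym.
rewrite Gauss_dvdzr; last by rewrite coprimez_sym coprimezE abszM.
by rewrite dvdzE !absz_nat => /(dvdn_leq h0); rewrite leqNgt ltn_ord.
Qed.

End WeylSums.

Lemma eq_imply_le (R : numDomainType) (x y : R) : x = y -> x <= y.
Proof. by move=> ->. Qed.

Lemma powR_add (R : realType) (x r s : R) : 0 < x -> x `^ r * x `^ s = x `^ (r + s).
Proof. by move=> x0; rewrite powRD// (gt_eqF x0) implybT. Qed.

(** * Increments of the series at badly approximable points *)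

Section Series.
Variables (R : realType) (P : {poly int}) (alpha : R).
Hypotheses (degP : size P = 3%N) (leadP : 0 < lead_coef P).
Hypotheses (alpha_gt1 : 1 < alpha) (alpha_le2 : alpha <= 2).
Local Notation C := R[i].
Local Notation cabs := (@ComplexField.Normc.normc R).
Local Notation e := (@e2pi R).
Local Notation F := (poly_fourier P alpha).

Definition lead_nat : nat := `|lead_coef P|%N.

Lemma lead_nat_gt0 : (0 < lead_nat)%N.
Proof. by rewrite absz_gt0 gt_eqF. Qed.

Lemma lead_natE : P`_2 = lead_nat%:Z.
Proof. by rewrite /lead_nat /lead_coef degP /= gtz0_abs//; move: leadP; rewrite /lead_coef degP. Qed.

(* Summation indices are shifted by one, so that sums start at 0. *)
Definition poly_value (n : nat) : int := P.[n.+1%:Z].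

Lemma poly_valueE n : poly_value n = lead_nat%:Z * n.+1%:Z ^+ 2 + P`_1 * n.+1%:Z + P`_0.
Proof.
rewrite /poly_value horner_coef degP !big_ord_recl big_ord0 /= expr0 expr1 mulr1 addr0.
by rewrite lead_natE; ring.
Qed.

Lemma poly_value_shift n : poly_value n = lead_nat%:Z * n%:Z ^+ 2 + (2 * lead_nat%:Z + P`_1) * n%:Z + (lead_nat%:Z + P`_1 + P`_0).
Proof. by rewrite poly_valueE -natr1; ring. Qed.

Definition weight n : R := n.+1%:R `^ (- alpha).
Definition phase x n : C := e ((poly_value n)%:~R * x).
Definition weyl_sum x N : C := \sum_(n < N) phase x n.
Definition partial_sum x N : C := \sum_(n < N) (weight n)%:C%C * phase x n.

Lemma weight_ge0 n : 0 <= weight n. Proof. exact: powR_ge0. Qed.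

Lemma cabs_phase x n : cabs (phase x n) = 1. Proof. exact: cabs_e2pi. Qed.

Lemma sum_weight_le N : \sum_(n < N) weight n <= zeta_bound (alpha - 1).
Proof.
have h : 0 < alpha - 1 by rewrite subr_gt0.
by have := sum_powRN_le N h; rewrite addrC subrK.
Qed.

Lemma sum_weight_tail s : 0 < s ->
  exists N0 : nat, forall N M, (N0 <= N)%N -> (N <= M)%N ->
    \sum_(n < M) weight n - \sum_(n < N) weight n <= s.
Proof.
move=> s0; pose W N := \sum_(n < N) weight n.
have Wincr : {homo W : n m / (n <= m)%N >-> n <= m}.
  apply/nondecreasing_seqP => n.
  by rewrite /W big_ord_recr /= lerDl weight_ge0.
have cW : cvgn W.
  apply: nondecreasing_is_cvgn => //.
  by exists (zeta_bound (alpha - 1)) => _ [n _ <-]; exact: sum_weight_le.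
have /cvgrPdist_le /(_ s s0) [N0 _ h] := cW.
exists N0 => N M N0N NM.
apply: le_trans (_ : limn W - W N <= _).
  by rewrite lerB// nondecreasing_cvgn_le.
by apply: le_trans (ler_norm _) _; exact: h.
Qed.

Lemma partial_sum_tail x N M : (N <= M)%N ->
  cabs (partial_sum x M - partial_sum x N) <= \sum_(n < M) weight n - \sum_(n < N) weight n.
Proof.
move=> NM; rewrite /partial_sum -!(big_mkord xpredT (fun n => (weight n)%:C%C * phase x n)).
rewrite -!(big_mkord xpredT weight) !(@big_cat_nat _ _ _ N 0%N M)//=.
rewrite addrAC subrr add0r addrAC subrr add0r.
apply: le_trans (cabs_sum _ _ _) _; apply: ler_sum => n _.
by rewrite ComplexField.Normc.normcM cabs_phase mulr1 cabsC ger0_norm// weight_ge0.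
Qed.

Lemma partial_sum_cvg x (proj : C -> R) : (forall z, `|proj z| <= cabs z) ->
  (forall z w, proj (z - w) = proj z - proj w) ->
  cvgn (fun N => proj (partial_sum x N)).
Proof.
move=> pr_le prB; apply/cauchy_cvgP/cauchyP => s s0.
have [N0 hN] := @sum_weight_tail (s / 2) ltac:(by rewrite divr_gt0).
exists (proj (partial_sum x N0)); exists N0 => // N /= N0N.
rewrite /ball /= -prB (le_lt_trans (pr_le _))// cabsBC (le_lt_trans (partial_sum_tail _ N0N))//.
by rewrite (le_lt_trans (hN _ _ (leqnn _) N0N))// ltr_pdivrMr// ltr_pMr// ltr1n.
Qed.

Lemma poly_fourier_approx s : 0 < s ->
  exists N0 : nat, forall N x, (N0 <= N)%N -> cabs (F x - partial_sum x N) <= s.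
Proof.
move=> s0.
have approx x : exists L : C, limn (fun N => partial_sum x N : C^o) = L /\
    forall d, 0 < d -> \forall N \near \oo, cabs (L - partial_sum x N) <= d.
  have cR := @partial_sum_cvg x (@complex.Re R) (@Re_le_cabs R) (fun z w => raddfB (@complex.Re R : Rcomplex R -> R) z w).
  have cI := @partial_sum_cvg x (@complex.Im R) (@Im_le_cabs R) (fun z w => raddfB (@complex.Im R : Rcomplex R -> R) z w).
  set lR := limn _ in cR; set lI := limn _ in cI.
  have h d : 0 < d -> \forall N \near \oo, cabs ((lR +i* lI)%C - partial_sum x N) <= d.
    move=> d0; have d2 : 0 < d / 2 by rewrite divr_gt0.
    have /cvgrPdist_le /(_ _ d2) hR := cR; have /cvgrPdist_le /(_ _ d2) hI := cI.
    near=> N; apply: le_trans (cabs_le_ReIm _) _.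
    rewrite [d]splitr lerD//.
      by rewrite (raddfB (@complex.Re R : Rcomplex R -> R)) /=; near: N.
    by rewrite (raddfB (@complex.Im R : Rcomplex R -> R)) /=; near: N.
  exists (lR +i* lI)%C; split=> //.
  apply: cvg_lim; first exact: norm_hausdorff.
  (* Radii in [R[i]^o] are complex: z > 0 means that its imaginary part is zero and its real part
     positive. *)
  apply/cvgrPdist_le => /= z; rewrite ltcE /= => /andP[/eqP z0 zp].
  have := h _ zp; apply: filterS => N hN.
  by rewrite cabsE [z]complexE z0 mulr0 addr0 lecR.
have [N0 hN] := sum_weight_tail s0.
exists N0 => N x N0N.
have [L [LE hL]] := approx x.
have -> : F x = L.
  rewrite -LE /poly_fourier; apply: (congr1 (fun f : nat -> C^o => limn f)).
  apply/funext => M; rewrite /partial_sum big_add1 big_mkord.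
  by apply: eq_bigr => n _; rewrite mulrC.
apply/ler_addgt0Pr => d d0.
have [N1 _ hN1] := hL _ d0.
pose M := maxn N N1.
apply: le_trans (cabs_le_dist _ (partial_sum x M) _) _.
rewrite addrC lerD//; last by apply: hN1; rewrite /= /M leq_maxr.
by apply: le_trans (partial_sum_tail _ _) _; rewrite ?leq_maxl// hN// leq_maxl.
Unshelve. all: by end_near. Qed.

Lemma poly_value_growth : exists2 K : R, 0 < K & forall n,
  `|(poly_value n)%:~R| <= K * n.+1%:R ^+ 2 /\
  `|(poly_value n.+1)%:~R - (poly_value n)%:~R| <= K * n.+1%:R.
Proof.
pose b := `|(P`_1)%:~R : R|; pose c := `|(P`_0)%:~R : R|.
have b0 : 0 <= b by exact: normr_ge0. have c0 : 0 <= c by exact: normr_ge0.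
have a1 : 1 <= lead_nat%:R :> R by rewrite ler1n lead_nat_gt0.
exists (3 * lead_nat%:R + b + c); first by lra.
move=> n; have n1 : 1 <= n.+1%:R :> R by rewrite ler1n.
have PvR k : (poly_value k)%:~R = lead_nat%:R * k.+1%:R ^+ 2 + (P`_1)%:~R * k.+1%:R + (P`_0)%:~R :> R.
  by rewrite poly_valueE !intrD !intrM.
split.
  rewrite PvR; set m := n.+1%:R in n1 *.
  apply: le_trans (ler_normD _ _) _; apply: le_trans (lerD (ler_normD _ _) (lexx _)) _.
  rewrite !normrM -/b -/c !ger0_norm ?exprn_ge0//; try lra.
  have : m <= m ^+ 2 by rewrite expr2 ler_peMl//; lra.
  move=> hm; have m2 : 1 <= m ^+ 2 by lra.
  have : b * m <= b * m ^+ 2 by rewrite ler_wpM2l.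
  have : c <= c * m ^+ 2 by rewrite ler_peMr.
  have : 0 <= lead_nat%:R * m ^+ 2 by rewrite mulr_ge0//; lra.
  lra.
rewrite !PvR -(natr1 n.+1); set m := n.+1%:R in n1 *.
have -> : lead_nat%:R * (m + 1) ^+ 2 + (P`_1)%:~R * (m + 1) + (P`_0)%:~R -
   (lead_nat%:R * m ^+ 2 + (P`_1)%:~R * m + (P`_0)%:~R) = lead_nat%:R * (2 * m + 1) + (P`_1)%:~R.
  by move: (P`_1)%:~R (P`_0)%:~R (lead_nat%:R : R) => ? ? ?; ring.
apply: le_trans (ler_normD _ _) _; rewrite -/b normrM !ger0_norm; try lra.
have : b <= b * m by rewrite ler_peMr.
have : c <= c * m by rewrite ler_peMr.
have : lead_nat%:R <= lead_nat%:R * m by rewrite ler_peMr//; lra.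
lra.
Qed.

(** The scale sqrt |h| appears because P(n) h stays bounded for n up to about |h|^(-1/2): shorter
    sums behave as at x itself, and longer ones stop improving. *)
Definition sums_small (x kappa s : R) := exists2 K : R, 0 <= K & forall h M,
  `|h| <= 1 -> cabs (weyl_sum (x + h) M.+1) <=
    K * M.+1%:R `^ (1 + s) * (Num.max (Num.sqrt `|h|) M.+1%:R^-1) `^ kappa.

(** Put r = sqrt |h| and m = M + 1. If m r >= 1, the two sums are bounded separately and the factor
    (m r)^vt is at least 1. Otherwise summation by parts against e(P(n) h) - 1, of size (m r)^2,
    gives (m r)^(2 - kappa) r^kappa, and 2 - kappa >= 3/2 >= vt. The free exponent vt is fixed when
    the weights enter. *)
Lemma weyl_sum_diff_bound (x kappa s : R) : 0 <= kappa <= 2^-1 -> 0 < s -> sums_small x kappa s ->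
  exists2 K : R, 0 <= K & forall (h : R) M (vt : R), 0 < `|h| <= 1 -> 0 <= vt <= 3 / 2 ->
    cabs (\sum_(n < M.+1) (phase (x + h) n - phase x n)) <=
    K * M.+1%:R `^ (1 + s) * Num.sqrt `|h| `^ kappa * (M.+1%:R * Num.sqrt `|h|) `^ vt.
Proof.
move=> /andP[k0 k1] s0 [K K0 hK].
have [K1 K10 hK1] := poly_value_growth.
exists (2 * K + 4 * pi * K1 * K).
  by rewrite addr_ge0// !mulr_ge0// ?pi_ge0// ltW.
move=> h M vt /andP[h0 h1] /andP[vt0 vt1]; set r := Num.sqrt `|h|.
have r0 : 0 < r by rewrite sqrtr_gt0.
have hr : `|h| = r * r by rewrite -expr2 sqr_sqrtr// ltW.
set m : R := M.+1%:R; have m1 : 1 <= m by rewrite ler1n.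
have m0 : 0 < m by lra.
have K20 : 0 <= 4 * pi * K1 * K by rewrite !mulr_ge0// ?pi_ge0// ltW.
have x0E k : cabs (weyl_sum x k.+1) <= K * k.+1%:R `^ (1 + s) * k.+1%:R^-1 `^ kappa.
  have := hK 0 k; rewrite normr0 addr0 sqrtr0 => /(_ ler01) /le_trans; apply.
  by rewrite max_r// invr_ge0.
have mm0 : 0 <= m `^ (1 + s) by exact: powR_ge0.
case: (leP 1 (m * r)) => mr.
  rewrite sumrB.
  have rm : m^-1 <= r by rewrite -[m^-1]mul1r ler_pdivrMr// mulrC.
  apply: le_trans (cabsB _ _) _.
  apply: le_trans (_ : 2 * K * m `^ (1 + s) * r `^ kappa <= _).
    rewrite -[2]/(1 + 1) -!mulrA mulrDl !mul1r !mulrA lerD//.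
      have := hK h M h1; rewrite -/r max_l//.
    apply: le_trans (x0E M) _; rewrite ler_wpM2l ?mulr_ge0//.
    by rewrite ge0_ler_powR ?nnegrE ?invr_ge0// ltW.
  have p1 : 1 <= (m * r) `^ vt by rewrite -[X in X <= _](powRr0 (m * r)) ler_powR.
  apply: le_trans (_ : 2 * K * m `^ (1 + s) * r `^ kappa * (m * r) `^ vt <= _).
    by rewrite ler_peMr// !mulr_ge0// powR_ge0.
  by rewrite !ler_wpM2r ?powR_ge0// lerDl.
pose g n : C := e ((poly_value n)%:~R * h) - 1.
have -> : \sum_(n < M.+1) (phase (x + h) n - phase x n) = \sum_(n < M.+1) g n * phase x n.
  apply: eq_bigr => n _; rewrite /g /phase mulrDr [(_ * x) + _]addrC e2piD mulrBl mul1r //.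
set B := K * m `^ (1 + s) * m^-1 `^ kappa.
have B0 : 0 <= B by rewrite !mulr_ge0// powR_ge0.
have hB n : (n <= M)%N -> cabs (\sum_(k < n.+1) phase x k) <= B.
  move=> nM; apply: le_trans (x0E n) _; rewrite /B -!mulrA ler_wpM2l//.
  have n0 : 0 < n.+1%:R :> R by [].
  have pE (y : R) : 0 < y -> y `^ (1 + s) * y^-1 `^ kappa = y `^ (1 + s - kappa).
    move=> y0; rewrite -powR_inv1 ?ltW// -powRrM mulN1r -powRD//.
    by rewrite (gt_eqF y0) implybT.
  rewrite !pE// ge0_ler_powR ?nnegrE ?ler_nat//; try lra.
apply: le_trans (sum_by_parts_bound g hB) _.
have pi0 := @pi_ge0 R.
have g1 : cabs (g M) <= 2 * pi * K1 * (m * r) ^+ 2.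
  apply: le_trans (cabs_e2pi_sub1_le _) _; rewrite -(mulrA (2 * pi)) ler_wpM2l ?mulr_ge0//.
  rewrite normrM hr -[r * r]expr2 exprMn [K1 * _]mulrA ler_wpM2r ?sqr_ge0//.
  by have [] := hK1 M.
have g2 n : (n < M)%N -> cabs (g n - g n.+1) <= 2 * pi * K1 * (m * r ^+ 2).
  move=> nM.
  have -> : g n - g n.+1 = - (e ((poly_value n)%:~R * h) * (e (((poly_value n.+1)%:~R - (poly_value n)%:~R) * h) - 1)).
    rewrite /g; have -> : (poly_value n.+1)%:~R * h = (poly_value n)%:~R * h + ((poly_value n.+1)%:~R - (poly_value n)%:~R) * h by rewrite mulrBl addrC subrK.
    rewrite e2piD; ring.
  rewrite cabsN ComplexField.Normc.normcM cabs_e2pi mul1r.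
  apply: le_trans (cabs_e2pi_sub1_le _) _; rewrite -(mulrA (2 * pi)) ler_wpM2l ?mulr_ge0//.
  rewrite normrM hr -[r * r]expr2 [K1 * _]mulrA ler_wpM2r ?sqr_ge0//.
  have [_ h2] := hK1 n; apply: le_trans h2 _.
  by rewrite ler_wpM2l ?(ltW K10)// /m ler_nat ltnW.
apply: le_trans (_ : 4 * pi * K1 * (m * r) ^+ 2 * B <= _).
  have -> : 4 * pi * K1 * (m * r) ^+ 2 * B = 2 * pi * K1 * (m * r) ^+ 2 * B + m * (2 * pi * K1 * (m * r ^+ 2) * B) by ring.
  apply: lerD; first by rewrite ler_wpM2r.
  apply: le_trans (_ : \sum_(n < M) (2 * pi * K1 * (m * r ^+ 2) * B) <= _).
    by apply: ler_sum => n _; rewrite ler_wpM2r// g2.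
  rewrite sumr_const card_ord -[_ *+ M]mulr_natl ler_wpM2r//; last by rewrite /m ler_nat.
  have K1p := ltW K10; have mp := ltW m0; have rr := sqr_ge0 r.
  by do 4 (apply: mulr_ge0 => //); apply: mulr_ge0.
have -> : 4 * pi * K1 * (m * r) ^+ 2 * B = 4 * pi * K1 * K * m `^ (1 + s) * ((m * r) ^+ 2 * m^-1 `^ kappa).
  by rewrite /B; ring.
have -> : (2 * K + 4 * pi * K1 * K) * m `^ (1 + s) * r `^ kappa * (m * r) `^ vt =
  ((2 * K + 4 * pi * K1 * K) * m `^ (1 + s)) * (r `^ kappa * (m * r) `^ vt) by ring.
apply: ler_pM.
- by rewrite mulr_ge0.
- by rewrite mulr_ge0 ?sqr_ge0 ?powR_ge0.
- by rewrite ler_wpM2r// lerDr mulr_ge0.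
have mr0 : 0 < m * r by rewrite mulr_gt0.
have -> : m^-1 = r * (m * r)^-1 by field; rewrite !gt_eqF.
rewrite [(r / _) `^ kappa]powRM ?invr_ge0 ?(ltW r0) ?(ltW mr0)// mulrCA ler_wpM2l ?powR_ge0//.
rewrite -powR_inv1 ?(ltW mr0)// -powRrM mulN1r -powR_mulrn ?(ltW mr0)// -powRD; last by rewrite (gt_eqF mr0) implybT.
by apply: ger_powR; [rewrite mr0 ltW | lra].
Qed.

Lemma fourier_increment (x kappa s : R) :
  0 <= kappa <= 2^-1 -> 0 < s -> s <= (alpha - 1) / 2 -> sums_small x kappa s ->
  exists2 K : R, 0 <= K & forall h, 0 < `|h| <= 1 ->
    cabs (F (x + h) - F x) <= K * `|h| `^ ((alpha - 1) / 2 + kappa / 2 - s).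
Proof.
move=> kap s0 s1 sm; have al1 := alpha_gt1; have al2 := alpha_le2.
have [K K0 hK] := weyl_sum_diff_bound kap s0 sm.
pose Z := 1 + alpha * zeta_bound s.
have Z0 : 0 <= Z by rewrite addr_ge0// mulr_ge0 ?zeta_bound_ge0//; lra.
exists (K * Z); first by rewrite mulr_ge0.
move=> h hh; case/andP: (hh) => h0 h1.
set r := Num.sqrt `|h|.
have r0 : 0 < r by rewrite sqrtr_gt0.
(* With this choice the sums grow like n^(1 + s + vt) = n^(alpha - s); against the weight
   differences, of size n^(-alpha - 1), this leaves the convergent series of n^(-1 - s). *)
pose vt := alpha - 1 - 2 * s.
have vtP1 : 0 <= vt by rewrite /vt; lra.
have vtP2 : vt <= 3 / 2 by rewrite /vt; lra.
have vtP : 0 <= vt <= 3 / 2 by apply/andP.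
have -> : `|h| `^ ((alpha - 1) / 2 + kappa / 2 - s) = r `^ (kappa + vt).
  by rewrite /r -powR12_sqrt// -powRrM; congr (_ `^ _); rewrite /vt; field.
have rv0 : 0 <= r `^ (kappa + vt) by exact: powR_ge0.
pose B n := K * r `^ (kappa + vt) * n.+1%:R `^ (alpha - s).
have main N : cabs (partial_sum (x + h) N.+1 - partial_sum x N.+1) <= K * Z * r `^ (kappa + vt).
  have -> : partial_sum (x + h) N.+1 - partial_sum x N.+1 = \sum_(n < N.+1) (weight n)%:C%C * (phase (x + h) n - phase x n).
    by rewrite /partial_sum -sumrB; apply: eq_bigr => n _; rewrite mulrBr.
  have hB n : (n <= N)%N -> cabs (\sum_(k < n.+1) (phase (x + h) k - phase x k)) <= B n.
    move=> _; apply: le_trans (hK h n vt hh vtP) _; rewrite -/r /B.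
    have n0 : 0 < n.+1%:R :> R by [].
    rewrite powRM ?(ltW r0)//.
    have -> : alpha - s = (1 + s) + vt by rewrite /vt; ring.
    rewrite [r `^ (kappa + vt)]powRD ?(gt_eqF r0) ?implybT// [n.+1%:R `^ (1 + s + vt)]powRD ?(gt_eqF n0) ?implybT//.
    by apply: eq_imply_le; ring.
  apply: le_trans (@sum_by_parts_bound R (fun n => (weight n)%:C%C) (fun k => phase (x + h) k - phase x k) B N hB) _.
  have -> : K * Z * r `^ (kappa + vt) = K * r `^ (kappa + vt) + alpha * (K * r `^ (kappa + vt)) * zeta_bound s.
    by rewrite /Z; ring.
  have Kr0 : 0 <= K * r `^ (kappa + vt) by rewrite mulr_ge0.
  have pE n : n.+1%:R `^ (- alpha) * n.+1%:R `^ (alpha - s) = n.+1%:R `^ (- s) :> R.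
    by rewrite powR_add//; congr (_ `^ _); ring.
  apply: lerD.
    rewrite cabsC ger0_norm ?weight_ge0// /B /weight mulrCA pE ler_piMr//.
    by rewrite powRN invf_le1 ?powR_gt0// -[X in X <= _](powRr0 N.+1%:R) ler_powR ?ler1n ?ltW.
  apply: le_trans (ler_wpM2l _ (sum_powRN_le N s0)); last by rewrite mulr_ge0//; lra.
  rewrite mulr_sumr; apply: ler_sum => n _.
  have n0 : 0 < n.+1%:R :> R by []. have n0' : 0 < n.+2%:R :> R by [].
  have a0 : 0 < alpha by lra.
  have := powRN_sub_le n0 n0' a0; rewrite -(natr1 n.+1) addrAC subrr add0r mulr1.
  have := powRN_sub_ge n0 n0' a0; rewrite -(natr1 n.+1) addrAC subrr add0r mulr1.
  rewrite natr1 -/(weight n) -/(weight n.+1) => l1 l2.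
  rewrite -rmorphB cabsC ger0_norm; last first.
    by apply: le_trans l1; rewrite mulr_ge0 ?powR_ge0// ltW.
  apply: le_trans (ler_wpM2r _ l2) _.
    by rewrite /B mulr_ge0// powR_ge0.
  rewrite /B powRNS// powRNS// -(pE n).
  by apply: eq_imply_le; field; rewrite gt_eqF.
apply/ler_addgt0Pr => d d0.
have [N0 hN0] := @poly_fourier_approx (d / 2) ltac:(by rewrite divr_gt0).
have h2 := hN0 N0.+1 (x + h) (leqnSn _); have h3 := hN0 N0.+1 x (leqnSn _).
apply: le_trans (cabs_le_dist _ (partial_sum (x + h) N0.+1) _) _.
apply: le_trans (lerD h2 (cabs_le_dist _ (partial_sum x N0.+1) _)) _.
rewrite cabsBC in h3; have := main N0; lra.
Qed.

End Series.

(** * Rational approximation *)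

Section Diophantine.
Variable R : realType.
Implicit Types (x y : R).
Local Notation cabs := (@ComplexField.Normc.normc R).

Lemma dirichlet_approx y (Q : nat) : (0 < Q)%N ->
  exists (p : int) (q : nat), [/\ (0 < q <= Q)%N, coprimez p q%:Z &
    `|q%:R * y - p%:~R| < Q%:R^-1].
Proof.
move=> Q0; have QR : 0 < Q%:R :> R by rewrite ltr0n.
pose bin (k : nat) := Num.truncn (Q%:R * fracpart (k%:R * y)).
have binP k : (bin k)%:R <= Q%:R * fracpart (k%:R * y) < (bin k).+1%:R.
  by apply: truncn_itv; rewrite mulr_ge0//; case/andP: (fracpart_itv (k%:R * y)).
have binQ k : (bin k < Q)%N.
  have /andP[h _] := binP k; rewrite -(ltr_nat R) (le_lt_trans h)//.
  by rewrite gtr_pMr//; case/andP: (fracpart_itv (k%:R * y)).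
pose f (k : 'I_Q.+1) := Ordinal (binQ k).
have /injectivePn [i [j ij eqf]] : ~~ injectiveb f.
  apply/negP => /injectiveP /leq_card; rewrite !card_ord; lia.
have eqb : bin i = bin j by have := congr1 val eqf.
wlog lij : i j {ij eqf} eqb / (i < j)%N.
  move=> H; move: ij; rewrite neq_ltn => /orP[] h; first exact: (H i j).
  exact: (H j i).
pose d := (j - i)%N; pose z : int := Num.floor (j%:R * y) - Num.floor (i%:R * y).
have d0 : (0 < d)%N by rewrite subn_gt0.
have dQ : (d <= Q)%N by rewrite /d; have := ltn_ord j; lia.
have dz : `|d%:R * y - z%:~R| < Q%:R^-1.
  have dE : d%:R = j%:R - i%:R :> R by rewrite /d natrB// ltnW.
  have -> : d%:R * y - z%:~R = fracpart (j%:R * y) - fracpart (i%:R * y).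
    by rewrite /fracpart /z intrB dE; ring.
  rewrite -[X in _ < X]mul1r ltr_pdivlMr// -[Q%:R]gtr0_norm// -normrM.
  have /andP[a1 a2] := binP i; have /andP[b1 b2] := binP j.
  rewrite -eqb in b1 b2; rewrite -(natr1 (bin i)) in a2 b2.
  rewrite ltr_norml mulrBl ![fracpart _ * _]mulrC; apply/andP; split; lra.
pose g := gcdn d `|z|; have g0 : (0 < g)%N by rewrite gcdn_gt0 d0.
have gR : 1 <= g%:R :> R by rewrite ler1n.
have gd : (g %| d)%N by exact: dvdn_gcdl.
have gz : (g%:Z %| z)%Z by rewrite dvdzE absz_nat dvdn_gcdr.
exists (z %/ g%:Z)%Z, (d %/ g)%N; split.
- by rewrite divn_gt0// dvdn_leq//= (leq_trans (leq_div _ _)).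
- rewrite coprimezE absz_nat /coprime -(eqn_pmul2r g0) mul1n muln_gcdl divnK//.
  have -> : (`|(z %/ g%:Z)%Z| * g)%N = `|z|%N by rewrite -[g in LHS]absz_nat -abszM divzK.
  by rewrite gcdnC.
- have dE : d%:R = (d %/ g)%:R * g%:R :> R by rewrite -natrM divnK.
  have zE : z%:~R = (z %/ g%:Z)%Z%:~R * g%:R :> R by rewrite -[in LHS](divzK gz) intrM.
  move: dz; rewrite dE zE mulrAC -mulrBl normrM normr_nat; apply: le_lt_trans.
  by rewrite ler_peMr.
Qed.

Definition badly_approx x (tau : R) := exists2 c : R, 0 < c &
  forall (p : int) (q : nat), (0 < q)%N -> c * q%:R `^ (- tau) <= `|x - p%:~R / q%:R|.

Section Sums.
Variable P : {poly int}.
Hypotheses (degP : size P = 3%N) (leadP : 0 < lead_coef P).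

Lemma weyl_sum_quadratic y N : weyl_sum P y N = \sum_(n < N) e2pi ((lead_nat P)%:R * y * n%:R ^+ 2 +
  ((2 * (lead_nat P)%:Z + P`_1)%:~R * y) * n%:R + ((lead_nat P)%:Z + P`_1 + P`_0)%:~R * y).
Proof.
apply: eq_bigr => n _; rewrite /phase poly_value_shift//; congr e2pi.
move: (_ + P`_1) (_ + P`_0) => A B; rewrite !intrD !intrM; ring.
Qed.

Lemma sums_small0 x (s : R) : 0 < s -> sums_small P x 0 s.
Proof.
move=> s0; exists 1; first exact: ler01.
move=> h M h1; rewrite powRr0 mulr1 mul1r.
apply: le_trans (@cabs_sum_e2pi_le R M.+1 (fun n => (poly_value P n)%:~R * (x + h))) _.
by rewrite le1r_powR ?ler1n// lerDl ltW.
Qed.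

(** Weyl's inequality is applied at x + h with a Dirichlet fraction p / q. Each of its terms m^2 /
    q, m and q must be at most of order m^2 X^(2 kap); the choice of Q handles the last two, and bad
    approximability of x excludes small q. *)
Lemma badly_approx_sums_small x (tau s : R) : 2 <= tau -> 0 < s ->
  badly_approx x tau -> sums_small P x tau^-1 s.
Proof.
move=> tau2 s0 [c c0 hc].
have [K K0 hK] := @weyl_quadratic R (lead_nat P) s (lead_nat_gt0 leadP) s0.
pose c2 := 1 + 3 / c.
have c20 : 0 <= c2 by rewrite /c2 addr_ge0// divr_ge0// ltW.
exists (Num.sqrt (K * (c2 + 2))); first exact: sqrtr_ge0.
move=> h M h1; set m : R := M.+1%:R; set X := Num.max _ _; set kap := tau^-1.
have m1 : 1 <= m by rewrite ler1n.
have m0 : 0 < m by lra.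
have k0 : 0 < kap by rewrite invr_gt0; lra.
have k1 : kap <= 2^-1 by rewrite lef_pV2// posrE; lra.
have kt : kap * tau = 1 by rewrite mulVf// gt_eqF//; lra.
have Xm : m^-1 <= X by rewrite le_max lexx orbT.
have Xh : `|h| <= X ^+ 2.
  rewrite -[`|h|]sqr_sqrtr// lerXn2r ?nnegrE ?sqrtr_ge0 ?le_max ?lexx//.
  by rewrite invr_ge0 (ltW m0) orbT.
have X0 : 0 < X by rewrite (lt_le_trans _ Xm)// invr_gt0.
(* As X >= 1/m, this largest denominator is within m^2 X^(2 kap); it is also at least m. *)
pose D := m `^ (2 - 2 * kap).
have mD : m <= D by rewrite -[y0 in y0 <= _]powRr1 ?(ltW m0)// /D ler_powR//; lra.
pose Q := Num.truncn D.
have /andP[QD DQ] : Q%:R <= D < Q.+1%:R by apply: truncn_itv; exact: powR_ge0.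
have Q1 : (0 < Q)%N by rewrite -(ltr_nat R) -(ltrD2r 1) add0r natr1; apply: le_lt_trans DQ; lra.
have QR : 1 <= Q%:R :> R by rewrite ler1n.
have [p [q [/andP[q0 qQ] cpq hq]]] := dirichlet_approx (x + h) Q1.
have qR : 1 <= q%:R :> R by rewrite ler1n.
have qR0 : 0 < q%:R :> R by lra.
have yq : `|x + h - p%:~R / q%:R| <= q%:R^-1 * Q%:R^-1.
  have -> : x + h - p%:~R / q%:R = q%:R^-1 * (q%:R * (x + h) - p%:~R) by field; rewrite gt_eqF.
  by rewrite normrM gtr0_norm ?invr_gt0// ler_wpM2l ?invr_ge0 ?ltW.
have yq2 : `|x + h - p%:~R / q%:R| <= (q%:R ^+ 2)^-1.
  apply: le_trans yq _; rewrite expr2 invfM ler_wpM2l ?invr_ge0 ?(ltW qR0)//.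
  by rewrite lef_pV2 ?posrE ?ltr0n// ler_nat.
have X2k0 : 0 < X `^ (2 * kap) by exact: powR_gt0.
(* In the variable v = q^-1 / X^(2 kap), the lower bound for |x - p/q| and the upper bound through x
   + h become c v^tau <= 1 + 2 v once X^2 is cancelled. Since tau >= 2, either v <= 1 or c v^2 <= 3
   v, whence the constant c2. *)
have tX : q%:R^-1 <= c2 * X `^ (2 * kap).
  have h2 : c * q%:R `^ (- tau) <= X ^+ 2 + q%:R^-1 * (2 * X `^ (2 - 2 * kap)).
    apply: le_trans (hc p q q0) _.
    have -> : x - p%:~R / q%:R = - h + (x + h - p%:~R / q%:R) by ring.
    apply: le_trans (ler_normD _ _) _; rewrite normrN lerD//.
    apply: le_trans yq _; rewrite ler_wpM2l ?invr_ge0 ?(ltW qR0)//.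
    apply: le_trans (_ : 2 * D^-1 <= _).
      rewrite ler_pdivlMr ?powR_gt0// mulrC ler_pdivrMr ?ltr0n//.
      by rewrite -(natr1 Q) in DQ; lra.
    rewrite ler_pM2l// /D -powRN.
    have -> : m `^ (- (2 - 2 * kap)) = m^-1 `^ (2 - 2 * kap).
      by rewrite -[m^-1]powR_inv1 ?ltW// -powRrM mulN1r.
    rewrite ge0_ler_powR ?nnegrE ?invr_ge0 ?(ltW m0) ?(ltW X0)//; lra.
  pose v := q%:R^-1 / X `^ (2 * kap).
  have v0 : 0 < v by rewrite divr_gt0// invr_gt0.
  have tE : q%:R^-1 = v * X `^ (2 * kap) by rewrite /v divfK// gt_eqF.
  rewrite tE ler_wpM2r ?(ltW X2k0)//.
  have tau0 : q%:R `^ (- tau) = v `^ tau * X ^+ 2.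
    have -> : q%:R `^ (- tau) = (q%:R^-1) `^ tau.
      by rewrite -[q%:R^-1]powR_inv1 ?ltW// -powRrM mulN1r.
    rewrite tE powRM ?powR_ge0 ?(ltW v0)// -powRrM -mulrA kt mulr1.
    by rewrite (@powR_mulrn _ X 2) ?ltW.
  rewrite tau0 tE in h2.
  have XE : X `^ (2 * kap) * X `^ (2 - 2 * kap) = X ^+ 2.
    by rewrite powR_add// addrC subrK (@powR_mulrn _ X 2) ?ltW.
  have h3 : c * v `^ tau <= 1 + 2 * v.
    rewrite -(ler_pM2r (_ : 0 < X ^+ 2)); last by rewrite exprn_gt0.
    apply: le_trans (_ : c * (v `^ tau * X ^+ 2) <= _); first by rewrite mulrA.
    apply: le_trans h2 _; rewrite -XE; apply: eq_imply_le; ring.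
  case: (leP v 1) => v1; first by rewrite /c2 (le_trans v1)// lerDl divr_ge0// ltW.
  have h4 : v ^+ 2 <= v `^ tau by rewrite -powR_mulrn ?(ltW v0)// ler_powR// ltW.
  have h5 : c * v ^+ 2 <= 3 * v.
    apply: le_trans (ler_wpM2l (ltW c0) h4) (le_trans h3 _).
    by have -> : 3 * v = v + 2 * v by [ring]; rewrite lerD2r ltW.
  have h6 : v <= 3 / c.
    rewrite ler_pdivlMr// -(ler_pM2r v0); apply: le_trans h5.
    by apply: eq_imply_le; ring.
  by rewrite /c2 (le_trans h6)// lerDr.
have := hK (x + h) ((2 * (lead_nat P)%:Z + P`_1)%:~R * (x + h)) (((lead_nat P)%:Z + P`_1 + P`_0)%:~R * (x + h)) p q M.+1 q0 cpq yq2.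
rewrite -weyl_sum_quadratic -/m => hS.
set S := cabs _ in hS *.
have qD : q%:R <= D by apply: le_trans QD; rewrite ler_nat.
have X2 : m ^+ 2 * X `^ (2 * kap) >= D.
  rewrite /D.
  have -> : m `^ (2 - 2 * kap) = m ^+ 2 * m^-1 `^ (2 * kap).
    rewrite -[m^-1]powR_inv1 ?(ltW m0)// -powRrM mulN1r -powR_mulrn ?(ltW m0)//.
    by rewrite powR_add.
  rewrite ler_wpM2l ?sqr_ge0//.
  by rewrite ge0_ler_powR ?nnegrE ?invr_ge0 ?(ltW m0) ?(ltW X0)// mulr_ge0// ltW.
have qs : q%:R `^ s <= m `^ (2 * s).
  rewrite powRrM ge0_ler_powR ?nnegrE ?powR_ge0 ?(ltW s0) ?(ltW qR0)//.
  by apply: le_trans qD _; rewrite /D ler_powR// gerBl mulr_ge0// ltW.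
have S2 : S ^+ 2 <= (Num.sqrt (K * (c2 + 2)) * m `^ (1 + s) * X `^ kap) ^+ 2.
  apply: le_trans hS _; rewrite !exprMn sqr_sqrtr; last by rewrite mulr_ge0// addr_ge0.
  have -> : (X `^ kap) ^+ 2 = X `^ (2 * kap).
    by rewrite -powR_mulrn ?powR_ge0// -powRrM mulrC.
  have -> : (m `^ (1 + s)) ^+ 2 = m ^+ 2 * m `^ (2 * s).
    rewrite -powR_mulrn ?powR_ge0// -powRrM -(@powR_mulrn _ m 2) ?(ltW m0)// powR_add//.
    by congr (_ `^ _); ring.
  have -> : K * (c2 + 2) * (m ^+ 2 * m `^ (2 * s)) * X `^ (2 * kap) =
     K * m `^ (2 * s) * ((c2 + 2) * (m ^+ 2 * X `^ (2 * kap))) by ring.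
  apply: ler_pM.
  - by rewrite mulr_ge0// powR_ge0.
  - by rewrite !addr_ge0// ?divr_ge0 ?sqr_ge0 ?(ltW qR0) ?(ltW m0).
  - by rewrite ler_wpM2l.
  have : m ^+ 2 / q%:R <= c2 * (m ^+ 2 * X `^ (2 * kap)).
    apply: le_trans (ler_wpM2l (sqr_ge0 m) tX) _; apply: eq_imply_le; ring.
  lra.
rewrite -(ler_pXn2r (_ : 0 < 2)%N) ?nnegrE ?cabs_ge0//.
by rewrite !mulr_ge0 ?sqrtr_ge0 ?powR_ge0.
Qed.

End Sums.

Lemma irrational_away x (N : nat) : irrational x ->
  exists2 d : R, 0 < d & forall (p : int) (q : nat), (0 < q <= N)%N -> d <= `|q%:R * x - p%:~R|.
Proof.
move=> xirr; elim: N => [|N [d d0 hd]]; first by exists 1 => // p q; lia.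
set f := fracpart (N.+1%:R * x).
have /andP[f0 f1] := fracpart_itv (N.+1%:R * x).
have fp : 0 < f.
  rewrite lt_def f0 andbT; apply/eqP => fE; apply: xirr.
  apply/rationalP; exists (Num.floor (N.+1%:R * x)), N.+1.
  move/eqP: fE; rewrite /f /fracpart subr_eq0 => /eqP <-.
  by rewrite mulrAC divff ?mul1r ?pnatr_eq0.
exists (Num.min d (Num.min f (1 - f))).
  by rewrite !lt_min d0 fp subr_gt0.
move=> p q; rewrite [(q <= _)%N]leq_eqVlt => /andP[q0 /orP[/eqP->|qN]]; last first.
  by rewrite ge_min hd// q0.
rewrite ge_min; apply/orP; right.
set z := Num.floor (N.+1%:R * x).
have E : N.+1%:R * x - p%:~R = f - (p - z)%:~R by rewrite intrB /f /fracpart -/z; ring.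
rewrite E; case: (leP (p - z) 0) => pz.
  have : (p - z)%:~R <= 0 :> R by rewrite lerz0.
  by move=> h; rewrite ge_min; apply/orP; left; rewrite (le_trans _ (ler_norm _))//; lra.
have : 1 <= (p - z)%:~R :> R by rewrite ler1z -gtz0_ge1.
by move=> h; rewrite ge_min; apply/orP; right; rewrite distrC (le_trans _ (ler_norm _))//; lra.
Qed.

(** The witness u is the part of m prime to q. A prime r dividing m and q divides neither u nor q0,
    hence not u q0; a prime r dividing m but not q divides u. In neither case does r divide q + u
    q0. *)
Lemma coprime_shift (m q q0 : nat) : (0 < m)%N -> (0 < q)%N -> coprime q q0 ->
  exists2 u : nat, (u <= m)%N & coprime m (q + u * q0).
Proof.
move=> m0 q_gt0 cq; exists (m`_(\pi(q)^'))%N; first by rewrite dvdn_leq// dvdn_part.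
rewrite coprime_has_primes ?addn_gt0 ?q_gt0//; apply/hasPn => r.
rewrite !mem_primes addn_gt0 q_gt0 m0 /= => /andP[pr rq].
rewrite pr /=; apply/negP => rm.
have [rdq|rdq] := boolP (r %| q)%N.
  move: rq; rewrite dvdn_addr// Euclid_dvdM// => /orP[ru|rq0]; last first.
    have : (r %| gcdn q q0)%N by rewrite dvdn_gcd rdq.
    by rewrite (eqP cq) dvdn1 => /eqP r1; rewrite r1 in pr.
  have /pnatP -/(_ (part_gt0 _ _)) /(_ r pr ru) := part_pnat (negn \pi(q)) m.
  by rewrite inE /= mem_primes pr q_gt0 rdq.
have ru : (r %| m`_(\pi(q)^'))%N.
  have : r \in \pi((m`_(\pi(q)^'))%N).
    by rewrite pi_of_part// inE /= mem_primes pr m0 rm /= inE /= mem_primes pr q_gt0 rdq.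
  by rewrite mem_primes => /and3P[].
by move: rq; rewrite dvdn_addl ?dvdn_mulr// (negbTE rdq).
Qed.

(** A Dirichlet fraction p/q is combined with a Bezout neighbour p0/q0 into (p + w p0) / (q + w q0).
    The determinant stays 1, so the fraction is reduced; w <= m makes the denominator coprime to m
    and costs only a factor depending on m. *)
Lemma good_approx_irrational x (m : nat) : (0 < m)%N -> irrational x ->
  exists2 K : R, 0 < K & forall N : nat, exists (p : int) (q : nat),
    [/\ (N < q)%N, coprime m q, coprimez p q%:Z & `|x - p%:~R / q%:R| <= K / q%:R ^+ 2].
Proof.
move=> m_gt0 xirr; exists ((1 + 2 * m%:R) * (m%:R + 1)).
  by rewrite mulr_gt0// ltr_pwDr// ?mulr_ge0.
move=> N; have [d d0 hd] := irrational_away N xirr.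
pose Q := (Num.truncn d^-1).+1.
have QR : d^-1 < Q%:R by have /andP[] := @truncn_itv R d^-1 ltac:(by rewrite invr_ge0 ltW).
have Q0 : 0 < Q%:R :> R by rewrite ltr0n.
have [p [q [/andP[q_gt0 qQ] cpq hq]]] := dirichlet_approx x (isT : (0 < Q)%N).
have qR : 0 < q%:R :> R by rewrite ltr0n.
have Nq : (N < q)%N.
  rewrite ltnNge; apply/negP => qN; have := hd p q; rewrite q_gt0 qN => /(_ isT).
  rewrite leNgt => /negP; apply; apply: lt_trans hq _.
  by rewrite -[d]invrK ltf_pV2// posrE invr_gt0.
have hq' : `|x - p%:~R / q%:R| <= q%:R^-1 * q%:R^-1.
  have -> : x - p%:~R / q%:R = q%:R^-1 * (q%:R * x - p%:~R) by field; rewrite gt_eqF.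
  rewrite normrM gtr0_norm ?invr_gt0// ler_wpM2l ?invr_ge0 ?(ltW qR)//.
  by rewrite (le_trans (ltW hq))// lef_pV2 ?posrE// ler_nat.
have /coprimezP [[u v] /= uv] := cpq.
(* Reducing the Bezout coefficient modulo q gives p0 q - p q0 = 1 with 0 <= q0 < q, so that q + w q0
   is at most (m + 1) q. *)
pose q0z : int := ((- u) %% q%:Z)%Z.
pose k : int := ((- u) %/ q%:Z)%Z.
pose p0 : int := v - k * p.
have q0zE : q0z = - u - k * q%:Z by have := divz_eq (- u) q%:Z; rewrite -/k -/q0z => ->; ring.
have det : p0 * q%:Z - p * q0z = 1 by rewrite q0zE /p0 -uv; ring.
have q0z_ge0 : 0 <= q0z by rewrite modz_ge0// -lt0n.
have q0z_lt : q0z < q%:Z by rewrite ltz_pmod.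
case: q0z q0zE det q0z_ge0 q0z_lt => // q0 q0zE det _ q0q.
have cqq0 : coprime q q0.
  have : coprimez q%:Z q0%:Z by apply/coprimezP; exists (p0, - p) => /=; rewrite -det; ring.
  by rewrite coprimezE !absz_nat.
have [w wm cw] := coprime_shift m_gt0 q_gt0 cqq0.
pose q' := (q + w * q0)%N; pose p' : int := p + w%:Z * p0.
have qq' : (q <= q')%N by exact: leq_addr.
have q'q : (q' <= (m + 1) * q)%N.
  rewrite /q' mulnDl mul1n addnC leq_add2r leq_mul//; move: q0q; rewrite ltz_nat => /ltnW //.
exists p', q'; split => //; first exact: leq_trans Nq qq'.
  apply/coprimezP; exists (- q0%:Z, p0) => /=.
  by rewrite /p' /q' PoszD PoszM -det; ring.
have q'R : 0 < q'%:R :> R by rewrite ltr0n (leq_trans q_gt0).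
have b1 : `|q%:R * x - p%:~R| <= q%:R^-1.
  by rewrite (le_trans (ltW hq))// lef_pV2 ?posrE// ler_nat.
have b2 : `|q0%:R * x - p0%:~R| <= 2 * q%:R^-1.
  have detR : p0%:~R * q%:R - p%:~R * q0%:R = 1 :> R.
    by have := congr1 (fun z : int => z%:~R : R) det; rewrite intrB !intrM.
  have -> : q0%:R * x - p0%:~R = (q0%:R * (q%:R * x - p%:~R) - (p0%:~R * q%:R - p%:~R * q0%:R)) / q%:R.
    by move: p0%:~R p%:~R (q0%:R : R) => ? ? ?; field; rewrite gt_eqF.
  rewrite detR normrM normfV (gtr0_norm qR) ler_wpM2r ?invr_ge0 ?(ltW qR)//.
  apply: le_trans (ler_normB _ _) _; rewrite normr1 normrM normr_nat.
  have : q0%:R * `|q%:R * x - p%:~R| <= 1.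
    apply: le_trans (ler_wpM2l _ b1) _ => //; rewrite ler_pdivrMr// mul1r ler_nat.
    by move: q0q; rewrite ltz_nat => /ltnW.
  lra.
have b3 : `|q'%:R * x - p'%:~R| <= (1 + 2 * m%:R) * q%:R^-1.
  have -> : q'%:R * x - p'%:~R = (q%:R * x - p%:~R) + w%:R * (q0%:R * x - p0%:~R).
    rewrite /q' /p' natrD natrM intrD intrM.
    by move: p0%:~R p%:~R (q0%:R : R) => ? ? ?; rewrite -[(w%:Z)%:~R]/(w%:R); ring.
  apply: le_trans (ler_normD _ _) _; rewrite normrM normr_nat mulrDl mul1r lerD//.
  rewrite [2 * _]mulrC -mulrA ler_pM// ler_nat//.
have -> : x - p'%:~R / q'%:R = (q'%:R * x - p'%:~R) / q'%:R by field; rewrite gt_eqF.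
rewrite normrM normfV (gtr0_norm q'R) expr2 invfM [X in _ <= X]mulrA ler_wpM2r ?invr_ge0 ?(ltW q'R)//.
apply: le_trans b3 _; rewrite -mulrA ler_wpM2l ?addr_ge0 ?mulr_ge0//.
rewrite ler_pdivlMr// mulrC ler_pdivrMr//.
by rewrite natr1 -natrM ler_nat; move: q'q; rewrite addn1.
Qed.

End Diophantine.

(** * Oscillation of the series near rationals *)

Section Sinc.
Variable R : realType.
Implicit Types (s t x y : R).
Local Notation cabs := (@ComplexField.Normc.normc R).

Definition sinc t : R := if t == 0 then 1 else sin t / t.

Lemma sinc0 : sinc 0 = 1. Proof. by rewrite /sinc eqxx. Qed.

Lemma is_derive_sin_div (a l x : R) : l != 0 ->
  is_derive x 1 (fun u : R => a * (sin (l * u) / l)) (a * cos (l * x)).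
Proof.
by move=> l0; apply: is_derive_eq; rewrite /GRing.scale /=; field.
Qed.

Lemma is_derive_mull (a x : R) : is_derive x 1 (fun u : R => a * u) a.
Proof.
have -> : (fun u : R => a * u) = a \*: (@id R) by [].
by apply: is_derive_eq; rewrite /GRing.scale /= mulr1.
Qed.

(** The primitive of cos (l u) that vanishes at 0. The case l = 0 is included because P may vanish
    at a positive integer. *)
Definition cos_prim (l u : R) : R := if l == 0 then u else sin (l * u) / l.

Lemma is_derive_cos_prim (a l x : R) :
  is_derive x 1 (fun u : R => a * cos_prim l u) (a * cos (l * x)).
Proof.
rewrite /cos_prim; case: eqVneq => [->|l0]; last exact: is_derive_sin_div.
by rewrite mul0r cos0 mulr1; exact: is_derive_mull.
Qed.

Lemma cos_prim_sinc (l y : R) : 0 < y -> cos_prim l y = y * sinc (l * y).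
Proof.
move=> y0; rewrite /cos_prim /sinc mulf_eq0 (gt_eqF y0) orbF.
by case: eqVneq => [_|l0]; [rewrite mulr1 | field; rewrite l0 gt_eqF].
Qed.

(* [sinc (l * y)] is the mean value of [cos (l * u)] for [u] in [0, y]. *)
Lemma sinc_average (N : nat) (a l : nat -> R) (Z B y : R) : 0 < y ->
  (forall u, 0 <= u <= y -> `|\sum_(n < N) a n * cos (l n * u) - Z| <= B) ->
  `|\sum_(n < N) a n * sinc (l n * y) - Z| <= B.
Proof.
move=> y0 hB.
(* The mean value theorem stands in for integration: the average over [0, y] is (G y - G 0) / y,
   hence a value of the derivative of G, to which the hypothesis applies. *)
pose G : R -> R := (\sum_(n < N) (fun u : R => a n * cos_prim (l n) u)) - (fun u : R => Z * u).
pose dG (u : R) : R := \sum_(n < N) a n * cos (l n * u) - Z.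
have GE u : G u = \sum_(n < N) a n * cos_prim (l n) u - Z * u.
  by rewrite /G fctE /= fct_sumE.
have dGP (u : R) : is_derive u 1 G (dG u).
  apply: is_deriveB; first by apply: is_derive_sum => i; exact: is_derive_cos_prim.
  exact: is_derive_mull.
have [|c /andP[c0 c1]] := MVT_segment (ltW y0) (fun u _ => dGP u).
  apply: continuous_subspaceT => u.
  by apply/differentiable_continuous/derivable1_diffP; apply: ex_derive.
have G0 : G 0 = 0.
  rewrite GE mulr0 subr0 big1// => i _.
  by rewrite /cos_prim; case: eqVneq; rewrite ?mulr0 ?sin0 ?mul0r ?mulr0.
have Gy : G y = y * (\sum_(n < N) a n * sinc (l n * y) - Z).
  rewrite GE mulrBr mulr_sumr [Z * y]mulrC; congr (_ - _).
  by apply: eq_bigr => i _; rewrite cos_prim_sinc// mulrCA.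
rewrite G0 !subr0 Gy mulrC => /(mulIf (lt0r_neq0 y0)) ->.
by apply: hB; move: c0 c1; rewrite !bnd_simp => -> ->.
Qed.

Lemma cos_sin_lip s t : `|cos s - cos t| <= `|s - t| /\ `|sin s - sin t| <= `|s - t|.
Proof.
have p0 := @pi_gt0 R.
pose E u : R[i] := e2pi (u / (2 * pi)).
have EE u : E u = (cos u +i* sin u)%C.
  by rewrite /E /e2pi mulrC divfK// mulf_neq0// gt_eqF.
have h : cabs (E s - E t) <= `|s - t|.
  have -> : E s - E t = E t * (e2pi ((s - t) / (2 * pi)) - 1).
    rewrite /E; have -> : s / (2 * pi) = t / (2 * pi) + (s - t) / (2 * pi).
      by rewrite -mulrDl addrC subrK.
    by rewrite e2piD; ring.
  rewrite ComplexField.Normc.normcM cabs_e2pi mul1r (le_trans (cabs_e2pi_sub1_le _))//.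
  rewrite normrM normfV [`|2 * pi|]gtr0_norm ?mulr_gt0//.
  by rewrite mulrC divfK// gt_eqF// mulr_gt0.
split.
  by apply: le_trans h; apply: le_trans (Re_le_cabs _); rewrite !EE.
by apply: le_trans h; apply: le_trans (Im_le_cabs _); rewrite !EE.
Qed.

(** Both values are means over [0, 1], so [sinc_average] with the two terms cos (s u) and - cos (t
    u) reduces the claim to the Lipschitz bound for cos. *)
Lemma sinc_lip s t : `|sinc s - sinc t| <= `|s - t|.
Proof.
pose a (n : nat) : R := if n is 0%N then 1 else -1.
pose l (n : nat) : R := if n is 0%N then s else t.
have := @sinc_average 2 a l 0 `|s - t| 1 ltr01.
rewrite !big_ord_recr !big_ord0 /= !mulr1 add0r mul1r mulN1r subr0; apply.
move=> u /andP[u0 u1].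
rewrite !big_ord_recr !big_ord0 /= add0r mul1r mulN1r subr0.
have [h _] := cos_sin_lip (s * u) (t * u); apply: le_trans h _.
by rewrite -mulrBl normrM (ger0_norm u0) ler_piMr.
Qed.

Lemma normr_sinc_le1 t : `|sinc t| <= 1.
Proof.
rewrite /sinc; case: eqVneq => [_|t0]; first by rewrite normr1.
by rewrite normrM normfV ler_pdivrMr ?normr_gt0// mul1r normr_sin_le.
Qed.

Lemma one_sub_sinc_ge0 t : 0 <= 1 - sinc t.
Proof. by rewrite subr_ge0 (le_trans (ler_norm _))// normr_sinc_le1. Qed.

Lemma one_sub_sinc_le t (th : R) : 0 <= th <= 1 -> 1 - sinc t <= 2 * `|t| `^ th.
Proof.
move=> /andP[th0 th1].
have [->|tn0] := eqVneq t 0; first by rewrite sinc0 subrr mulr_ge0// powR_ge0.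
have tp : 0 < `|t| by rewrite normr_gt0.
case: (leP `|t| 1) => t1.
  have h : 1 - sinc t <= `|t|.
    by rewrite -sinc0 -[t in X in _ <= X]subr0 -normrN opprB (le_trans (ler_norm _))// sinc_lip.
  apply: le_trans h _; have h1 : `|t| <= `|t| `^ th by rewrite ger1_powR// tp.
  by have := powR_ge0 `|t| th; lra.
have h1 : 1 <= `|t| `^ th by rewrite -[y0 in y0 <= _](powRr0 `|t|) ler_powR// ltW.
have := normr_sinc_le1 t; rewrite ler_norml => /andP[h2 _]; lra.
Qed.

Lemma one_sub_sinc_ge t : 2 <= t -> 2^-1 <= 1 - sinc t.
Proof.
move=> t2; have t0 : 0 < t by lra.
rewrite /sinc (gt_eqF t0).
have : sin t / t <= 2^-1.
  rewrite ler_pdivrMr//; apply: le_trans (sin_le1 t) _; lra.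
lra.
Qed.

(** For s > 1 the variation of sinc decays like 1/s, for s <= 1 the Lipschitz bound is enough; s^(th
    - 1) dominates both 1/s in the first range and 1 in the second. *)
Lemma sinc_far s t (th : R) : 0 < s -> s <= t -> 0 <= th <= 1 ->
  `|sinc s - sinc t| <= 2 * (t - s) * s `^ (th - 1).
Proof.
move=> s0 st /andP[th0 th1]; have t0 : 0 < t by lra.
have ts0 : 0 <= t - s by lra.
case: (leP s 1) => s1.
  have h : 1 <= s `^ (th - 1).
    by rewrite -[y0 in y0 <= _](powRr0 s) ger_powR ?s0//; lra.
  apply: le_trans (sinc_lip s t) _; rewrite distrC ger0_norm//.
  by rewrite [2 * _]mulrC -mulrA ler_peMr//; lra.
have h : s^-1 <= s `^ (th - 1).
  by rewrite -[s^-1]powR_inv1 ?(ltW s0)// ler_powR ?(ltW s1)//; lra.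
apply: le_trans (ler_wpM2l _ h); last by rewrite mulr_ge0.
rewrite /sinc !gt_eqF//.
have -> : sin s / s - sin t / t = ((sin s - sin t) + sin t * ((t - s) / t)) / s.
  by field; rewrite !gt_eqF.
rewrite normrM normfV (gtr0_norm s0) ler_wpM2r ?invr_ge0 ?(ltW s0)//.
apply: le_trans (ler_normD _ _) _.
have dts : `|s - t| = t - s by rewrite distrC ger0_norm.
have [_ h2] := cos_sin_lip s t; rewrite dts in h2.
have h3 : `|sin t * ((t - s) / t)| <= t - s.
  rewrite mulrCA normrM (ger0_norm ts0) ler_piMr//.
  by rewrite normrM normfV ler_pdivrMr ?normr_gt0 ?gt_eqF// mul1r normr_sin_le.
lra.
Qed.

End Sinc.

(** * The averaging kernel tested against the phases at a rational *)

Section Kernel.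
Variables (R : realType) (P : {poly int}) (alpha : R).
Hypotheses (degP : size P = 3%N) (leadP : 0 < lead_coef P).
Hypotheses (alpha_gt1 : 1 < alpha) (alpha_le2 : alpha <= 2).
Local Notation C := R[i].
Local Notation cabs := (@ComplexField.Normc.normc R).
Local Notation F := (poly_fourier P alpha).
Local Notation weight := (@weight R alpha).
Local Notation phase := (@phase R P).
Local Notation partial_sum := (@partial_sum R P alpha).
Local Notation poly_value := (poly_value P).

Lemma poly_value_large : exists n0 : nat, forall n, (n0 <= n)%N ->
  n.+1%:R ^+ 2 / 2 <= (poly_value n)%:~R :> R /\ (poly_value n)%:~R <= (poly_value n.+1)%:~R :> R.
Proof.
pose b := absz (P`_1); pose c := absz (P`_0).
exists (2 * (b + c))%N => n hn.
have bE : `|(P`_1)%:~R : R| = b%:R by rewrite /b natr_absz intr_norm.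
have cE : `|(P`_0)%:~R : R| = c%:R by rewrite /c natr_absz intr_norm.
have PvR k : (poly_value k)%:~R = (lead_nat P)%:R * k.+1%:R ^+ 2 + (P`_1)%:~R * k.+1%:R + (P`_0)%:~R :> R.
  by rewrite poly_valueE// !intrD !intrM.
have a1 : 1 <= (lead_nat P)%:R :> R by rewrite ler1n lead_nat_gt0.
have m1 : 1 <= n.+1%:R :> R by rewrite ler1n.
have hm : 2 * (b%:R + c%:R) <= n.+1%:R :> R.
  by rewrite -natrD -natrM ler_nat (leq_trans hn).
have := ler_norm (- (P`_1)%:~R : R); rewrite normrN bE => hb.
have := ler_norm (- (P`_0)%:~R : R); rewrite normrN cE => hc.
have b0 : 0 <= b%:R :> R by []. have c0 : 0 <= c%:R :> R by [].
rewrite !PvR -(natr1 n.+1); move: (n.+1%:R : R) m1 hm => m m1 hm.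
have am : m ^+ 2 <= (lead_nat P)%:R * m ^+ 2 by rewrite ler_peMl// sqr_ge0.
have am1 : m <= (lead_nat P)%:R * m by rewrite ler_peMl//; lra.
split.
  have h1 : - (P`_1)%:~R * m <= b%:R * m by rewrite ler_wpM2r//; lra.
  have h2 : c%:R <= c%:R * m by rewrite ler_peMr.
  have h3 : 2 * (b%:R + c%:R) * m <= m ^+ 2 by rewrite expr2 ler_wpM2r//; lra.
  lra.
have -> : (lead_nat P)%:R * (m + 1) ^+ 2 = (lead_nat P)%:R * m ^+ 2 + 2 * ((lead_nat P)%:R * m) + (lead_nat P)%:R by ring.
lra.
Qed.

Definition kernel_weight (y : R) (n : nat) : R := weight n * (1 - sinc (2 * pi * y * (poly_value n)%:~R)).

Lemma kernel_weight_ge0 y n : 0 <= kernel_weight y n.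
Proof. by rewrite mulr_ge0 ?weight_ge0 ?one_sub_sinc_ge0. Qed.

(** The exponent th interpolates between the bounds 2 and |t| for 1 - sinc t. As long as 2 th <
    alpha the total variation is O(y^th), and larger th means a smaller error next to the main term
    y^((alpha - 1) / 2). *)
Lemma kernel_weight_variation (th : R) : 0 <= th <= 1 -> exists2 K : R, 0 <= K &
  forall (y : R) n, 0 < y <= 1 ->
    kernel_weight y n <= K * n.+1%:R `^ (2 * th - alpha) * y `^ th /\
    `|kernel_weight y n - kernel_weight y n.+1| <= K * n.+1%:R `^ (- (1 + (alpha - 2 * th))) * y `^ th.
Proof.
move=> th01; case/andP: (th01) => th0 th1.
have al1 := alpha_gt1; have al2 := alpha_le2.
have [K1 K10 hK1] := @poly_value_growth R P degP leadP.
have [n0 hn0] := poly_value_large.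
have p0 := @pi_gt0 R; have p0' := ltW p0; have K10' := ltW K10.
pose A := 2 * (2 * pi * K1) `^ th.
have A0 : 0 <= A by rewrite mulr_ge0// powR_ge0.
pose Bc := 2 * (2 * pi * K1) * pi `^ (th - 1) + 2 * pi * K1 * n0.+1%:R ^+ 2.
have Bc0 : 0 <= Bc by rewrite /Bc addr_ge0// !mulr_ge0 ?powR_ge0 ?exprn_ge0.
exists (A + alpha * A + Bc).
  have : 0 <= alpha * A by rewrite mulr_ge0//; lra.
  lra.
move=> y n /andP[y0 y1].
have m1 : 1 <= n.+1%:R :> R by rewrite ler1n.
set m : R := n.+1%:R in m1 *; have m0 : 0 < m by lra.
have yth : 0 <= y `^ th by exact: powR_ge0.
pose S : R := 1 - sinc (2 * pi * y * (poly_value n)%:~R).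
have hS : S <= A * m `^ (2 * th) * y `^ th.
  apply: le_trans (one_sub_sinc_le _ th01) _.
  have -> : A * m `^ (2 * th) * y `^ th = 2 * (2 * pi * K1 * m ^+ 2 * y) `^ th.
    have c0 : 0 <= 2 * pi * K1 by rewrite !mulr_ge0.
    rewrite /A; move: (2 * pi * K1) c0 => c c0.
    have -> : (c * m ^+ 2 * y) `^ th = c `^ th * m `^ (2 * th) * y `^ th.
      rewrite powRM ?mulr_ge0 ?sqr_ge0 ?(ltW y0)// powRM ?sqr_ge0//.
      by rewrite -[m ^+ 2]powR_mulrn ?(ltW m0)// -powRrM.
    by ring.
  rewrite ler_pM2l// ge0_ler_powR ?nnegrE//; first by rewrite !mulr_ge0 ?sqr_ge0 ?(ltW y0).
  rewrite normrM gtr0_norm ?mulr_gt0//.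
  have -> : 2 * pi * K1 * m ^+ 2 * y = 2 * pi * y * (K1 * m ^+ 2) by ring.
  by rewrite ler_wpM2l ?mulr_ge0 ?(ltW y0)//; have [] := hK1 n.
have wE : weight n = m `^ (- alpha) by [].
have w0 : 0 <= weight n by exact: weight_ge0.
have S0 : 0 <= S by exact: one_sub_sinc_ge0.
split.
  rewrite /kernel_weight -/S; apply: le_trans (ler_wpM2l w0 hS) _.
  have -> : weight n * (A * m `^ (2 * th) * y `^ th) = A * (m `^ (2 * th) * m `^ (- alpha)) * y `^ th.
    by rewrite wE; ring.
  rewrite powR_add// ler_wpM2r// ler_wpM2r ?powR_ge0//.
  have : 0 <= alpha * A by rewrite mulr_ge0//; lra.
  lra.
have -> : kernel_weight y n - kernel_weight y n.+1 = (weight n - weight n.+1) * S +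
    weight n.+1 * (sinc (2 * pi * y * (poly_value n.+1)%:~R) - sinc (2 * pi * y * (poly_value n)%:~R)).
  by rewrite /kernel_weight /S; ring.
have wl := @powRN_sub_le R m n.+2%:R alpha m0 (ltr0Sn _ _) ltac:(lra).
have wg := @powRN_sub_ge R m n.+2%:R alpha m0 (ltr0Sn _ _) ltac:(lra).
have dE : n.+2%:R - m = 1 by rewrite -(natr1 n.+1) -/m; ring.
rewrite dE mulr1 -/(weight n.+1) -wE in wl wg.
have wd0 : 0 <= weight n - weight n.+1 by apply: le_trans wg; rewrite mulr_ge0 ?powR_ge0//; lra.
have mE : m `^ (- (1 + (alpha - 2 * th))) = m `^ (2 * th) * m `^ (- (1 + alpha)).
  by rewrite powR_add//; congr (_ `^ _); ring.
have part1 : `|(weight n - weight n.+1) * S| <= alpha * A * m `^ (- (1 + (alpha - 2 * th))) * y `^ th.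
  rewrite ger0_norm ?mulr_ge0//; apply: le_trans (ler_pM _ _ wl hS) _ => //.
  by rewrite mE; apply: eq_imply_le; ring.
have sd : `|sinc (2 * pi * y * (poly_value n.+1)%:~R) - sinc (2 * pi * y * (poly_value n)%:~R)| <=
    Bc * m `^ (2 * th - 1) * y `^ th.
  have [g1 g2] := hK1 n; rewrite -/m in g1 g2.
  (* From n0 on the arguments of sinc are positive and nondecreasing, so its decay can be used; the
     finitely many earlier n are absorbed by the factor [n0.+1%:R ^+ 2]. *)
  case: (leqP n0 n) => hn.
    have [l1 l2] := hn0 n hn; rewrite -/m in l1.
    have pvp : 0 < (poly_value n)%:~R :> R by apply: lt_le_trans l1; rewrite divr_gt0// exprn_gt0.
    have c0 : 0 < 2 * pi * y by rewrite !mulr_gt0.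
    rewrite distrC.
    have := @sinc_far R (2 * pi * y * (poly_value n)%:~R) (2 * pi * y * (poly_value n.+1)%:~R) th.
    rewrite mulr_gt0// ler_pM2l// => /(_ isT l2 th01) /le_trans; apply.
    rewrite -mulrBr.
    have h1 : 2 * (2 * pi * y * ((poly_value n.+1)%:~R - (poly_value n)%:~R)) <= 2 * (2 * pi * K1) * (m * y).
      have : (poly_value n.+1)%:~R - (poly_value n)%:~R <= K1 * m :> R by apply: le_trans (ler_norm _) g2.
      move=> /(ler_wpM2l (ltW c0)) h; apply: le_trans (ler_wpM2l _ h) _ => //.
      by apply: eq_imply_le; ring.
    have h2 : (2 * pi * y * (poly_value n)%:~R) `^ (th - 1) <= (pi * (m ^+ 2 * y)) `^ (th - 1).
      have -> : th - 1 = - (1 - th) by ring.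
      rewrite !powRN lef_pV2 ?posrE ?powR_gt0 ?mulr_gt0 ?exprn_gt0//.
      rewrite ge0_ler_powR ?nnegrE ?mulr_ge0 ?sqr_ge0 ?(ltW y0) ?(ltW pvp)//; first by rewrite subr_ge0; case/andP: th01.
      have := ler_wpM2l (ltW c0) l1; apply: le_trans; apply: eq_imply_le; by field.
    apply: le_trans (ler_pM _ (powR_ge0 _ _) h1 h2) _.
      by rewrite !mulr_ge0 ?(ltW y0) ?subr_ge0.
    rewrite powRM ?mulr_ge0 ?sqr_ge0 ?(ltW y0)// powRM ?sqr_ge0 ?(ltW y0)//.
    have -> : (m ^+ 2) `^ (th - 1) = m `^ (2 * (th - 1)) by rewrite -powR_mulrn ?(ltW m0)// -powRrM.
    have e1 : m * m `^ (2 * (th - 1)) = m `^ (2 * th - 1).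
      by rewrite -[y0 in y0 * _]powRr1 ?(ltW m0)// powR_add//; congr (_ `^ _); ring.
    have e2 : y * y `^ (th - 1) = y `^ th.
      by rewrite -[y0 in y0 * _]powRr1 ?(ltW y0)// powR_add//; congr (_ `^ _); ring.
    have -> : 2 * (2 * pi * K1) * (m * y) * (pi `^ (th - 1) * (m `^ (2 * (th - 1)) * y `^ (th - 1))) =
       2 * (2 * pi * K1) * pi `^ (th - 1) * (m * m `^ (2 * (th - 1))) * (y * y `^ (th - 1)) by ring.
    rewrite e1 e2 ler_wpM2r// ler_wpM2r ?powR_ge0// /Bc lerDl.
    by rewrite !mulr_ge0 ?exprn_ge0.
  apply: le_trans (sinc_lip _ _) _.
  rewrite -mulrBr normrM gtr0_norm ?mulr_gt0//.
  apply: le_trans (ler_wpM2l _ g2) _; first by rewrite !mulr_ge0 ?(ltW y0).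
  have yy : y <= y `^ th by rewrite ger1_powR ?y0.
  have mm : m <= n0.+1%:R ^+ 2 * m `^ (2 * th - 1).
    have e1 : m = m `^ (2 - 2 * th) * m `^ (2 * th - 1).
      rewrite powR_add//; have -> : 2 - 2 * th + (2 * th - 1) = 1 by ring.
      by rewrite powRr1// ltW.
    rewrite {1}e1 ler_wpM2r ?powR_ge0//.
    apply: le_trans (_ : m `^ 2%:R <= _); first by rewrite ler_powR// gerBl mulr_ge0//; case/andP: th01.
    rewrite powR_mulrn ?(ltW m0)// lerXn2r ?nnegrE ?(ltW m0)//.
    by rewrite /m ler_nat ltnS ltnW.
  have : m * y <= n0.+1%:R ^+ 2 * m `^ (2 * th - 1) * y `^ th.
    by rewrite ler_pM ?(ltW m0) ?(ltW y0).
  move=> /(ler_wpM2l (_ : 0 <= 2 * pi * K1)) -/(_ ltac:(by rewrite !mulr_ge0)) h.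
  apply: le_trans (_ : 2 * pi * K1 * (m * y) <= _); first by apply: eq_imply_le; ring.
  apply: le_trans h _.
  have -> : 2 * pi * K1 * (n0.+1%:R ^+ 2 * m `^ (2 * th - 1) * y `^ th) =
    (2 * pi * K1 * n0.+1%:R ^+ 2) * m `^ (2 * th - 1) * y `^ th by ring.
  rewrite ler_wpM2r// ler_wpM2r ?powR_ge0// /Bc lerDr.
  by rewrite !mulr_ge0 ?powR_ge0.
have part2 : `|weight n.+1 * (sinc (2 * pi * y * (poly_value n.+1)%:~R) - sinc (2 * pi * y * (poly_value n)%:~R))| <=
    Bc * m `^ (- (1 + (alpha - 2 * th))) * y `^ th.
  rewrite normrM ger0_norm ?weight_ge0//.
  apply: le_trans (ler_pM (weight_ge0 _ _) _ (_ : weight n.+1 <= weight n) sd) _ => //.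
    by rewrite -subr_ge0.
  have -> : - (1 + (alpha - 2 * th)) = - alpha + (2 * th - 1) by ring.
  by rewrite -[m `^ (- alpha + _)]powR_add// wE; apply: eq_imply_le; ring.
apply: le_trans (ler_normD _ _) _; apply: le_trans (lerD part1 part2) _.
have : 0 <= A * m `^ (- (1 + (alpha - 2 * th))) * y `^ th by rewrite !mulr_ge0 ?powR_ge0.
lra.
Qed.

(** Only the k terms k <= n < 2 k are kept, with k of order y^(-1/2). There 2 pi y P(n + 1) >= pi >=
    2, so 1 - sinc >= 1/2, and each weight is at least (2 k)^(-alpha). *)
Lemma kernel_weight_sum_ge : exists2 c : R, 0 < c & forall y : R, 0 < y <= 1 ->
  exists N0 : nat, forall N, (N0 <= N)%N -> c * y `^ ((alpha - 1) / 2) <= \sum_(n < N) kernel_weight y n.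
Proof.
have al1 := alpha_gt1; have al2 := alpha_le2.
have [n0 hn0] := poly_value_large.
have p2 := @pi_ge2 R.
exists (2 `^ (- alpha) / 2 * (n0.+2%:R) `^ (1 - alpha)).
  by rewrite mulr_gt0 ?divr_gt0 ?powR_gt0.
move=> y /andP[y0 y1].
set r := y `^ (- 2^-1).
have r1 : 1 <= r by rewrite -[y0 in y0 <= _](powRr0 y) ger_powR ?y0//; lra.
have r0 : 0 < r by lra.
have r2 : r ^+ 2 * y = 1.
  rewrite -powR_mulrn ?(ltW r0)// /r -powRrM -[y0 in _ * y0]powRr1 ?(ltW y0)// powR_add//.
  by rewrite (_ : _ + _ = 0) ?powRr0//; field.
pose k := (Num.truncn r + n0.+1)%N.
have /andP[tr1 tr2] : (Num.truncn r)%:R <= r < (Num.truncn r).+1%:R by apply: truncn_itv; exact: ltW.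
have rk : r <= k%:R.
  by rewrite (le_trans (ltW tr2))// ler_nat /k; lia.
have kr : k%:R <= n0.+2%:R * r.
  rewrite /k natrD -(natr1 n0.+1) mulrDl mul1r addrC lerD// ler_peMr//.
have k0 : 0 < k%:R :> R by lra.
have kn0 : (n0 <= k)%N by rewrite /k addnS ltnW// ltnS leq_addl.
clearbody k.
exists (k + k)%N => N hN.
apply: le_trans (_ : \sum_(n < k) kernel_weight y (n + k)%N <= _); last first.
  rewrite -!(big_mkord xpredT (kernel_weight y)) -(big_mkord xpredT (fun n => kernel_weight y (n + k)%N)).
  have -> : \sum_(0 <= n < k) kernel_weight y (n + k)%N = \sum_(k <= n < k + k) kernel_weight y n.
    have := @big_addn _ 0 +%R 0 (k + k) k xpredT (kernel_weight y).
    by rewrite add0n addnK => ->.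
  have kN : (k <= N)%N by rewrite (leq_trans _ hN)// leq_addr.
  rewrite (@big_cat_nat _ _ _ k 0%N N)// (@big_cat_nat _ _ _ (k + k) k N) ?leq_addr//=.
  by rewrite addrCA lerDl addr_ge0// sumr_ge0// => i _; exact: kernel_weight_ge0.
have term (n : 'I_k) : (2 * k%:R) `^ (- alpha) / 2 <= kernel_weight y (n + k)%N.
  rewrite /kernel_weight ler_pM ?invr_ge0 ?powR_ge0//.
    rewrite /weight !powRN lef_pV2 ?posrE ?powR_gt0 ?mulr_gt0//.
    rewrite ge0_ler_powR ?nnegrE ?mulr_ge0//; first by lra.
    by rewrite -natrM ler_nat mul2n -addnn -addSn leq_add2r.
  apply: one_sub_sinc_ge.
  have [h _] := hn0 (n + k)%N (leq_trans kn0 (leq_addl _ _)).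
  apply: le_trans (_ : 2 * pi * y * (r ^+ 2 / 2) <= _).
    have -> : 2 * pi * y * (r ^+ 2 / 2) = pi * (r ^+ 2 * y) by field.
    by rewrite r2 mulr1.
  rewrite ler_wpM2l ?mulr_ge0 ?pi_ge0 ?(ltW y0)//; apply: le_trans h.
  by rewrite ler_wpM2r// lerXn2r ?nnegrE ?(ltW r0)// (le_trans rk)// ler_nat leqW// leq_addl.
apply: le_trans (ler_sum _ (fun n _ => term n)).
rewrite sumr_const card_ord -[_ *+ k]mulr_natl powRM//.
have -> : y `^ ((alpha - 1) / 2) = r `^ (1 - alpha).
  by rewrite /r -powRrM; congr (_ `^ _); field.
have -> : k%:R * (2 `^ (- alpha) * k%:R `^ (- alpha) / 2) = 2 `^ (- alpha) / 2 * k%:R `^ (1 - alpha) :> R.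
  by rewrite -powR_add// powRr1//; ring.
rewrite -mulrA ler_wpM2l ?divr_ge0 ?powR_ge0// -powRM ?(ltW r0)//.
have -> : 1 - alpha = - (alpha - 1) by ring.
rewrite !powRN lef_pV2 ?posrE ?powR_gt0 ?mulr_gt0//.
by rewrite ge0_ler_powR ?nnegrE ?mulr_ge0 ?(ltW r0)//; lra.
Qed.

Lemma phase_periodic (p : int) (q n : nat) : (0 < q)%N ->
  phase (p%:~R / q%:R) (n + q)%N = phase (p%:~R / q%:R) n.
Proof.
move=> q0; have qR : q%:R != 0 :> R by rewrite pnatr_eq0 -lt0n.
pose k : int := 2 * (lead_nat P)%:Z * n.+1%:Z + (lead_nat P)%:Z * q%:Z + P`_1.
rewrite /phase -[RHS](e2piDint _ (k * p)); congr e2pi.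
have -> : poly_value (n + q)%N = poly_value n + q%:Z * k.
  by rewrite !poly_valueE// /k -addSn PoszD; ring.
rewrite intrD !intrM; move: (poly_value n)%:~R k%:~R p%:~R => A B D.
by rewrite -[(q%:Z)%:~R]/(q%:R); field.
Qed.

Lemma sum_periodic_mod (g : nat -> C) (q k : nat) :
  (forall n, g (n + q)%N = g n) -> \sum_(n < q) g n = 0 ->
  \sum_(n < k) g n = \sum_(n < k %% q) g n.
Proof.
move=> gq g0; suff key i j : \sum_(n < j * q + i) g n = \sum_(n < i) g n.
  by have := key (k %% q)%N (k %/ q)%N; rewrite -divn_eq.
elim: j => [|j IH]; first by rewrite mul0n add0n.
rewrite mulSn -addnA big_split_ord /= g0 add0r -[RHS]IH.
by apply: eq_bigr => n _; rewrite addnC gq.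
Qed.

(** G is the mean of the phase over one period, a Gauss sum divided by q. After subtracting G a full
    period sums to zero, so only an incomplete Gauss sum of length below q remains, which Weyl's
    inequality bounds. The latter is used with 2 s because it bounds a square. *)
Lemma gauss_partial (s : R) : 0 < s -> exists2 K : R, 0 <= K & forall (p : int) (q : nat),
  (0 < q)%N -> coprime (2 * lead_nat P) q -> coprimez p q%:Z ->
  exists2 G : C, cabs G = q%:R `^ (- 2^-1) & forall k,
    cabs (\sum_(n < k) (phase (p%:~R / q%:R) n - G)) <= K * q%:R `^ (2^-1 + s).
Proof.
move=> s0; have [K K0 hK] := @weyl_quadratic R (lead_nat P) (2 * s) (lead_nat_gt0 leadP) ltac:(by rewrite mulr_gt0).
exists (Num.sqrt (3 * K) + 1); first by rewrite addr_ge0 ?sqrtr_ge0.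
move=> p q q0 caq cpq; set r := p%:~R / q%:R.
have q1 : 1 <= q%:R :> R by rewrite ler1n.
have qR0 : 0 < q%:R :> R by lra.
pose T := weyl_sum P r q.
have TE : cabs T = q%:R `^ 2^-1.
  have := @gauss_sum_modulus R (lead_nat P) (2 * (lead_nat P)%:Z + P`_1) ((lead_nat P)%:Z + P`_1 + P`_0) p q q0 caq cpq.
  have <- : T = \sum_(n < q) e2pi (((lead_nat P)%:Z * n%:Z ^+ 2 + (2 * (lead_nat P)%:Z + P`_1) * n%:Z +
     ((lead_nat P)%:Z + P`_1 + P`_0))%:~R * (p%:~R / q%:R)).
    by apply: eq_bigr => n _; rewrite /phase poly_value_shift.
  by move=> <-; rewrite powR12_sqrt ?sqr_ge0// sqrtr_sqr ger0_norm ?cabs_ge0.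
pose G : C := (q%:R^-1)%:C%C * T.
have GE : cabs G = q%:R `^ (- 2^-1).
  rewrite /G ComplexField.Normc.normcM cabsC ger0_norm ?invr_ge0// TE.
  by rewrite -[q%:R^-1]powR_inv1// powR_add//; congr (_ `^ _); field.
exists G => // k.
pose g n := phase r n - G.
rewrite (@sum_periodic_mod g q); first last.
- rewrite sumrB -/(weyl_sum P r q) -/T sumr_const card_ord /G -mulrnAl.
  by rewrite -rmorphMn -[_ *+ q]mulr_natr mulVf ?gt_eqF// mul1r subrr.
- by move=> n; rewrite /g phase_periodic.
set i := (k %% q)%N; have iq : (i <= q)%N by rewrite ltnW// ltn_mod.
have iR : i%:R <= q%:R :> R by rewrite ler_nat.
rewrite sumrB sumr_const card_ord.
apply: le_trans (cabsB _ _) _; rewrite mulrDl mul1r lerD//; last first.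
  rewrite normcMn GE -[_ *+ i]mulr_natl.
  apply: le_trans (ler_wpM2r (powR_ge0 _ _) iR) _.
  rewrite -[y0 in y0 * _]powRr1// powR_add// ler_powR//; lra.
have := hK r ((2 * (lead_nat P)%:Z + P`_1)%:~R * r) (((lead_nat P)%:Z + P`_1 + P`_0)%:~R * r) p q i q0 cpq.
rewrite subrr normr0 invr_ge0 exprn_ge0// => /(_ isT).
rewrite -weyl_sum_quadratic// -/(weyl_sum P r i) => hS.
rewrite -(ler_pXn2r (_ : 0 < 2)%N) ?nnegrE ?cabs_ge0 ?mulr_ge0 ?sqrtr_ge0 ?powR_ge0//.
apply: le_trans hS _; rewrite exprMn sqr_sqrtr ?mulr_ge0//.
have -> : (q%:R `^ (2^-1 + s)) ^+ 2 = q%:R `^ (2 * s) * q%:R :> R.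
  rewrite -powR_mulrn ?powR_ge0// -powRrM.
  have -> : q%:R `^ (2 * s) * q%:R = q%:R `^ (2 * s) * q%:R `^ 1 :> R by rewrite powRr1.
  by rewrite powR_add//; congr (_ `^ _); field.
have -> : 3 * K * (q%:R `^ (2 * s) * q%:R) = K * q%:R `^ (2 * s) * (3 * q%:R) by ring.
rewrite ler_wpM2l ?mulr_ge0 ?powR_ge0//.
have : i%:R ^+ 2 / q%:R <= q%:R :> R.
  by rewrite ler_pdivrMr// expr2 ler_pM.
lra.
Qed.

(** The phase is split into its mean G and a fluctuation. The weights are nonnegative, so nothing
    cancels in G times their sum; the fluctuation is summed by parts against the variation of the
    weights. *)
Lemma kernel_lower (th s : R) : 0 <= th -> 2 * th < alpha -> 0 < s ->
  exists c K : R, [/\ 0 < c, 0 <= K & forall (p : int) (q : nat) (y : R),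
    (0 < q)%N -> coprime (2 * lead_nat P) q -> coprimez p q%:Z -> 0 < y <= 1 ->
    exists N0 : nat, forall N, (N0 <= N)%N ->
      c * q%:R `^ (- 2^-1) * y `^ ((alpha - 1) / 2) - K * q%:R `^ (2^-1 + s) * y `^ th
      <= cabs (\sum_(n < N.+1) (kernel_weight y n)%:C%C * phase (p%:~R / q%:R) n)].
Proof.
move=> th0 th1 s0; have al1 := alpha_gt1; have al2 := alpha_le2.
have th01 : 0 <= th <= 1 by rewrite th0 /=; lra.
have [K1 K10 hK1] := gauss_partial s0.
have [K2 K20 hK2] := kernel_weight_variation th01.
have [c c0 hc] := kernel_weight_sum_ge.
pose d := alpha - 2 * th; have d0 : 0 < d by rewrite /d; lra.
exists c, (K1 * K2 * (1 + zeta_bound d)); split => //.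
  by rewrite !mulr_ge0// addr_ge0// zeta_bound_ge0.
move=> p q y q0 caq cpq hy; set r := p%:~R / q%:R.
have [G GE hG] := hK1 p q q0 caq cpq.
have [N0 hN0] := hc y hy.
exists N0 => N hN.
pose g n : C := (kernel_weight y n)%:C%C.
have -> : \sum_(n < N.+1) g n * phase r n = G * \sum_(n < N.+1) g n + \sum_(n < N.+1) g n * (phase r n - G).
  by rewrite mulr_sumr -big_split /=; apply: eq_bigr => n _; ring.
have main : c * q%:R `^ (- 2^-1) * y `^ ((alpha - 1) / 2) <= cabs (G * \sum_(n < N.+1) g n).
  rewrite ComplexField.Normc.normcM GE -[c * _]mulrC -mulrA ler_wpM2l ?powR_ge0//.
  rewrite /g -rmorph_sum cabsC (le_trans (hN0 N.+1 (leqW hN)))// ler_norm//.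
have err : cabs (\sum_(n < N.+1) g n * (phase r n - G)) <= K1 * K2 * (1 + zeta_bound d) * q%:R `^ (2^-1 + s) * y `^ th.
  pose B (n : nat) := K1 * q%:R `^ (2^-1 + s).
  have B0 : 0 <= K1 * q%:R `^ (2^-1 + s) by rewrite mulr_ge0// powR_ge0.
  apply: le_trans (@sum_by_parts_bound R g (fun n => phase r n - G) B N (fun n _ => hG n.+1)) _.
  rewrite /B -mulr_suml -mulrDl.
  have -> : K1 * K2 * (1 + zeta_bound d) * q%:R `^ (2^-1 + s) * y `^ th =
    (K2 * (1 + zeta_bound d) * y `^ th) * (K1 * q%:R `^ (2^-1 + s)) by ring.
  rewrite ler_wpM2r// mulrDr mulr1 mulrDl lerD//.
    rewrite /g cabsC ger0_norm ?kernel_weight_ge0//.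
    have [h _] := hK2 y N hy; apply: le_trans h _.
    rewrite ler_wpM2r ?powR_ge0// ler_piMr//.
    by rewrite -[X in _ <= X](powRr0 N.+1%:R) ler_powR ?ler1n//; lra.
  rewrite -mulrA [zeta_bound d * _]mulrC mulrA.
  apply: le_trans (ler_wpM2l _ (sum_powRN_le N d0)); last by rewrite mulr_ge0// powR_ge0.
  rewrite mulr_sumr; apply: ler_sum => n _.
  rewrite /g -rmorphB cabsC; have [_ h] := hK2 y n hy.
  by apply: le_trans h _; apply: eq_imply_le; rewrite /d; ring.
have h1 := cabsB (G * \sum_(n < N.+1) g n + \sum_(n < N.+1) g n * (phase r n - G)) (\sum_(n < N.+1) g n * (phase r n - G)).
rewrite addrK in h1.
lra.
Qed.

Lemma Re_realM (a : R) (z : C) : complex.Re (a%:C%C * z) = a * complex.Re z.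
Proof. by case: z => u v /=; rewrite mul0r subr0. Qed.

Lemma Im_realM (a : R) (z : C) : complex.Im (a%:C%C * z) = a * complex.Im z.
Proof. by case: z => u v /=; rewrite mul0r addr0. Qed.

(** The mean value argument is real, so [proj] is to be the real or the imaginary part. Adding the
    values at r + u and r - u turns e(P(n) u) into a cosine, and the kernel sum is the value at u =
    0 minus the mean; each of these is within B of [proj Zc], whence 2 B. *)
Lemma kernel_proj (proj : C -> R) (r y : R) (Zc : C) (B : R) N :
  (forall z w, proj (z + w) = proj z + proj w) ->
  (forall (a : R) z, proj (a%:C%C * z) = a * proj z) ->
  (forall z, `|proj z| <= cabs z) -> 0 < y ->
  (forall u, `|u| <= y -> cabs (partial_sum (r + u) N - Zc) <= B) ->
  `|proj (\sum_(n < N) (kernel_weight y n)%:C%C * phase r n)| <= 2 * B.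
Proof.
move=> pD pZ ple y0 hB.
have p0 : proj 0 = 0 by rewrite -[0 in LHS](mul0r 0) -(rmorph0 (real_complex R)) pZ mul0r.
have psumE (F0 : 'I_N -> C) : proj (\sum_(n < N) F0 n) = \sum_(n < N) proj (F0 n).
  by apply: (big_morph _ pD p0).
pose A n := weight n * proj (phase r n).
pose l n : R := 2 * pi * (poly_value n)%:~R.
have hcos u : 0 <= u <= y -> `|\sum_(n < N) A n * cos (l n * u) - proj Zc| <= B.
  move=> /andP[u0 uy].
  have h1 := hB u; rewrite ger0_norm// in h1; have {}h1 := h1 uy.
  have h2 := hB (- u); rewrite normrN ger0_norm// in h2; have {}h2 := h2 uy.
  have E : (partial_sum (r + u) N - Zc) + (partial_sum (r - u) N - Zc) =
     2%:C%C * (\sum_(n < N) (weight n * cos (l n * u))%:C%C * phase r n - Zc).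
    have -> : (partial_sum (r + u) N - Zc) + (partial_sum (r - u) N - Zc) =
       (partial_sum (r + u) N + partial_sum (r - u) N) - (1 + 1) * Zc by ring.
    rewrite mulrBr; congr (_ - _); last by rewrite -[2]/(1 + 1) rmorphD rmorph1.
    rewrite /partial_sum -big_split mulr_sumr /=; apply: eq_bigr => n _.
    rewrite /phase !mulrDr !e2piD mulrN e2piN.
    have -> : (weight n)%:C%C * (e2pi ((poly_value n)%:~R * r) * e2pi ((poly_value n)%:~R * u)) +
       (weight n)%:C%C * (e2pi ((poly_value n)%:~R * r) * conjc (e2pi ((poly_value n)%:~R * u))) =
       (weight n)%:C%C * (e2pi ((poly_value n)%:~R * u) + conjc (e2pi ((poly_value n)%:~R * u))) * e2pi ((poly_value n)%:~R * r) by ring.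
    rewrite addcJ -[complex.Re _]/(cos (2 * pi * ((poly_value n)%:~R * u))).
    have -> : 2 * pi * ((poly_value n)%:~R * u) = l n * u by rewrite /l mulrA.
    have two : (2 : R)%:C%C = 2 :> C by rewrite rmorph_nat.
    by rewrite two rmorphM /=; ring.
  have := le_trans (ple _) (le_trans (cabsD _ _) (lerD h1 h2)).
  rewrite E pZ normrM ger0_norm// => h3.
  have -> : \sum_(n < N) A n * cos (l n * u) - proj Zc =
     proj (\sum_(n < N) (weight n * cos (l n * u))%:C%C * phase r n - Zc).
    rewrite pD; have -> : proj (- Zc) = - proj Zc.
      by apply/eqP; rewrite -addr_eq0 -pD addNr p0.
    rewrite psumE; congr (_ - _); apply: eq_bigr => n _.
    by rewrite pZ /A; ring.
  lra.
have h1 := sinc_average y0 hcos.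
have h0 := hcos 0; rewrite lexx ltW// in h0; have {}h0 := h0 isT.
have -> : proj (\sum_(n < N) (kernel_weight y n)%:C%C * phase r n) =
   (\sum_(n < N) A n * cos (l n * 0) - proj Zc) - (\sum_(n < N) A n * sinc (l n * y) - proj Zc).
  rewrite psumE opprB addrA subrK -sumrB; apply: eq_bigr => n _.
  rewrite pZ mulr0 cos0 mulr1 /kernel_weight /A.
  have -> : 2 * pi * y * (poly_value n)%:~R = l n * y by rewrite /l; ring.
  by ring.
apply: le_trans (ler_normB _ _) _; lra.
Qed.

(** The reference value [Zc] is left free so that it can be F at a point x near p/q: a Hoelder bound
    at x then supplies B. The factor 4 is 2 for the real part plus 2 for the imaginary part. *)
Lemma oscillation_lower (th s : R) : 0 <= th -> 2 * th < alpha -> 0 < s ->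
  exists c K : R, [/\ 0 < c, 0 <= K & forall (p : int) (q : nat) (y : R) (Zc : C) (B : R),
    (0 < q)%N -> coprime (2 * lead_nat P) q -> coprimez p q%:Z -> 0 < y <= 1 ->
    (forall u, `|u| <= y -> cabs (F (p%:~R / q%:R + u) - Zc) <= B) ->
    c * q%:R `^ (- 2^-1) * y `^ ((alpha - 1) / 2) <= 4 * B + K * q%:R `^ (2^-1 + s) * y `^ th].
Proof.
move=> th0 th1 s0; have [c [K [c0 K0 h]]] := kernel_lower th0 th1 s0.
exists c, K; split=> // p q y Zc B q0 caq cpq hy hB; case/andP: (hy) => y0 _.
have [N0 hN0] := h p q y q0 caq cpq hy.
apply/ler_addgt0Pr => d d0.
have [N1 hN1] := @poly_fourier_approx R P alpha alpha_gt1 (d / 4) ltac:(by rewrite divr_gt0).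
pose N := maxn N0 N1.
have hN := hN0 N (leq_maxl _ _).
set r := p%:~R / q%:R in hB hN.
have hB' u : `|u| <= y -> cabs (partial_sum (r + u) N.+1 - Zc) <= B + d / 4.
  move=> uy; apply: le_trans (cabs_le_dist _ (F (r + u)) _) _.
  by rewrite addrC lerD ?hB// cabsBC; apply: hN1; rewrite leqW// leq_maxr.
have a1 := @kernel_proj (@complex.Re R) r y Zc _ N.+1 (fun z w => raddfD (@complex.Re R : Rcomplex R -> R) z w) Re_realM (@Re_le_cabs R) y0 hB'.
have a2 := @kernel_proj (@complex.Im R) r y Zc _ N.+1 (fun z w => raddfD (@complex.Im R : Rcomplex R -> R) z w) Im_realM (@Im_le_cabs R) y0 hB'.
have a3 := cabs_le_ReIm (\sum_(n < N.+1) (kernel_weight y n)%:C%C * phase r n).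
lra.
Qed.

End Kernel.

(** * Hoelder exponents *)

Section Exponents.
Variables (R : realType) (P : {poly int}) (alpha : R).
Hypotheses (degP : size P = 3%N) (leadP : 0 < lead_coef P).
Hypotheses (alpha_gt1 : 1 < alpha) (alpha_le2 : alpha <= 2).
Local Notation C := R[i].
Local Notation cabs := (@ComplexField.Normc.normc R).
Local Notation F := (poly_fourier P alpha).

Lemma poly_bounded (Q : {poly C}) : exists2 L : R, 0 <= L &
  forall h : R, `|h| <= 1 -> cabs Q.[h%:C%C] <= L.
Proof.
elim/poly_ind: Q => [|Q c [L L0 hL]].
  by exists 0 => // h _; rewrite horner0 ComplexField.Normc.normc0.
exists (L + cabs c); first by rewrite addr_ge0 ?cabs_ge0.
move=> h h1; rewrite hornerMXaddC (le_trans (cabsD _ _))// lerD2r.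
rewrite ComplexField.Normc.normcM cabsC.
by rewrite -[L]mulr1 ler_pM ?cabs_ge0 ?hL.
Qed.

Lemma poly_lip0 (Q : {poly C}) : exists2 L : R, 0 <= L &
  forall h : R, `|h| <= 1 -> cabs (Q.[h%:C%C] - Q.[0]) <= L * `|h|.
Proof.
elim/poly_ind: Q => [|Q c _].
  by exists 0 => // h _; rewrite !horner0 subrr ComplexField.Normc.normc0 mul0r.
have [L L0 hL] := poly_bounded Q; exists L => // h h1.
rewrite !hornerMXaddC mulr0 add0r addrK ComplexField.Normc.normcM cabsC.
by rewrite ler_wpM2r ?hL.
Qed.

Lemma powR_small (a d : R) : 0 < a -> 0 < d ->
  exists2 t : R, 0 < t & forall h, 0 <= h <= t -> h `^ d <= a.
Proof.
move=> a0 d0; exists (a `^ d^-1); first exact: powR_gt0.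
move=> h /andP[h0 ht]; have -> : a = (a `^ d^-1) `^ d.
  by rewrite -powRrM mulVf ?powRr1 ?(ltW a0)// gt_eqF.
by rewrite ge0_ler_powR ?nnegrE ?powR_ge0 ?(ltW d0).
Qed.

Lemma powR_nat_large (a d : R) : 0 < d ->
  exists N : nat, forall q : nat, (N <= q)%N -> a < q%:R `^ d.
Proof.
move=> d0; pose b := (`|a| + 1) `^ d^-1.
exists (Num.truncn b).+1 => q hq.
have b0 : 0 <= b by exact: powR_ge0.
have /andP[_ h] := truncn_itv b0.
have a1 : 0 < `|a| + 1 by rewrite ltr_wpDl.
have : b `^ d <= q%:R `^ d.
  rewrite ge0_ler_powR ?nnegrE ?(ltW d0)//.
  by rewrite (le_trans (ltW h))// ler_nat.
rewrite /b -powRrM mulVf ?gt_eqF// powRr1 ?(ltW a1)//.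
by apply: lt_le_trans; have := ler_norm a; lra.
Qed.

(* As [g' <= 1], only the constant term of the polynomial matters. *)
Lemma holder_le1 (g g' x : R) : 0 < x < 1 -> pointwise_holder F g x ->
  0 < g' <= 1 -> g' <= g ->
  exists M d : R, [/\ 0 <= M, 0 < d & forall h, `|h| <= d ->
    cabs (F (x + h) - F x) <= M * `|h| `^ g'].
Proof.
have al1 := alpha_gt1; have al2 := alpha_le2.
move=> /andP[x0 x1] [g0 [Q [_ [M]]]]; rewrite near_withinE => /nbhs_ballP [d /= d0 hd].
move=> /andP[g'0 g'1] g'g.
have [L L0 hL] := poly_lip0 Q.
pose d1 := Num.min (d / 2) (Num.min 1 (Num.min x (1 - x))).
have d10 : 0 < d1 by rewrite !lt_min divr_gt0// x0 subr_gt0 x1 ltr01.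
pose M1 := `|M| + L.
have M10 : 0 <= M1 by rewrite addr_ge0.
have hQ h : 0 < `|h| <= d1 -> cabs (F (x + h) - Q.[0]) <= M1 * `|h| `^ g'.
  move=> /andP[h0]; rewrite !le_min => /andP[h1 /andP[h2 /andP[h3 h4]]].
  have hd2 : `|h| < d by lra.
  have := hd h; rewrite /ball /= sub0r normrN => /(_ hd2).
  rewrite -normr_gt0 => /(_ h0).
  have := ler_norm h; have := ler_norm (- h); rewrite normrN => hh1 hh2.
  have xh : 0 <= x + h <= 1 by apply/andP; split; lra.
  rewrite in_itv /= => /(_ xh).
  rewrite cabsE lecR => hF.
  apply: le_trans (cabs_le_dist _ (Q.[h%:C%C]) _) _; rewrite mulrDl lerD//.
    apply: le_trans hF _; apply: le_trans (ler_wpM2r (powR_ge0 _ _) (ler_norm M)) _.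
    by rewrite ler_wpM2l// ger_powR// h0.
  apply: le_trans (hL h h2) _; rewrite ler_wpM2l//.
  by rewrite ger1_powR// h0.
(* [pointwise_holder] concerns a punctured neighbourhood, so the constant term is identified through
   continuity of F at x, which is [fourier_increment] with kappa = 0. *)
have QF : F x = Q.[0].
  have hs1 : 0 < (alpha - 1) / 4 by lra.
  have hs2 : (alpha - 1) / 4 <= (alpha - 1) / 2 by lra.
  have hk : 0 <= (0 : R) <= 2^-1 by rewrite lexx /=; lra.
  have [K K0 hK] := @fourier_increment R P alpha degP leadP al1 al2 x 0 _ hk hs1 hs2 (sums_small0 P x hs1).
  apply/eqP; rewrite -subr_eq0; apply/eqP; apply: ComplexField.Normc.eq0_normc.
  apply/eqP; rewrite eq_le cabs_ge0 andbT; apply/ler_addgt0Pr => e e0; rewrite add0r.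
  have K1 : 0 < K + 1 by lra. have M11 : 0 < M1 + 1 by lra.
  have e1 : 0 < e / 2 / (K + 1) by rewrite !divr_gt0.
  have e2 : 0 < e / 2 / (M1 + 1) by rewrite !divr_gt0.
  set r := (alpha - 1) / 2 + 0 / 2 - (alpha - 1) / 4 in hK.
  have r0 : 0 < r by rewrite /r; lra.
  have [t1 t10 ht1] := powR_small e1 r0.
  have [t2 t20 ht2] := powR_small e2 g'0.
  pose h := Num.min d1 (Num.min t1 t2).
  have h0 : 0 < h by rewrite lt_min d10 lt_min t10.
  have hh1 : h <= d1 by rewrite ge_min lexx.
  have hh2 : h <= t1 by rewrite ge_min; apply/orP; right; rewrite ge_min lexx.
  have hh3 : h <= t2 by rewrite ge_min; apply/orP; right; rewrite ge_min lexx orbT.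
  have d11 : d1 <= 1 by rewrite /d1 !ge_min lexx orbT.
  have a1 := hK h; rewrite gtr0_norm// h0 (le_trans hh1 d11) in a1; have {}a1 := a1 isT.
  have a2 := hQ h; rewrite gtr0_norm// h0 hh1 in a2; have {}a2 := a2 isT.
  apply: le_trans (cabs_le_dist _ (F (x + h)) _) _.
  rewrite [e]splitr lerD//.
    rewrite cabsBC; apply: le_trans a1 _.
    apply: le_trans (_ : (K + 1) * (e / 2 / (K + 1)) <= _); last by rewrite mulrC divfK// gt_eqF.
    rewrite ler_pM ?powR_ge0//; first by rewrite lerDl.
    by apply: ht1; rewrite ltW.
  apply: le_trans a2 _.
  apply: le_trans (_ : (M1 + 1) * (e / 2 / (M1 + 1)) <= _); last by rewrite mulrC divfK// gt_eqF.
  rewrite ler_pM ?powR_ge0//; first by rewrite lerDl.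
  by apply: ht2; rewrite ltW.
exists M1, d1; split => // h hd1.
have [->|hn0] := eqVneq h 0; first by rewrite addr0 subrr ComplexField.Normc.normc0 mulr_ge0 ?powR_ge0.
by rewrite QF hQ// normr_gt0 hn0.
Qed.

Lemma exponent_ge (x kappa : R) : 0 <= kappa <= 2^-1 ->
  (forall s : R, 0 < s -> sums_small P x kappa s) ->
  (((alpha - 1) / 2 + kappa / 2)%:E <= holder_exponent F x)%E.
Proof.
have al1 := alpha_gt1; have al2 := alpha_le2.
move=> hk hs; apply/lee_addgt0Pr => e e0.
pose s := Num.min e ((alpha - 1) / 2).
have s0 : 0 < s by rewrite lt_min e0 divr_gt0// subr_gt0.
have se : s <= e by rewrite ge_min lexx.
have sa : s <= (alpha - 1) / 2 by rewrite ge_min lexx orbT.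
have [K K0 hK] := @fourier_increment R P alpha degP leadP al1 al2 x kappa s hk s0 sa (hs s s0).
set g := (alpha - 1) / 2 + kappa / 2 - s in hK.
have g0 : 0 <= g by case/andP: hk => k0 k1; rewrite /g; lra.
have : (g%:E <= holder_exponent F x)%E.
  apply: ereal_sup_ubound; exists g => //; split => //.
  exists (F x)%:P; split.
    by rewrite size_polyC; case: (_ != _) => /=.
  exists K; rewrite near_withinE; apply/nbhs_ballP; exists 1 => //= h.
  rewrite /ball /= sub0r normrN => h1 hn0 _.
  by rewrite hornerC cabsE lecR hK// normr_gt0 hn0 ltW.
move=> hg; apply: le_trans (_ : (g%:E + e%:E <= _)%E); last by rewrite leeD2r.
by rewrite -EFinD lee_fin /g; lra.
Qed.

(** An exponent g above the bound would make F vary by at most M (q^(-tau))^g' on the interval of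
    radius y around p/q, up to a constant. For large q this is below the oscillation q^(-1/2)
    y^((alpha - 1) / 2), while the error term of the oscillation bound is below it as well. *)
Lemma exponent_le_good (x tau K0 : R) : 0 < x < 1 -> 2 <= tau -> 0 < K0 ->
  (forall N : nat, exists (p : int) (q : nat), [/\ (N < q)%N, coprime (2 * lead_nat P) q,
     coprimez p q%:Z & `|x - p%:~R / q%:R| <= K0 * q%:R `^ (- tau)]) ->
  (holder_exponent F x <= ((alpha - 1) / 2 + (2 * tau)^-1)%:E)%E.
Proof.
have al1 := alpha_gt1; have al2 := alpha_le2.
move=> hx tau2 K00 hgood; apply: ub_ereal_sup => _ [g hg <-]; rewrite lee_fin.
set b := _ + _; rewrite leNgt; apply/negP => bg.
have tau0 : 0 < tau by lra.
have ti : tau * (2 * tau)^-1 = 2^-1 by field; rewrite gt_eqF.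
have ti4 : (2 * tau)^-1 <= 4^-1 by rewrite lef_pV2 ?posrE; lra.
have ti0 : 0 < (2 * tau)^-1 by rewrite invr_gt0 mulr_gt0.
pose g0 := (alpha - 1) / 2.
have g00 : 0 < g0 <= 2^-1 by rewrite /g0; lra.
have bE : b = g0 + (2 * tau)^-1 by [].
pose g' := Num.min g 1.
have g'g : g' <= g by rewrite ge_min lexx.
have g'1 : g' <= 1 by rewrite ge_min lexx orbT.
have g'b : b < g' by rewrite lt_min bg /= bE; lra.
have g'0 : 0 < g' by lra.
have g'01 : 0 < g' <= 1 by rewrite g'0.
have [M [d [M0 d0 hM]]] := holder_le1 hx hg g'01 g'g.
pose D := tau * (g' - b).
have D0 : 0 < D by rewrite mulr_gt0// subr_gt0.
have DE : D = tau * g' - tau * g0 - 2^-1 by rewrite /D bE -ti; ring.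
(* The radius is q^(-tau - eta). At tau = 2 some eta > 0 is required for the error term to be
   smaller than the main one; eta <= D keeps the Hoelder bound smaller too. *)
pose eta := Num.min D 1.
have eta0 : 0 < eta by rewrite lt_min D0 ltr01.
have etaD : eta <= D by rewrite ge_min lexx.
have eta1 : eta <= 1 by rewrite ge_min lexx orbT.
pose tau' := tau + eta.
have tau'0 : 0 < tau' by rewrite addr_gt0.
pose e1 := eta / (8 * tau').
have e1t : tau' * e1 = eta / 8 by rewrite /e1; field; rewrite gt_eqF.
have e10 : 0 < e1 by rewrite divr_gt0// mulr_gt0.
have e11 : e1 <= 2^-1.
  have : 2 * e1 <= tau' * e1 by rewrite ler_pM2r// /tau'; lra.
  rewrite e1t; lra.
pose th := alpha / 2 - e1.
have th_ge0 : 0 <= th by rewrite /th; lra.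
have th_lt : 2 * th < alpha by rewrite /th; lra.
have eta8 : 0 < eta / 8 by lra.
have [c [K [c0 Kp hc]]] := @oscillation_lower R P alpha degP leadP al1 al2 th (eta / 8) th_ge0 th_lt eta8.
(* The powers of q by which the main term exceeds the Hoelder bound (d1) and the error term (d2). *)
pose d1 := tau * g' - 2^-1 - tau' * g0.
pose d2 := tau' * (th - g0) - 1 - eta / 8.
have d10 : 0 < d1.
  have -> : d1 = D - eta * g0 by rewrite /d1 /tau' DE; ring.
  have /andP[h1 h2] := g00.
  have h3 : eta * g0 <= D * 2^-1 by rewrite ler_pM ?(ltW eta0) ?(ltW h1).
  by rewrite subr_gt0 (le_lt_trans h3)// ltr_pdivrMr// ltr_pMr// ltr1n.
have d20 : 0 < d2.
  have -> : d2 = tau' / 2 - eta / 8 - 1 - eta / 8.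
    by rewrite /d2 /th -e1t /g0; field.
  by rewrite /tau'; lra.
pose dd := Num.min d1 d2.
have dd0 : 0 < dd by rewrite lt_min d10.
pose A := 4 * (M * (K0 + 1) `^ g') + K.
have [N1 hN1] := @powR_nat_large (A / c) dd dd0.
have [N2 hN2] := @powR_nat_large ((K0 + 1) / d) tau tau0.
have [p [q [Nq caq cpq hpq]]] := hgood (maxn N1 N2).
have q_gt0 : (0 < q)%N by exact: leq_ltn_trans Nq.
have q1 : 1 <= q%:R :> R by rewrite ler1n.
have q0 : 0 < q%:R :> R by rewrite ltr0n.
have hq1 := hN1 q (leq_trans (leq_maxl _ _) (ltnW Nq)).
have hq2 := hN2 q (leq_trans (leq_maxr _ _) (ltnW Nq)).
pose y := q%:R `^ (- tau').
have y0 : 0 < y by exact: powR_gt0.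
have y1 : y <= 1.
  by rewrite -[X in _ <= X](powRr0 q%:R) ler_powR// oppr_le0 ltW.
have ytau : y <= q%:R `^ (- tau) by rewrite ler_powR// lerN2 lerDl ltW.
pose rho := (K0 + 1) * q%:R `^ (- tau).
have rhod : rho <= d.
  rewrite /rho powRN ler_pdivrMr ?powR_gt0// mulrC -ler_pdivrMr// ltW//.
have K01 : 0 <= K0 + 1 by rewrite addr_ge0// ltW.
have rho0 : 0 <= rho by rewrite mulr_ge0 ?powR_ge0.
have hB u : `|u| <= y -> cabs (F (p%:~R / q%:R + u) - F x) <= M * rho `^ g'.
  move=> uy; have -> : p%:~R / q%:R + u = x + (u - (x - p%:~R / q%:R)) by ring.
  have hu : `|u - (x - p%:~R / q%:R)| <= rho.
    apply: le_trans (ler_normB _ _) _; rewrite /rho mulrDl mul1r addrC lerD//.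
    exact: le_trans uy ytau.
  apply: le_trans (hM _ (le_trans hu rhod)) _; rewrite ler_wpM2l//.
  by rewrite ge0_ler_powR ?nnegrE ?(ltW g'0).
have y01 : 0 < y <= 1 by rewrite y0.
have := hc p q y (F x) _ q_gt0 caq cpq y01 hB.
pose W := q%:R `^ (- 2^-1 - tau' * g0).
have W0 : 0 < W by exact: powR_gt0.
have -> : c * q%:R `^ (- 2^-1) * y `^ ((alpha - 1) / 2) = c * W.
  by rewrite /y -powRrM -mulrA powR_add// /W -/g0 mulNr.
have -> : 4 * (M * rho `^ g') = 4 * (M * (K0 + 1) `^ g') * q%:R `^ (- d1) * W.
  rewrite /rho powRM ?powR_ge0//.
  rewrite -powRrM -[_ * W]mulrA /W powR_add//.
  have -> : - d1 + (- 2^-1 - tau' * g0) = - tau * g' by rewrite /d1; ring.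
  by ring.
have -> : K * q%:R `^ (2^-1 + eta / 8) * y `^ th = K * q%:R `^ (- d2) * W.
  rewrite /y -powRrM -!mulrA /W !powR_add//; congr (_ * _ `^ _).
  by rewrite /d2; field.
have p1 : q%:R `^ (- d1) <= q%:R `^ (- dd) :> R by rewrite ler_powR// lerN2 ge_min lexx.
have p2 : q%:R `^ (- d2) <= q%:R `^ (- dd) :> R by rewrite ler_powR// lerN2 ge_min lexx orbT.
have M40 : 0 <= 4 * (M * (K0 + 1) `^ g') by rewrite !mulr_ge0 ?powR_ge0.
rewrite -mulrDl ler_pM2r// => h.
have : c <= A * q%:R `^ (- dd).
  apply: le_trans h _; have := ler_wpM2l M40 p1; have := ler_wpM2l Kp p2.
  by rewrite /A [X in _ -> _ -> _ <= X]mulrDl => l1 l2; exact: lerD.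
rewrite leNgt => /negP; apply.
rewrite powRN ltr_pdivrMr ?powR_gt0// mulrC -ltr_pdivrMr//.
Qed.

(** Here q is fixed and y tends to 0, so powers of q are constants, and any th strictly between
    (alpha - 1) / 2 and alpha / 2 makes the error negligible. *)
Lemma exponent_le_rational (p : int) (q : nat) :
  (0 < q)%N -> coprime (2 * lead_nat P) q -> coprimez p q%:Z -> 0 < (p%:~R / q%:R : R) < 1 ->
  (holder_exponent F (p%:~R / q%:R) <= ((alpha - 1) / 2)%:E)%E.
Proof.
have al1 := alpha_gt1; have al2 := alpha_le2.
move=> q_gt0 caq cpq hx; apply: ub_ereal_sup => _ [g hg <-]; rewrite lee_fin.
set b := _ / 2; rewrite leNgt; apply/negP => bg.
pose g' := Num.min g 1.
have b1 : 0 < b <= 2^-1 by rewrite /b; lra.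
have g'g : g' <= g by rewrite ge_min lexx.
have g'1 : g' <= 1 by rewrite ge_min lexx orbT.
have g'b : b < g' by rewrite lt_min bg /=; lra.
have g'0 : 0 < g' by lra.
have g'01 : 0 < g' <= 1 by rewrite g'0.
have [M [d [M0 d0 hM]]] := holder_le1 hx hg g'01 g'g.
pose th := alpha / 2 - 4^-1.
have th_ge0 : 0 <= th by rewrite /th; lra.
have th_lt : 2 * th < alpha by rewrite /th; lra.
have [c [K [c0 Kp hc]]] := @oscillation_lower R P alpha degP leadP al1 al2 th 1 th_ge0 th_lt ltr01.
pose dd := Num.min (g' - b) 4^-1.
have dd0 : 0 < dd by rewrite lt_min; apply/andP; split; lra.
have q0 : 0 < q%:R :> R by rewrite ltr0n.
have qa0 : 0 < q%:R `^ (- 2^-1) :> R by exact: powR_gt0.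
pose A := 4 * M + K * q%:R `^ (2^-1 + 1).
pose cc := c * q%:R `^ (- 2^-1).
have cc0 : 0 < cc by rewrite mulr_gt0.
have [N1 hN1] := @powR_nat_large (A / cc) dd dd0.
have [N2 hN2] := @powR_nat_large d^-1 1 ltr01.
pose k := (maxn N1 N2).+1.
have k1 : 1 <= k%:R :> R by rewrite ler1n.
have k0 : 0 < k%:R :> R by lra.
have hk1 := hN1 k (leqW (leq_maxl _ _)).
have hk2 := hN2 k (leqW (leq_maxr _ _)).
rewrite powRr1 ?(ltW k0)// in hk2.
pose y := k%:R `^ (-1) : R.
have yE : y = k%:R^-1 by rewrite /y powR_inv1 ?ltW.
have y0 : 0 < y by exact: powR_gt0.
have y1 : y <= 1 by rewrite yE invf_le1.
have yd : y <= d by rewrite yE -[d]invrK lef_pV2 ?posrE ?invr_gt0// ltW.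
have hB u : `|u| <= y -> cabs (F (p%:~R / q%:R + u) - F (p%:~R / q%:R)) <= M * y `^ g'.
  move=> uy; apply: le_trans (hM u (le_trans uy yd)) _; rewrite ler_wpM2l//.
  by rewrite ge0_ler_powR ?nnegrE ?(ltW g'0) ?(ltW y0).
have y01 : 0 < y <= 1 by rewrite y0.
have := hc p q y _ _ q_gt0 caq cpq y01 hB.
rewrite -/b -/cc.
have yb0 : 0 < y `^ b by exact: powR_gt0.
have e1 : y `^ g' = y `^ (g' - b) * y `^ b by rewrite powR_add// subrK.
have e2 : y `^ th = y `^ 4^-1 * y `^ b.
  by rewrite powR_add//; congr (_ `^ _); rewrite /th /b; field.
rewrite e1 e2 !mulrA -mulrDl ler_pM2r// => h.
have p1 : y `^ (g' - b) <= y `^ dd by rewrite ger_powR ?y0// ge_min lexx.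
have p2 : y `^ 4^-1 <= y `^ dd by rewrite ger_powR ?y0// ge_min lexx orbT.
have M40 : 0 <= 4 * M by rewrite mulr_ge0.
have Kp' : 0 <= K * q%:R `^ (2^-1 + 1) by rewrite mulr_ge0 ?powR_ge0.
have : cc <= A * y `^ dd.
  apply: le_trans h _; have := ler_wpM2l M40 p1; have := ler_wpM2l Kp' p2.
  by rewrite /A [X in _ -> _ -> _ <= X]mulrDl => l1 l2; exact: lerD.
have -> : y `^ dd = (k%:R `^ dd)^-1.
  by rewrite /y -powRrM mulN1r powRN.
rewrite leNgt => /negP; apply.
by rewrite ltr_pdivrMr ?powR_gt0// mulrC -ltr_pdivrMr.
Qed.

End Exponents.

(** * Hausdorff measures *)

Section Hausdorff.
Variable R : realType.
Implicit Types (A U : set R) (s d x y : R).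

Lemma diam_pow_ge0 s U : (0 <= diam_pow s U)%E.
Proof. by rewrite /diam_pow; case: asboolP => // _; exact: poweR_ge0. Qed.

Lemma diam_le U (r : R) : (forall x y, U x -> U y -> `|x - y| <= r) -> (diam U <= r%:E)%E.
Proof.
by move=> h; apply: ub_ereal_sup => _ [x [y [Ux Uy ->]]]; rewrite lee_fin h.
Qed.

Lemma diam_ge U x y : U x -> U y -> (`|x - y|%:E <= diam U)%E.
Proof. by move=> Ux Uy; apply: ereal_sup_ubound; exists x, y. Qed.

Lemma diam_pow_le s U (r : R) : 0 <= s -> 0 <= r ->
  (forall x y, U x -> U y -> `|x - y| <= r) -> (diam_pow s U <= (r `^ s)%:E)%E.
Proof.
move=> s0 r0 h; rewrite /diam_pow; case: asboolP => [_|U0]; first by rewrite lee_fin powR_ge0.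
have [x Ux] : U !=set0 by apply/set0P/eqP.
have d0 : (0 <= diam U)%E.
  by have := diam_ge Ux Ux; rewrite subrr normr0.
rewrite -poweR_EFin; apply: gt0_ler_poweR => //; last exact: diam_le.
- by rewrite in_itv /= d0 leey.
- by rewrite in_itv /= lee_fin r0 leey.
Qed.

Lemma diam_powE s U d : U !=set0 -> (diam U <= d%:E)%E ->
  exists D : R, [/\ 0 <= D, diam_pow s U = (D `^ s)%:E &
    forall x y, U x -> U y -> `|x - y| <= D].
Proof.
move=> [x Ux] hd.
have d0 : (0 <= diam U)%E by have := diam_ge Ux Ux; rewrite subrr normr0.
have df : diam U \is a fin_num by rewrite ge0_fin_numE// (le_lt_trans hd) ?ltry.
exists (fine (diam U)); split.
- exact: fine_ge0.
- rewrite /diam_pow; case: asboolP => [U0|_]; first by move: Ux; rewrite U0.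
  by rewrite -poweR_EFin fineK.
- by move=> y z Uy Uz; rewrite -lee_fin fineK// diam_ge.
Qed.

Lemma nneseries_le_bound (f : nat -> \bar R) (B : \bar R) : (forall i, (0 <= f i)%E) ->
  (forall N, (\sum_(0 <= i < N) f i <= B)%E) -> (\sum_(0 <= i <oo) f i <= B)%E.
Proof.
move=> f0 h; apply: lime_le; first by apply: is_cvg_nneseries => n _ _; exact: f0.
by near=> N; exact: h.
Unshelve. all: by end_near. Qed.

Lemma hausdorff_measure_eq0 s A :
  (forall d e, 0 < d -> 0 < e -> exists U : (set R)^nat,
    [/\ A `<=` \bigcup_i U i, forall i, (diam (U i) <= d%:E)%E &
        (\sum_(0 <= i <oo) diam_pow s (U i) <= e%:E)%E]) ->
  hausdorff_measure s A = 0%E.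
Proof.
move=> h; apply/eqP; rewrite eq_le; apply/andP; split.
  apply: ub_ereal_sup => _ [d /= d0 <-]; apply/lee_addgt0Pr => e e0; rewrite add0e.
  have [U [AU dU SU]] := h d e d0 e0.
  by apply: ge_ereal_inf; exists (\sum_(0 <= i <oo) diam_pow s (U i))%E => //; exists U.
apply: (@le_trans _ _ (hausdorff_premeasure s 1 A)).
  apply: le_ereal_inf_tmp => _ [U _ <-].
  by apply: nneseries_ge0 => i _ _; exact: diam_pow_ge0.
by apply: ereal_sup_ubound; exists 1 => //=.
Qed.

Lemma hausdorff_measure_cover s A (e : R) : hausdorff_measure s A = 0%E -> 0 < e ->
  exists U : (set R)^nat, [/\ A `<=` \bigcup_i U i, forall i, (diam (U i) <= 1%:E)%E &
    (\sum_(0 <= i <oo) diam_pow s (U i) <= e%:E)%E].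
Proof.
move=> h e0.
have : (hausdorff_premeasure s 1 A < e%:E)%E.
  apply: (@le_lt_trans _ _ (hausdorff_measure s A)); last by rewrite h lte_fin.
  by apply: ereal_sup_ubound; exists 1 => //=.
move=> /ereal_inf_lt [_ [U [AU dU] <-] hU].
by exists U; split => //; exact: ltW.
Qed.

Lemma hausdorff_dim_le A (b : R) : 0 <= b ->
  (forall s, b < s -> hausdorff_measure s A = 0%E) -> (hausdorff_dim A <= b%:E)%E.
Proof.
move=> b0 h; apply/lee_addgt0Pr => e e0.
apply: ereal_inf_lbound; exists (b + e); last by rewrite EFinD.
by split; [rewrite addr_ge0// ltW | apply: h; rewrite ltrDl].
Qed.

Lemma hausdorff_dim_ge A (b : R) :
  (forall s, 0 <= s -> s < b -> hausdorff_measure s A <> 0%E) -> (b%:E <= hausdorff_dim A)%E.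
Proof.
move=> h; apply: le_ereal_inf_tmp => _ [s [s0 hs] <-]; rewrite lee_fin leNgt.
by apply/negP => sb; exact: (h s s0 sb hs).
Qed.

(** The fraction p/q with -q <= p < 2 q is listed at index 3 q^2 + p + q; the ranges for different q
    are disjoint as 3 q^2 + 3 q < 3 (q + 1)^2. The index is of order q^2, so a cover by fractions
    becomes a single series in i instead of a double sum. *)
Lemma code_inj (p p' : int) (q q' : nat) :
  0 <= p + q%:Z < 3 * q%:Z -> 0 <= p' + q'%:Z < 3 * q'%:Z ->
  (3 * q ^ 2 + absz (p + q%:Z)%R = 3 * q' ^ 2 + absz (p' + q'%:Z)%R)%N -> p = p' /\ q = q'.
Proof.
move=> h1 h2 h3; have key : q = q'.
  case: (ltngtP q q') => [h|h|//]; exfalso.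
    have : (q.+1 * q.+1 <= q' * q')%N by rewrite leq_mul.
    by nia.
  have : (q'.+1 * q'.+1 <= q * q)%N by rewrite leq_mul.
  by nia.
by split => //; subst q'; lia.
Qed.

Lemma code_lt (p : int) (q i : nat) : (0 < q)%N -> 0 <= p + q%:Z < 3 * q%:Z ->
  (3 * q ^ 2 + absz (p + q%:Z)%R)%N = i -> (i < q ^ 2 * 12)%N.
Proof.
move=> q0 h <-; have : (q <= q ^ 2)%N by rewrite -[leqLHS]expn1 leq_pexp2l.
move: (q ^ 2)%N => Q; lia.
Qed.

(** Failure of [badly_approx] gives, for each c, some p/q within c q^(-tau), with no control on q.
    So the cover uses all fractions, and its diameters and total are made small through c rather
    than by taking a tail. The series is that of (i + 1)^(-tau s / 2), convergent since tau s >
    2. *)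
Lemma hausdorff_measure_well_approx (tau s : R) A : 0 < tau -> 0 < s -> 2 < tau * s ->
  (forall x, A x -> x \in `[0, 1]) -> (forall x, A x -> ~ badly_approx x tau) ->
  hausdorff_measure s A = 0%E.
Proof.
move=> tau0 s0 ts A01 Abad; apply: hausdorff_measure_eq0 => d e d0 e0.
pose sg := tau * s / 2 - 1; have sg0 : 0 < sg by rewrite /sg; lra.
pose W : R := 12 `^ (tau / 2).
have W0 : 0 < W by exact: powR_gt0.
have Z0 : 0 < zeta_bound sg by rewrite /zeta_bound; have : 0 < sg^-1 by [rewrite invr_gt0]; lra.
have eZ : 0 < e / zeta_bound sg by rewrite divr_gt0.
have [t t0 ht] := powR_small eZ s0.
(* The bound d limits the diameters, t the total, and 2 W forces c <= 1, which keeps p/q within 1 of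
   [0, 1] and so within the listed fractions. *)
pose u := Num.min d (Num.min t (2 * W)).
have W2 : 0 < 2 * W by rewrite mulr_gt0.
have u0 : 0 < u by rewrite lt_min d0 lt_min t0.
have ud : u <= d by rewrite ge_min lexx.
have ut : u <= t by rewrite ge_min; apply/orP; right; rewrite ge_min lexx.
have uW : u <= 2 * W by rewrite ge_min; apply/orP; right; rewrite ge_min lexx orbT.
pose c := u / (2 * W).
have c0 : 0 < c by rewrite divr_gt0.
have c1 : c <= 1 by rewrite ler_pdivrMr// mul1r.
have cu : 2 * c * W = u by rewrite /c; field; rewrite gt_eqF.
clearbody c.
pose U (i : nat) : set R := [set x | exists (p : int) (q : nat), [/\ (0 < q)%N,
   0 <= p + q%:Z < 3 * q%:Z, (3 * q ^ 2 + absz (p + q%:Z)%R)%N = i &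
   `|x - p%:~R / q%:R| < c * q%:R `^ (- tau)]].
pose r (i : nat) : R := u * i.+1%:R `^ (- (tau / 2)).
have r0 i : 0 <= r i by rewrite mulr_ge0 ?powR_ge0 ?(ltW u0).
have rU i x y : U i x -> U i y -> `|x - y| <= r i.
  move=> [p [q [q0 pq pqi hx]]] [p' [q' [q'0 pq' pqi' hy]]].
  have [pp qq] := code_inj pq pq' (etrans pqi (esym pqi')); subst p' q'.
  have qR : 0 < q%:R :> R by rewrite ltr0n.
  apply: le_trans (_ : 2 * c * q%:R `^ (- tau) <= _).
    have -> : x - y = (x - p%:~R / q%:R) - (y - p%:~R / q%:R) by ring.
    by apply: le_trans (ler_normB _ _) _; lra.
  have -> : r i = 2 * c * (i.+1%:R `^ (- (tau / 2)) * W) by rewrite /r -cu; ring.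
  rewrite ler_wpM2l ?mulr_ge0 ?(ltW c0)//.
  have -> : q%:R `^ (- tau) = (q%:R ^+ 2) `^ (- (tau / 2)) :> R.
    rewrite -powR_mulrn// -powRrM; congr (_ `^ _); by field.
  have -> : i.+1%:R `^ (- (tau / 2)) * W = (i.+1%:R / 12) `^ (- (tau / 2)).
    rewrite powRM ?invr_ge0// /W -[12^-1]powR_inv1// -powRrM.
    by congr (_ * _ `^ _); ring.
  rewrite !powRN lef_pV2 ?posrE ?powR_gt0 ?divr_gt0 ?exprn_gt0//.
  rewrite ge0_ler_powR ?nnegrE ?divr_ge0 ?exprn_ge0 ?(ltW tau0)//.
  by rewrite ler_pdivrMr// -natrX -natrM ler_nat (code_lt q0 pq pqi).
exists U; split.
- move=> x Ax; have x01 := A01 x Ax; rewrite in_itv /= in x01; case/andP: x01 => x0 x1.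
  have [p [q [q0 hpq]]] : exists p q, (0 < q)%N /\ `|x - p%:~R / q%:R| < c * q%:R `^ (- tau).
    apply: contrapT => hn; apply: (Abad x Ax); exists c => // p q q0.
    by rewrite leNgt; apply/negP => h; apply: hn; exists p, q.
  exists (3 * q ^ 2 + absz (p + q%:Z)%R)%N => //=; exists p, q; split => //.
  have qR : 1 <= q%:R :> R by rewrite ler1n.
  have h1 : `|x - p%:~R / q%:R| < 1.
    apply: lt_le_trans hpq _; apply: mulr_ile1; rewrite ?(ltW c0) ?powR_ge0//.
    by rewrite -[X in _ <= X](powRr0 q%:R) ler_powR// oppr_le0 ltW.
  rewrite ltr_norml in h1; case/andP: h1 => h1 h2.
  have qp : 0 < q%:R :> R by lra.
  have b1 : p%:~R < 2 * q%:R :> R by rewrite -ltr_pdivrMr//; lra.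
  have b2 : - q%:R < p%:~R :> R by rewrite -mulN1r -ltr_pdivlMr//; lra.
  have : p < 2 * q%:Z by rewrite -(ltr_int R) intrM.
  have : - q%:Z < p by rewrite -(ltr_int R) intrN.
  by clear; lia.
- move=> i; apply: le_trans (diam_le (rU i)) _; rewrite lee_fin.
  apply: le_trans ud; rewrite /r ler_piMr ?(ltW u0)//.
  by rewrite -[X in _ <= X](powRr0 i.+1%:R) ler_powR ?ler1n// oppr_le0 divr_ge0// ltW.
- apply: nneseries_le_bound => [i|N]; first exact: diam_pow_ge0.
  apply: (@le_trans _ _ (\sum_(0 <= i < N) ((r i) `^ s)%:E)%E).
    by apply: lee_sum => i _; apply: diam_pow_le; [exact: ltW|exact: r0|exact: rU].
  rewrite sumEFin lee_fin big_mkord.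
  have -> : \sum_(i < N) r i `^ s = u `^ s * \sum_(i < N) i.+1%:R `^ (- (1 + sg)).
    rewrite mulr_sumr; apply: eq_bigr => i _.
    rewrite /r powRM ?powR_ge0 ?(ltW u0)// -powRrM; congr (_ * _ `^ _).
    by rewrite /sg; field.
  apply: le_trans (_ : e / zeta_bound sg * zeta_bound sg <= _); last by rewrite divfK// gt_eqF.
  apply: ler_pM; rewrite ?powR_ge0 ?sum_powRN_le//.
    by apply: sumr_ge0 => i _; exact: powR_ge0.
  by apply: ht; rewrite ut ltW.
Qed.

(** * Pulling Hausdorff null sets back to Lebesgue null sets *)

Local Notation mu := (@lebesgue_measure R).

Lemma negligible_small (A : set R) :
  (forall e : R, 0 < e -> exists B : set R, [/\ measurable B, A `<=` B & (mu B <= e%:E)%E]) ->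
  mu.-negligible A.
Proof.
move=> h.
have hk (k : nat) : exists B : set R, [/\ measurable B, A `<=` B & (mu B <= (k.+1%:R^-1)%:E)%E].
  by apply: h; rewrite invr_gt0.
pose B k := projT1 (cid (hk k)).
have BP k : [/\ measurable (B k), A `<=` B k & (mu (B k) <= (k.+1%:R^-1)%:E)%E].
  by rewrite /B; case: cid.
exists (\bigcap_k B k); split.
- by apply: bigcap_measurable => // k _; case: (BP k).
- apply/eqP; rewrite eq_le measure_ge0 andbT; apply/lee_addgt0Pr => e e0; rewrite add0e.
  pose k := Num.truncn e^-1.
  have [mB _ lB] := BP k.
  apply: (@le_trans _ _ (mu (B k))).
    apply: le_measure; rewrite ?inE//.
      by apply: bigcap_measurable => // j _; case: (BP j).
    exact: bigcap_inf.
  apply: le_trans lB _; rewrite lee_fin.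
  have /andP[_ h2] := @truncn_itv R e^-1 ltac:(by rewrite invr_ge0 ltW).
  by rewrite -[e]invrK lef_pV2 ?posrE ?invr_gt0// ltW.
- by move=> x Ax k _; case: (BP k) => _ + _; apply.
Qed.

(** The preimage of a set of diameter D has diameter at most K D^s, so it lies in an interval of
    length 2 (K + 1) D^s. Enclosing intervals are used since phi is not assumed measurable; K + 1 is
    positive even when K = 0. *)
Lemma negligible_preimage (phi : R -> R) (T A : set R) (K s : R) : 0 <= K ->
  (forall t t', T t -> T t' -> `|t - t'| <= K * `|phi t - phi t'| `^ s) ->
  0 <= s -> hausdorff_measure s A = 0%E -> mu.-negligible (T `&` phi @^-1` A).
Proof.
move=> K0 hphi s0 hA; apply: negligible_small => e e0.
have K1 : 0 < 2 * (K + 1) by rewrite mulr_gt0// ltr_wpDl.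
have [U [AU dU SU]] := hausdorff_measure_cover hA (divr_gt0 e0 K1).
pose V i := T `&` phi @^-1` (U i).
have hI i : exists I : set R, [/\ measurable I, V i `<=` I &
    (mu I <= (2 * (K + 1))%:E * diam_pow s (U i))%E].
  have [Vi0|Vin] := eqVneq (V i) set0.
    exists set0; split; rewrite ?Vi0// measure0 mule_ge0 ?diam_pow_ge0//.
    by rewrite lee_fin ltW.
  have [t0 [Tt0 Ut0]] : V i !=set0 by apply/set0P.
  have [|D [D0 DE hD]] := @diam_powE s (U i) 1 _ (dU i); first by exists (phi t0).
  pose rr := (K + 1) * D `^ s.
  have rr0 : 0 <= rr by rewrite mulr_ge0 ?powR_ge0//; lra.
  exists `[t0 - rr, t0 + rr]%classic; split => //.
    move=> t [Tt Ut]; rewrite /= in_itv /=.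
    have : `|t - t0| <= rr.
      apply: le_trans (hphi _ _ Tt Tt0) _; apply: ler_pM; rewrite ?powR_ge0//; first by lra.
      by rewrite ge0_ler_powR ?nnegrE// hD.
    by rewrite ler_norml => /andP[h1 h2]; apply/andP; split; lra.
  rewrite lebesgue_measure_itv /= DE -EFinM; case: ifP => _.
    rewrite -EFinD lee_fin /rr; apply: eq_imply_le; ring.
  by rewrite lee_fin mulr_ge0 ?powR_ge0 ?(ltW K1).
pose I i := projT1 (cid (hI i)).
have IP i : [/\ measurable (I i), V i `<=` I i &
    (mu (I i) <= (2 * (K + 1))%:E * diam_pow s (U i))%E].
  by rewrite /I; case: cid.
have mI : measurable (\bigcup_i I i) by apply: bigcup_measurable => i _; case: (IP i).
exists (\bigcup_i I i); split => //.
  move=> t [Tt At]; have [i _ Ui] := AU _ At; exists i => //.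
  by case: (IP i) => _ + _; apply.
apply: (@le_trans _ _ (\sum_(0 <= i <oo) mu (I i))%E).
  by apply: measure_sigma_subadditive => // i; case: (IP i).
apply: (@le_trans _ _ (\sum_(0 <= i <oo) ((2 * (K + 1))%:E * diam_pow s (U i)))%E).
  by apply: lee_nneseries => // i _; case: (IP i).
rewrite nneseriesZl; last by move=> i _; exact: diam_pow_ge0.
apply: (@le_trans _ _ ((2 * (K + 1))%:E * (e / (2 * (K + 1)))%:E)%E).
  by rewrite lee_pmul2l// lte_fin.
by rewrite -EFinM lee_fin mulrC divfK// gt_eqF.
Qed.

Lemma not_negligible_itv01 : ~ mu.-negligible (`[0, 1]%classic : set R).
Proof.
move=> [B [mB B0]]; set J := (X in X `<=` B) => sB.
have : (mu J <= mu B)%E by apply: le_measure => //; rewrite ?inE//; exact: measurable_itv.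
by rewrite B0 lebesgue_measure_itv /= lte_fin ltr01 -EFinD lee_fin subr0 ler10.
Qed.

End Hausdorff.

(** * Well-spaced fractions and the map into well-approximable points *)

(** If r is coprime to m, each block of r consecutive k contains at most one solution. Otherwise a
    common factor of r and m would divide a, and there is no solution. *)
Lemma count_dvd_progression (m r K a : nat) : (0 < r)%N -> coprime m a ->
  (\sum_(k < K) (r %| a + m * k) <= K %/ r + 1)%N.
Proof.
move=> r0 cma.
have [crm|ncrm] := boolP (coprime r m); last first.
  rewrite big1 // => k _; apply/eqP; rewrite eqb0; apply: contra ncrm => rd.
  rewrite /coprime -dvdn1 -(eqP cma) dvdn_gcd dvdn_gcdr /=.
  have h1 : (gcdn r m %| a + m * k)%N by apply: dvdn_trans rd; exact: dvdn_gcdl.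
  by rewrite -(dvdn_addl _ (n := m * k)) // dvdn_mulr // dvdn_gcdr.
pose A := finset (fun k : 'I_K => r %| a + m * k)%N.
have -> : (\sum_(k < K) (r %| a + m * k) = #|A|)%N.
  by rewrite -sum1_card [RHS]big_mkcond /=; apply: eq_bigr => k _; rewrite inE; case: ifP.
have hb (k : 'I_K) : (k %/ r < (K %/ r).+1)%N by rewrite ltnS leq_div2r // ltnW.
pose f (k : 'I_K) : 'I_(K %/ r).+1 := Ordinal (hb k).
have injf : {in A &, injective f}.
  have wl (k k' : 'I_K) : k \in A -> k' \in A -> f k = f k' -> (k <= k')%N -> k = k'.
    rewrite !inE => kA k'A /(congr1 val) /= e le.
    apply: val_inj => /=; apply/eqP; rewrite eqn_leq le /=.
    have : (r %| m * (k' - k))%N.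
      have -> : (m * (k' - k) = (a + m * k') - (a + m * k))%N by rewrite subnDl mulnBr.
      exact: dvdn_sub.
    rewrite Gauss_dvdr // => rd.
    rewrite leqNgt -subn_gt0; apply/negP => kk.
    have := dvdn_leq kk rd; rewrite leqNgt.
    have -> // : (k' - k < r)%N.
    rewrite (divn_eq k r) (divn_eq k' r) e subnDl.
    by apply: leq_ltn_trans (leq_subr _ _) _; rewrite ltn_mod.
  move=> k k' kA k'A e; case: (leqP k k') => h; first exact: wl.
  by apply/esym/wl => //; exact: ltnW.
rewrite -(card_in_imset injf) addn1 -[X in (_ <= X)%N]card_ord.
exact: max_card.
Qed.

(** A union bound over r = 2 j + 3, standing for a prime divisor common to numerator and
    denominator. The denominators are congruent to 1 modulo the even number m, so r is odd, and they
    are at most 2 m K, so j < m K. *)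
Lemma noncoprime_count (m K L : nat) (p0 : nat -> nat) : (0 < m)%N -> ~~ odd m ->
  (\sum_(k < K) \sum_(i < L) ~~ coprime (p0 k + i) (1 + m * K + m * k) <=
   \sum_(j < m * K) (K %/ (2 * j + 3) + 1) * (L %/ (2 * j + 3) + 1))%N.
Proof.
move=> m0 om.
pose n k := (1 + m * K + m * k)%N.
apply: (@leq_trans (\sum_(k < K) \sum_(i < L) \sum_(j < m * K)
   ((2 * j + 3 %| n k) * (2 * j + 3 %| p0 k + i)))%N).
  apply: leq_sum => k _; apply: leq_sum => i _.
  case: (boolP (coprime _ _)) => //= nc.
  have n1 : (0 < n k)%N by [].
  have g1 : (1 < gcdn (p0 k + i) (n k))%N.
    by rewrite ltn_neqAle eq_sym nc gcdn_gt0 n1 orbT.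
  have pr := pdiv_prime g1.
  set r := pdiv _ in pr.
  have rd : (r %| gcdn (p0 k + i) (n k))%N by exact: pdiv_dvd.
  move: rd; rewrite dvdn_gcd => /andP[rp rn].
  have odn : odd (n k) by rewrite /n !oddD !oddM (negbTE om).
  have odr : odd r by apply: dvdn_odd rn odn.
  have r3 : (2 < r)%N.
    have := prime_gt1 pr; rewrite leq_eqVlt => /orP[/eqP e|//].
    by move: odr; rewrite -e.
  have rle : (r <= n k)%N by exact: dvdn_leq.
  have er : (r = 2 * ((r - 3)./2) + 3)%N.
    have := odd_double_half (r - 3); rewrite oddB // odr /= add0n -muln2 mulnC => ->.
    by rewrite subnK.
  have jlt : ((r - 3)./2 < m * K)%N.
    have nk2 : (n k <= 2 * (m * K))%N.
      have : (m * k + m <= m * K)%N by rewrite -mulnSr leq_mul2l ltn_ord orbT.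
      rewrite /n; move: m0; clear; lia.
    move: er rle nk2; clear; lia.
  by rewrite (bigD1 (Ordinal jlt)) //= -er rp rn.
rewrite (eq_bigr (fun k : 'I_K => (\sum_(j < m * K) \sum_(i < L)
   ((2 * j + 3 %| n k) * (2 * j + 3 %| p0 k + i)))%N)); last first.
  by move=> k _; rewrite exchange_big.
rewrite exchange_big /=; apply: leq_sum => j _.
rewrite (@leq_trans (\sum_(k < K) (2 * j + 3 %| n k) * (L %/ (2 * j + 3) + 1))%N) //.
  apply: leq_sum => k _; rewrite -big_distrr /= leq_mul //.
  rewrite (eq_bigr (fun i : 'I_L => (2 * j + 3 %| p0 k + 1 * i : nat)%N)).
    by apply: count_dvd_progression; rewrite ?coprime1n // addn3.
  by move=> i _; rewrite mul1n.
rewrite -big_distrl leq_mul //= /n; apply: count_dvd_progression; first by rewrite addn3.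
by rewrite /coprime addnC mulnC gcdnMDl gcdn1.
Qed.

Section Spread.
Variable R : realType.

(** Since (2 j + 3)^2 >= 4 (j + 1) (j + 2), the squares telescope to at most 1/4: this is where odd
    divisors pay off. The remaining terms are at most 9 m^2 K^(3/2) + m K, hence 10 m^2 K^(3/2),
    while K L >= l m K^2 / 2; the threshold with 80 makes them at most K L / 4. *)
Lemma noncoprime_count_half (m K L : nat) (p0 : nat -> nat) (l : R) : (0 < m)%N -> ~~ odd m ->
  0 < l -> l * (m * K)%:R - 1 <= L%:R -> (L <= 2 * (m * K))%N ->
  (80 * m%:R / l) ^+ 2 <= K%:R ->
  (2 * \sum_(k < K) \sum_(i < L) ~~ coprime (p0 k + i) (1 + m * K + m * k) <= K * L)%N
  /\ l * m%:R * K%:R ^+ 2 <= 2 * (K * L)%:R.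
Proof.
move=> m0 om l0 Llo Lhi Kbig.
have m1 : 1 <= m%:R :> R by rewrite ler1n.
set w := Num.sqrt (K%:R : R).
have w2 : w ^+ 2 = K%:R by rewrite sqr_sqrtr.
have wl : 80 * m%:R <= l * w.
  rewrite -ler_pdivrMl // mulrC.
  rewrite -(@ger0_norm _ (80 * m%:R / l)) ?divr_ge0 ?mulr_ge0 ?(ltW l0) //.
  by rewrite -sqrtr_sqr ler_wsqrtr.
have w0 : 0 <= w by exact: sqrtr_ge0.
have K2 : l * m%:R * w ^+ 2 >= 2.
  have wp : 0 < w by rewrite lt_neqAle w0 andbT eq_sym; apply/eqP => e; move: wl; rewrite e; lra.
  have w1 : 1 <= w.
    rewrite leNgt; apply/negP => w1.
    have K1 : (0 < K)%N by rewrite -(ltr_nat R) -w2 exprn_gt0.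
    have : 1 <= w ^+ 2 by rewrite w2 ler1n.
    by rewrite leNgt exprn_ilt1.
  rewrite expr2.
  have h1 : 80 <= l * w by lra.
  have -> : l * m%:R * (w * w) = (l * w) * (m%:R * w) by ring.
  have h2 : 1 <= m%:R * w by rewrite -[leLHS]mulr1 ler_pM.
  have : 80 * 1 <= (l * w) * (m%:R * w) by rewrite ler_pM.
  lra.
have Llo' : l * m%:R * w ^+ 2 / 2 <= L%:R.
  move: Llo; rewrite natrM mulrA -w2; lra.
split; last first.
  rewrite natrM -w2.
  have : w ^+ 2 * (l * m%:R * w ^+ 2 / 2) <= w ^+ 2 * L%:R by rewrite ler_wpM2l ?sqr_ge0.
  by rewrite [in X in X -> _]expr2; lra.
rewrite -(ler_nat R) natrM.
apply: le_trans (_ : 2 * (\sum_(j < m * K) (K %/ (2 * j + 3) + 1) * (L %/ (2 * j + 3) + 1))%:R <= _).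
  by rewrite ler_wpM2l // ler_nat noncoprime_count.
rewrite natr_sum.
have term (j : nat) : ((K %/ (2 * j + 3) + 1) * (L %/ (2 * j + 3) + 1))%:R <=
   (K%:R * L%:R / 4) * (j.+1%:R^-1 - j.+2%:R^-1) + (K%:R + L%:R) * j.+1%:R^-1 + 1 :> R.
  have r0 : 0 < (2 * j + 3)%:R :> R by rewrite ltr0n addn3.
  have hd (n : nat) : (n %/ (2 * j + 3) + 1)%:R <= n%:R / (2 * j + 3)%:R + 1 :> R.
    by rewrite natrD lerD2r ler_pdivlMr // -natrM ler_nat leq_divM.
  rewrite natrM (le_trans (ler_pM _ _ (hd K) (hd L))) //.
  have e1 : (2 * j + 3)%:R^-1 <= j.+1%:R^-1 :> R.
    by rewrite lef_pV2 ?posrE // ler_nat; clear; lia.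
  have e2 : (2 * j + 3)%:R^-1 ^+ 2 <= 4^-1 * (j.+1%:R^-1 - j.+2%:R^-1) :> R.
    have -> : 4^-1 * (j.+1%:R^-1 - j.+2%:R^-1) = (4 * (j.+1%:R * j.+2%:R))^-1 :> R.
      rewrite -(natr1 j.+1); have : 0 < j.+1%:R :> R by [].
      move: (j.+1%:R : R) => a a0; field; apply/andP; split; lra.
    rewrite exprVn lef_pV2 ?posrE ?exprn_gt0 ?mulr_gt0 //.
    rewrite -natrM -(natrM _ 4) -natrX ler_nat; clear; nia.
  have KL0 : 0 <= K%:R * L%:R :> R by rewrite mulr_ge0.
  have := ler_wpM2l KL0 e2.
  have KL1 : 0 <= K%:R + L%:R :> R by rewrite addr_ge0.
  have := ler_wpM2l KL1 e1.
  move: (2 * j + 3)%:R^-1 (j.+1%:R^-1) (j.+2%:R^-1) => z a b h1 h2.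
  have -> : (K%:R * z + 1) * (L%:R * z + 1) = K%:R * L%:R * z ^+ 2 + (K%:R + L%:R) * z + 1 by ring.
  lra.
apply: le_trans (ler_wpM2l (ler0n R 2) (ler_sum _ (fun (j : 'I_(m * K)) _ => term j))) _.
rewrite !big_split /= -!mulr_sumr sumr_const card_ord.
have tel M : \sum_(j < M) (j.+1%:R^-1 - j.+2%:R^-1) <= 1 :> R.
  suff -> : \sum_(j < M) (j.+1%:R^-1 - j.+2%:R^-1) = 1 - M.+1%:R^-1 :> R.
    by rewrite gerBl invr_ge0.
  elim: M => [|M IH]; first by rewrite big_ord0 invr1 subrr.
  by rewrite big_ord_recr /= IH addrA subrK.
have K0 : (0 < K)%N by rewrite lt0n; apply/eqP => e; move: K2; rewrite w2 e mulr0n mulr0; lra.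
have har := @sum_harmonic_le R 2^-1 (m * K) ltac:(by lra) ltac:(by rewrite muln_gt0 m0).
have sqle : (m * K)%:R `^ 2^-1 <= m%:R * w :> R.
  rewrite powR12_sqrt // natrM sqrtrM // ler_wpM2r //.
  by rewrite -[leRHS](ger0_norm (ler0n R m)) -sqrtr_sqr ler_wsqrtr // expr2 ler_peMl.
have har' : \sum_(j < m * K) j.+1%:R^-1 <= 3 * (m%:R * w) :> R.
  apply: le_trans har _; rewrite /zeta_bound invrK.
  have -> : 1 + 2 = 3 :> R by ring.
  by rewrite ler_wpM2l.
have KL0 : 0 <= K%:R * L%:R / 4 :> R by rewrite divr_ge0 ?mulr_ge0.
have t1 := ler_wpM2l KL0 (tel (m * K)%N).
have KL1 : 0 <= K%:R + L%:R :> R by rewrite addr_ge0.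
have t2 := ler_wpM2l KL1 har'.
have w1 : 1 <= w by rewrite -sqrtr1 ler_wsqrtr // ler1n.
have KL3 : K%:R + L%:R <= 3 * (m%:R * w ^+ 2) :> R.
  have : L%:R <= 2 * (m%:R * w ^+ 2) :> R by rewrite w2 -!natrM ler_nat.
  have : w ^+ 2 <= m%:R * w ^+ 2 by rewrite ler_peMl ?sqr_ge0.
  rewrite -w2; lra.
have t3 : (K%:R + L%:R) * (3 * (m%:R * w)) <= 3 * (m%:R * w ^+ 2) * (3 * (m%:R * w)).
  by rewrite ler_wpM2r // ?mulr_ge0.
have t4 : w ^+ 2 * (l * m%:R * w ^+ 2 / 2) <= K%:R * L%:R by rewrite -w2 ler_wpM2l ?sqr_ge0.
have mw0 : 0 <= m%:R * w ^+ 3 by rewrite mulr_ge0 // exprn_ge0.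
have t5 := ler_wpM2l mw0 wl.
have t6 : m%:R * w ^+ 2 <= m%:R ^+ 2 * w ^+ 3.
  rewrite !exprS !expr0 !mulr1.
  have -> : m%:R * m%:R * (w * (w * w)) = (m%:R * (w * w)) * (m%:R * w) by ring.
  rewrite ler_peMr ?mulr_ge0 // -[leLHS]mulr1 ler_pM //.
have e0 : (m * K)%:R = m%:R * w ^+ 2 by rewrite natrM w2.
rewrite e0.
have -> : (K * L)%:R = K%:R * L%:R :> R by rewrite natrM.
have q5 : m%:R * w ^+ 3 * (80 * m%:R) = 80 * (m%:R ^+ 2 * w ^+ 3) by ring.
have q6 : m%:R * w ^+ 3 * (l * w) = 2 * (w ^+ 2 * (l * m%:R * w ^+ 2 / 2)) by field.
have q3 : 3 * (m%:R * w ^+ 2) * (3 * (m%:R * w)) = 9 * (m%:R ^+ 2 * w ^+ 3) by ring.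
rewrite q5 q6 in t5; rewrite q3 in t3.
lra.
Qed.

Lemma sorted_spaced (s : seq R) (delta : R) : sorted <=%R s -> uniq s ->
  {in s &, forall x y, x != y -> delta <= `|x - y|} ->
  forall i j, (i <= j < size s)%N -> (j - i)%:R * delta <= s`_j - s`_i.
Proof.
move=> ss us hs i; elim=> [|j IH] /andP[ij js].
  by move: ij; rewrite leqn0 => /eqP->; rewrite subnn mul0r subrr.
move: ij; rewrite leq_eqVlt => /orP[/eqP->|]; first by rewrite subnn mul0r subrr.
rewrite ltnS => ij; have js' := ltnW js.
have := IH; rewrite ij js' => /(_ isT) h.
have hle : s`_j <= s`_j.+1 by rewrite (sorted_leq_nth le_trans le_refl) ?inE.
have := hs s`_j.+1 s`_j (mem_nth _ js) (mem_nth _ js').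
rewrite nth_uniq // gtn_eqF // => /(_ isT); rewrite ger0_norm ?subr_ge0 // => h'.
by rewrite subSn // -natr1 mulrDl mul1r; lra.
Qed.

Lemma reduced_fractions_spaced (p n p' n' Q : nat) : (0 < n <= Q)%N -> (0 < n' <= Q)%N ->
  p%:R / n%:R != p'%:R / n'%:R :> R ->
  (Q%:R ^+ 2)^-1 <= `|p%:R / n%:R - p'%:R / n'%:R| :> R.
Proof.
move=> /andP[n0 nQ] /andP[n'0 n'Q] ne.
have n0' : n%:R != 0 :> R by rewrite pnatr_eq0 -lt0n.
have n0'' : n'%:R != 0 :> R by rewrite pnatr_eq0 -lt0n.
have e : p%:R / n%:R - p'%:R / n'%:R = ((p * n')%:Z - (p' * n)%:Z)%:~R / (n * n')%:R :> R.
  by rewrite intrD mulrNz -!pmulrn !natrM; field; rewrite n0' n0''.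
rewrite e; move: ne; rewrite -subr_eq0 e mulf_eq0 negb_or => /andP[ne _].
rewrite normrM normfV normr_nat -intr_norm.
have h1 : 1 <= (`|(p * n')%:Z - (p' * n)%:Z|)%:~R :> R.
  by rewrite ler1z -gtz0_ge1 normr_gt0; move: ne; rewrite intr_eq0.
apply: le_trans (_ : 1 / (n * n')%:R <= _); last first.
  by rewrite ler_wpM2r // invr_ge0.
rewrite mul1r lef_pV2 ?posrE ?exprn_gt0 ?ltr0n ?muln_gt0 ?n0 // ?(leq_trans n0 nQ) //.
by rewrite -natrX ler_nat expnS expn1 leq_mul.
Qed.

Lemma reduced_fraction_inj (p n p' n' : nat) : (0 < n)%N -> (0 < n')%N ->
  coprime p n -> coprime p' n' -> p%:R / n%:R = p'%:R / n'%:R :> R -> p = p' /\ n = n'.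
Proof.
move=> n0 n'0 c c' /eqP; rewrite eqr_div ?pnatr_eq0 -?lt0n // -!natrM eqr_nat => /eqP e.
have en : n = n'.
  apply/eqP; rewrite eqn_dvd; apply/andP; split.
    by rewrite -(@Gauss_dvdr _ p) 1?coprime_sym // e dvdn_mull.
  by rewrite -(@Gauss_dvdr _ p') 1?coprime_sym // -e dvdn_mull.
by split=> //; move/eqP: e; rewrite en eqn_pmul2r // => /eqP.
Qed.

(** For every denominator n k, the L numerators following c (n k) give fractions in ]c, c + l]; at
    least half of all pairs are reduced, reduced fractions are distinct, and sorting them yields g.
    K and N are chosen before c, so every interval of one level has the same number of children. *)
Lemma spread_fractions (m : nat) (l : R) : (0 < m)%N -> ~~ odd m -> 0 < l <= 1 ->
  exists K0, forall K, (K0 <= K)%N -> exists2 N : nat, l * m%:R * K%:R ^+ 2 / 8 <= N%:R &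
  forall c : R, 0 <= c -> exists g : nat -> R,
  (forall d, (d < N)%N -> c < g d <= c + l /\ exists p q, [/\ (K <= q <= 2 * (m * K))%N,
      coprime m q, coprime p q & g d = p%:R / q%:R]) /\
  (forall d d', (d <= d' < N)%N ->
     (d' - d)%:R * ((2 * (m * K))%:R ^+ 2)^-1 <= g d' - g d).
Proof.
move=> m0 om /andP[l0 l1].
have [K0 hK0] : exists K0 : nat, forall K, (K0 <= K)%N -> (80 * m%:R / l) ^+ 2 + 8 / l <= K%:R.
  exists (Num.truncn ((80 * m%:R / l) ^+ 2 + 8 / l)).+1 => K; rewrite -(ler_nat R).
  by apply: le_trans; rewrite ltW // truncnS_gt.
exists K0 => K /hK0 Kb.
have l8 : 0 < 8 / l by rewrite divr_gt0.
have Kbig : (80 * m%:R / l) ^+ 2 <= K%:R by lra.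
have K8 : 8 <= l * K%:R by rewrite mulrC -ler_pdivrMr //; have := sqr_ge0 (80 * m%:R / l); lra.
have K1 : (0 < K)%N by rewrite -(ltr_nat R); have := sqr_ge0 (80 * m%:R / l); lra.
pose n k := (1 + m * K + m * k)%N.
have n0 : 0 < (1 + m * K)%:R :> R by rewrite ltr0n.
pose L := Num.truncn (l * (1 + m * K)%:R).
have /andP[L1 L2] : L%:R <= l * (1 + m * K)%:R < L.+1%:R.
  by apply: truncn_itv; rewrite mulr_ge0 // ltW.
have Llo : l * (m * K)%:R - 1 <= L%:R.
  by move: L2; rewrite natrD mulrDr mulr1 -natr1; lra.
have mK : (1 <= m * K)%N by rewrite muln_gt0 m0.
have Lhi : (L <= 2 * (m * K))%N.
  have : (L <= 1 + m * K)%N.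
    by rewrite -(ler_nat R); apply: le_trans L1 _; rewrite ler_piMl.
  by move: mK; clear; lia.
have [_ KLlo] := noncoprime_count_half (fun=> 0%N) m0 om l0 Llo Lhi Kbig.
(* The guaranteed number of reduced pairs is used instead of the exact one, which depends on c. *)
exists ((K * L)./2).
  have : (K * L)%:R - 1 <= 2 * ((K * L)./2)%:R :> R.
    have := odd_double_half (K * L); set h := _./2 => <-.
    by rewrite natrD -muln2 natrM; case: odd => /=; lra.
  have : 8 <= l * m%:R * K%:R ^+ 2.
    rewrite expr2; have -> : l * m%:R * (K%:R * K%:R) = (l * K%:R) * (m * K)%:R.
      by rewrite natrM; ring.
    by rewrite -[leLHS]mulr1 ler_pM // ler1n.
  lra.
move=> c c0.
(* The least integer greater than c (n k), which makes the fractions strictly greater than c. *)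
pose p0 k := (Num.truncn (c * (n k)%:R)).+1.
have [half _] := noncoprime_count_half p0 m0 om l0 Llo Lhi Kbig.
pose T := ('I_K * 'I_L)%type.
pose good := [seq u : T <- enum {: T} | coprime (p0 u.1 + u.2) (n u.1)].
pose v (u : T) : R := (p0 u.1 + u.2)%:R / (n u.1)%:R.
have szg : ((K * L)./2 <= size good)%N.
  have eg : size good = (\sum_(k < K) \sum_(i < L) coprime (p0 k + i) (n k))%N.
    rewrite size_filter -sum1_count big_enum_cond /= big_mkcond /= pair_bigA /=.
    by apply: eq_bigr => u _; case: coprime.
  have : (size good + \sum_(k < K) \sum_(i < L) ~~ coprime (p0 k + i) (n k) = K * L)%N.
    rewrite eg -big_split /=.
    rewrite (eq_bigr (fun=> L)) ?sum_nat_const ?card_ord // => k _.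
    rewrite -big_split /= (eq_bigr (fun=> 1%N)) ?sum_nat_const ?card_ord ?muln1 // => i _.
    by case: coprime.
  have := odd_double_half (K * L); move: half; set z := (\sum_(k < K) _)%N.
  by clear; case: odd; rewrite -?muln2 => /=; lia.
have injv : {in good &, injective v}.
  move=> u u'; rewrite !mem_filter => /andP[cu _] /andP[cu' _] e.
  have [e1 e2] := reduced_fraction_inj (isT : (0 < n u.1)%N) (isT : (0 < n u'.1)%N) cu cu' e.
  have e3 : u.1 = u'.1.
    apply: val_inj => /=; apply/eqP; rewrite -(eqn_pmul2l m0).
    by move/eqP: e2; rewrite /n eqn_add2l.
  have e4 : u.2 = u'.2 by apply: val_inj => /=; move/eqP: e1; rewrite e3 eqn_add2l => /eqP.
  by rewrite (surjective_pairing u) (surjective_pairing u') e3 e4.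
have nQ (k : 'I_K) : (0 < n k <= 2 * (m * K))%N.
  have : (m * k + m <= m * K)%N by rewrite -mulnSr leq_mul2l ltn_ord orbT.
  by rewrite /n; move: m0; clear; lia.
pose s := sort <=%R [seq v u | u <- good].
have us : uniq s by rewrite sort_uniq map_inj_in_uniq // filter_uniq // enum_uniq.
have ss : sorted <=%R s by apply: sort_sorted; exact: le_total.
have szs : ((K * L)./2 <= size s)%N by rewrite size_sort size_map.
exists (nth 0 s); split=> [d dN|d d' /andP[dd' d'N]]; last first.
  apply: sorted_spaced => //; last by rewrite dd' (leq_trans d'N).
  move=> x y; rewrite !mem_sort => /mapP[u _ ->] /mapP[u' _ ->].
  exact: reduced_fractions_spaced.
have : s`_d \in s by rewrite mem_nth // (leq_trans dN).
rewrite mem_sort => /mapP[u]; rewrite mem_filter => /andP[cu _] ->.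
have nk0 : 0 < (n u.1)%:R :> R by rewrite ltr0n.
split; last first.
  exists (p0 u.1 + u.2)%N, (n u.1); split=> //.
    have /andP[_ ->] := nQ u.1; rewrite andbT /n.
    have : (K <= m * K)%N by rewrite leq_pmull.
    by clear; lia.
  by rewrite /coprime /n -addnA -mulnDr addnC [(m * _)%N]mulnC gcdnMDl gcdn1.
have /andP[t1 t2] : (Num.truncn (c * (n u.1)%:R))%:R <= c * (n u.1)%:R < (p0 u.1)%:R.
  by apply: truncn_itv; rewrite mulr_ge0.
rewrite /v ltr_pdivlMr // ler_pdivrMr // natrD mulrDl; apply/andP; split.
  by have : 0 <= u.2%:R :> R by []; lra.
have : u.2.+1%:R <= L%:R :> R by rewrite ler_nat.
have : l * (1 + m * K)%:R <= l * (n u.1)%:R.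
  by rewrite ler_wpM2l ?(ltW l0) // ler_nat leq_addr.
have e1 : (p0 u.1)%:R = (Num.truncn (c * (n u.1)%:R))%:R + 1 :> R by rewrite natr1.
rewrite e1 -(natr1 u.2) => h1 h2; move: t1 h1 h2 L1; clear.
move: (_ * _ : R) (_ * _ : R) (_ * _ : R) => a b d; lra.
Qed.

End Spread.

(** * Cantor maps in a mixed base *)

Section CantorMap.
Variable R : realType.
Variables (l sigma : nat -> R) (N : nat -> nat) (f : nat -> R -> nat -> R).
Hypothesis l_gt0 : forall k, 0 < l k.
Hypothesis N_gt1 : forall k, (1 < N k)%N.
Hypothesis f_itv : forall k (c : R) d, 0 <= c -> (d < N k)%N ->
  c < f k c d /\ f k c d + l k.+1 <= c + l k.
Hypothesis f_gap : forall k (c : R) d d', 0 <= c -> (d <= d' < N k)%N ->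
  (d' - d)%:R * sigma k <= f k c d' - f k c d.
Hypothesis l_sigma : forall k, 2 * l k.+1 <= sigma k.

Definition digit k (u : R) : nat := Num.truncn ((N k)%:R * u).

(* The left endpoint of the k-th interval and the k-th remainder of the
   expansion of t in the mixed base N. *)
Fixpoint orbit (t : R) (k : nat) : R * R :=
  if k is k'.+1 then
    (f k' (orbit t k').1 (digit k' (orbit t k').2),
     (N k')%:R * (orbit t k').2 - (digit k' (orbit t k').2)%:R)
  else (0, t).

(** The left endpoints increase, so this is their limit, the common point of the nested
    intervals. *)
Definition cantor_map (t : R) : R := sup (range (fun k => (orbit t k).1)).

Lemma digit_bounds k (u : R) : 0 <= u < 1 ->
  (digit k u < N k)%N /\ (digit k u)%:R <= (N k)%:R * u < (digit k u)%:R + 1.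
Proof.
move=> /andP[u0 u1].
have N0 : 0 < (N k)%:R :> R by rewrite ltr0n ltnW.
have /andP[h1 h2] : (digit k u)%:R <= (N k)%:R * u < (digit k u).+1%:R.
  by apply: truncn_itv; rewrite mulr_ge0 // ltW.
split; last by rewrite h1 natr1.
by rewrite -(ltr_nat R) (le_lt_trans h1) // gtr_pMr.
Qed.

Lemma orbit_bounds (t : R) k : 0 <= t < 1 -> 0 <= (orbit t k).1 /\ 0 <= (orbit t k).2 < 1.
Proof.
move=> t01; elim: k => [//|k [c0 u01]] /=.
have [dN /andP[d1 d2]] := digit_bounds k u01.
have [h _] := f_itv c0 dN.
by split; lra.
Qed.

Lemma orbit_nested (t : R) k j : 0 <= t < 1 ->
  (orbit t k).1 <= (orbit t (k + j)).1 /\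
  (orbit t (k + j)).1 + l (k + j) <= (orbit t k).1 + l k.
Proof.
move=> t01; elim: j => [|j [IH1 IH2]]; first by rewrite addn0 !lexx.
have [c0 u01] := orbit_bounds (k + j) t01.
have [dN _] := digit_bounds (k + j) u01.
have [h1 h2] := f_itv c0 dN.
rewrite addnS /=; split; lra.
Qed.

Lemma cantor_map_bounds (t : R) k : 0 <= t < 1 ->
  (orbit t k).1 <= cantor_map t <= (orbit t k).1 + l k.
Proof.
move=> t01.
have ub j : (orbit t j).1 <= (orbit t k).1 + l k.
  have lj := l_gt0 j; have lk := l_gt0 k.
  have [jk|/ltnW jk] := leqP j k.
    have [h1 h2] := orbit_nested j (k - j) t01.
    by move: h1; rewrite subnKC //; lra.
  have [h1 h2] := orbit_nested k (j - k) t01.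
  by move: h2; rewrite subnKC //; lra.
have hub : ubound (range (fun k => (orbit t k).1)) ((orbit t k).1 + l k).
  by move=> _ [j _ <-].
apply/andP; split.
  apply: ub_le_sup; first by exists ((orbit t k).1 + l k).
  by exists k.
by apply: ge_sup => //; exists (orbit t 0).1, 0%N.
Qed.

Let base k : nat := (\prod_(j < k) N j)%N.

Lemma base_ge k : (2 ^ k <= base k)%N.
Proof.
rewrite /base; elim: k => [|k IH]; first by rewrite big_ord0.
by rewrite big_ord_recr /= expnSr leq_mul.
Qed.

Lemma orbit_agree (t t' : R) k :
  (forall j, (j < k)%N -> digit j (orbit t j).2 = digit j (orbit t' j).2) ->
  (orbit t k).1 = (orbit t' k).1 /\
  (orbit t k).2 - (orbit t' k).2 = (base k)%:R * (t - t').
Proof.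
elim: k => [|k IH] h; first by rewrite /base big_ord0 mul1r.
have [|e1 e2] := IH; first by move=> j jk; apply: h; rewrite ltnW.
have e := h k (ltnSn k).
rewrite /= e1 e /base big_ord_recr /= natrM -/(base k); split=> //.
have -> : (base k)%:R * (N k)%:R * (t - t') = (N k)%:R * ((base k)%:R * (t - t')) by ring.
by rewrite -e2; ring.
Qed.

(** At the first level k where the digits differ, by E say, |t - t'| is at most 2 E / (base k * N
    k), while the images are at least E sigma - l k.+1 >= E sigma / 2 apart. As E / N k <= 1 it is
    at most its s-th power, and E then drops out of the condition on C. *)
Lemma cantor_map_inverse_holder (s C : R) : 0 <= s <= 1 ->
  (forall k, 2 / (base k)%:R * (2 / ((N k)%:R * sigma k)) `^ s <= C) ->
  forall t t' : R, 0 <= t < 1 -> 0 <= t' < 1 ->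
  `|t - t'| <= C * `|cantor_map t - cantor_map t'| `^ s.
Proof.
move=> /andP[s0 s1] hC t t' t01 t'01.
have sg0 k : 0 < sigma k by have := l_sigma k; have := l_gt0 k.+1; lra.
have b0 k : 0 < (base k)%:R :> R.
  by rewrite ltr0n (leq_trans _ (base_ge k)) // expn_gt0.
have C0 : 0 <= C.
  by apply: le_trans (hC 0%N); rewrite mulr_ge0 ?powR_ge0 // divr_ge0 ?(ltW (b0 _)).
pose D k := digit k (orbit t k).2 != digit k (orbit t' k).2.
have [exD|nD] := pselect (exists k, D k); last first.
  have eqd j : digit j (orbit t j).2 = digit j (orbit t' j).2.
    by apply/eqP/negP => /negP h; apply: nD; exists j.
  suff -> : t = t' by rewrite subrr normr0 mulr_ge0 ?powR_ge0.
  apply/eqP; rewrite -subr_eq0 -normr_eq0 -[_ == _]negbK -normr_gt0 normr_id.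
  apply/negP => tt.
  have [k kb] : exists k : nat, `|t - t'|^-1 < k%:R.
    by exists (Num.truncn `|t - t'|^-1).+1; exact: truncnS_gt.
  have [_ e] := orbit_agree (fun j (_ : (j < k)%N) => eqd j).
  have [_ /andP[u0 u1]] := orbit_bounds k t01.
  have [_ /andP[v0 v1]] := orbit_bounds k t'01.
  have : `|(orbit t k).2 - (orbit t' k).2| < 1 by rewrite ltr_norml; lra.
  rewrite e normrM gtr0_norm // => h.
  have : k%:R * `|t - t'| <= (base k)%:R * `|t - t'|.
    by rewrite ler_wpM2r // ler_nat (leq_trans _ (base_ge k)) // ltnW // ltn_expl.
  by move: kb; rewrite -[_^-1]mul1r ltr_pdivrMr //; lra.
case: (ex_minnP exD) => k Dk mink.
have agree : forall j, (j < k)%N -> digit j (orbit t j).2 = digit j (orbit t' j).2.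
  by move=> j jk; apply/eqP/negP => /negP h; have := mink j h; rewrite leqNgt jk.
have [e1 e2] := orbit_agree agree.
have key (x y : R) : 0 <= x < 1 -> 0 <= y < 1 -> (orbit x k).1 = (orbit y k).1 ->
   (orbit x k).2 - (orbit y k).2 = (base k)%:R * (x - y) ->
   (digit k (orbit x k).2 < digit k (orbit y k).2)%N ->
   `|x - y| <= C * `|cantor_map x - cantor_map y| `^ s.
  move=> x01 y01 ec eu dd.
  have [c0 u01] := orbit_bounds k x01.
  have [_ v01] := orbit_bounds k y01.
  have [dN /andP[d1 d2]] := digit_bounds k u01.
  have [dN' /andP[d1' d2']] := digit_bounds k v01.
  set d := digit k (orbit x k).2 in dd dN d1 d2.
  set d' := digit k (orbit y k).2 in dd dN' d1' d2'.
  have gap := @f_gap k (orbit x k).1 d d' c0 ltac:(by rewrite (ltnW dd)).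
  have /andP[_ b1] := cantor_map_bounds k.+1 x01.
  have /andP[b2 _] := cantor_map_bounds k.+1 y01.
  rewrite /= -/d in b1; rewrite /= -/d' -ec in b2.
  have ls := l_sigma k.
  set E := (d' - d)%:R in gap.
  have EE : E = d'%:R - d%:R :> R by rewrite /E natrB // ltnW.
  have E1 : 1 <= E by rewrite /E ler1n subn_gt0.
  have Es : sigma k <= E * sigma k by rewrite ler_peMl // ltW.
  have sep : E * sigma k / 2 <= cantor_map y - cantor_map x by lra.
  have sgk := sg0 k.
  have E0 : 0 < E by rewrite (lt_le_trans ltr01).
  have yx0 : 0 <= cantor_map y - cantor_map x.
    by apply: le_trans sep; rewrite !mulr_ge0 ?(ltW E0) ?(ltW sgk).
  have N0 : 0 < (N k)%:R :> R by rewrite ltr0n ltnW.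
  have dist : `|x - y| <= 2 / (base k)%:R * (E / (N k)%:R).
    have h : (base k)%:R * (N k)%:R * `|x - y| <= 2 * E.
      rewrite -(gtr0_norm (b0 k)) mulrAC -normrM -eu -[X in _ * X](gtr0_norm N0) -normrM.
      by rewrite mulrBl ![_ * (N k)%:R]mulrC ler_norml; lra.
    have -> : 2 / (base k)%:R * (E / (N k)%:R) = 2 * E / ((base k)%:R * (N k)%:R).
      by field; rewrite !gt_eqF.
    by rewrite ler_pdivlMr ?mulr_gt0 // mulrC.
  have EN : E / (N k)%:R <= 1.
    by rewrite ler_pdivrMr // mul1r ler_nat (leq_trans (leq_subr _ _)) // ltnW.
  have EN0 : 0 < E / (N k)%:R by rewrite divr_gt0.
  have p1 : E / (N k)%:R <= (E / (N k)%:R) `^ s.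
    rewrite -{1}(powRr1 (ltW EN0)); apply: ger_powR => //; by rewrite EN0.
  have p2 : (E / (N k)%:R) `^ s <= (2 / ((N k)%:R * sigma k)) `^ s *
       (cantor_map y - cantor_map x) `^ s.
    rewrite -powRM; last 2 first.
    - by rewrite divr_ge0 // mulr_ge0 // ltW.
    - by [].
    apply: ge0_ler_powR => //.
    - by rewrite nnegrE ltW.
    - by rewrite nnegrE mulr_ge0 // ?divr_ge0 ?mulr_ge0 ?(ltW sgk).
    have -> : E / (N k)%:R = 2 / ((N k)%:R * sigma k) * (E * sigma k / 2).
      by field; rewrite !gt_eqF.
    by rewrite ler_wpM2l // divr_ge0 // mulr_ge0 // ltW.
  rewrite (distrC (cantor_map x)) (ger0_norm yx0).
  apply: le_trans dist _.
  apply: le_trans (ler_wpM2l _ (le_trans p1 p2)) _.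
    by rewrite divr_ge0 // ltW.
  by rewrite mulrA ler_wpM2r ?powR_ge0.
move: Dk; rewrite /D neq_ltn => /orP[] h; first exact: key.
rewrite distrC (distrC (cantor_map t)); apply: key => //.
by rewrite -opprB e2 -mulrN opprB.
Qed.

End CantorMap.

(** * Jarnik's construction of well-approximable points *)

Section JarnikMap.
Variable R : realType.

Lemma powR_mul3 (a b k t s : R) : 0 <= a -> 0 <= b -> 0 <= k ->
  a `^ s * b `^ (t * s) * k `^ (t * s) = (a * (b * k) `^ t) `^ s.
Proof.
by move=> a0 b0 k0; rewrite powRM ?powR_ge0 // -powRrM -mulrA -powRM.
Qed.

Lemma eventually_bounded (v : nat -> R) (k0 : nat) (B : R) :
  (forall k, (k0 <= k)%N -> v k <= B) -> exists C, forall k, v k <= C.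
Proof.
move=> h; exists (\sum_(i < k0) `|v i| + `|B|) => k.
have s0 : 0 <= \sum_(i < k0) `|v i| by apply: sumr_ge0.
have [kk|kk] := leqP k0 k.
  by have := h k kk; have := ler_norm B; lra.
rewrite (bigD1 (Ordinal kk)) //=.
have : 0 <= \sum_(i < k0 | i != Ordinal kk) `|v i| by apply: sumr_ge0.
by have := ler_norm (v k); have := normr_ge0 B; lra.
Qed.

(** The bound on [l^-1] makes K grow so fast that the length l is negligible at the scale of K, a
    power with exponent tending to 0. Fractions are placed in the left half of the parent interval,
    which leaves room for a child of length at most l / 2. *)
Definition jarnik_step (m k : nat) (l : R) (K N : nat) (g : R -> nat -> R) :=
  [/\ (k < K)%N, l^-1 <= K%:R `^ (k.+1%:R^-1), 16 / l <= K%:R,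
      l * m%:R * K%:R ^+ 2 / 16 <= N%:R &
  forall c : R, 0 <= c ->
  (forall d, (d < N)%N -> c < g c d <= c + l / 2 /\
     exists p q, [/\ (K <= q <= 2 * (m * K))%N,
      coprime m q, coprime p q & g c d = p%:R / q%:R]) /\
  (forall d d', (d <= d' < N)%N ->
     (d' - d)%:R * ((2 * (m * K))%:R ^+ 2)^-1 <= g c d' - g c d)].

Lemma jarnik_step_exists (m : nat) : (0 < m)%N -> ~~ odd m ->
  forall x : nat * R, exists y : nat * nat * (R -> nat -> R),
  0 < x.2 <= 1 -> jarnik_step m x.1 x.2 y.1.1 y.1.2 y.2.
Proof.
move=> m0 om [k l] /=.
(* Dummy values outside the admissible lengths make the statement total, as [choice] requires. *)
have [/andP[l0 l1]|nl] := boolP (0 < l <= 1); last by exists (0%N, 0%N, fun _ _ => 0).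
have [K0 hK0] := @spread_fractions R m (l / 2) m0 om ltac:(by lra).
have [K1 hK1] := @powR_nat_large R (l^-1) (k.+1%:R^-1) ltac:(by rewrite invr_gt0).
pose K := (K0 + K1 + k.+1 + (Num.truncn (16 / l)).+1)%N.
have [N hN hg] := hK0 K ltac:(by rewrite /K -!addnA leq_addr).
have hKk : (k < K)%N by rewrite /K; move: (Num.truncn _) => z; clear; lia.
have hg' (c : R) : exists g : nat -> R, 0 <= c -> 
  (forall d, (d < N)%N -> c < g d <= c + l / 2 /\
     exists p q, [/\ (K <= q <= 2 * (m * K))%N,
      coprime m q, coprime p q & g d = p%:R / q%:R]) /\
  (forall d d', (d <= d' < N)%N ->
     (d' - d)%:R * ((2 * (m * K))%:R ^+ 2)^-1 <= g d' - g d).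
  have [c0|c0] := boolP (0 <= c); last by exists (fun=> 0).
  by have [g h] := hg c c0; exists g.
have [g Hg] := choice hg'.
exists (K, N, g) => _; split=> //=.
- by apply/ltW/hK1; rewrite /K; move: (Num.truncn _) => z; clear; lia.
- apply: le_trans (ltW (truncnS_gt _)) _.
  by rewrite ler_nat /K leq_addl.
- by apply: le_trans hN; lra.
Qed.

Lemma jarnik_map (m : nat) (tau : R) : (0 < m)%N -> ~~ odd m -> 2 <= tau ->
  exists phi : R -> R,
  (forall t : R, 0 <= t < 1 -> 0 < phi t < 1 /\
     forall M, exists p q, [/\ (M < q)%N, coprime m q, coprime p q &
       `|phi t - p%:R / q%:R| <= q%:R `^ (- tau)]) /\
  (forall s : R, 0 <= s -> s * tau < 2 -> exists2 C : R, 0 <= C &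
     forall t t' : R, 0 <= t < 1 -> 0 <= t' < 1 -> `|t - t'| <= C * `|phi t - phi t'| `^ s).
Proof.
move=> m0 om tau2.
have [F hF] := choice (jarnik_step_exists m0 om).
(* Denominators of this level are at most 2 m K, so an interval of this length to the right of p/q
   stays within q^(-tau) of it. As tau >= 2, the factor 1/2 keeps twice the length below the spacing
   sigma. *)
pose len K : R := (2 * (m * K))%:R `^ (- tau) / 2.
pose l := fix l k := if k is k'.+1 then len (F (k', l k')).1.1 else 2^-1.
pose K k := (F (k, l k)).1.1.
pose N k := (F (k, l k)).1.2.
pose f k := (F (k, l k)).2.
pose sigma k : R := ((2 * (m * K k))%:R ^+ 2)^-1.
have lS k : l k.+1 = len (K k) by [].
have m1 : 1 <= m%:R :> R by rewrite ler1n.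
have len_le k (x : R) : 0 < x <= 1 -> 16 / x <= (K k)%:R -> 
   [/\ 0 < len (K k) <= 1, len (K k) <= x / 2 & 2 * len (K k) <= sigma k].
  move=> /andP[x0 x1] Kx.
  have K1 : 1 <= (K k)%:R :> R.
    by apply: le_trans Kx; rewrite ler_pdivlMr //; lra.
  have q1 : (K k)%:R <= (2 * (m * K k))%:R :> R.
    by rewrite ler_nat mulnA leq_pmull // muln_gt0.
  have e : 2 * len (K k) <= sigma k.
    rewrite /len /sigma mulrCA divff // mulr1 -powR_mulrn // -powRN ler_powR //; lra.
  have pl : 0 < len (K k) by rewrite divr_gt0 // powR_gt0; lra.
  have e' : sigma k <= x / 16.
    rewrite /sigma -[x / 16]invrK invf_div lef_pV2 ?posrE ?divr_gt0 ?exprn_gt0 //; last by lra.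
    by apply: (le_trans Kx); rewrite expr2 (le_trans q1) // ler_peMr //; lra.
  by rewrite pl; split=> //; lra.
have l01 k : 0 < l k <= 1.
  elim: k => [|k IH]; first by rewrite /=; lra.
  have [_ _ h _ _] := hF (k, l k) IH.
  by rewrite lS; have [] := len_le k _ IH h.
have step k : jarnik_step m k (l k) (K k) (N k) (f k) by exact: (hF (k, l k) (l01 k)).
have lens k : l k.+1 <= l k / 2 /\ 2 * l k.+1 <= sigma k.
  by have [_ _ h _ _] := step k; have [_ h1 h2] := len_le k _ (l01 k) h.
have l0 k : 0 < l k by case/andP: (l01 k).
have K0 k : 0 < (K k)%:R :> R.
  by have [h _ _ _ _] := step k; rewrite ltr0n (leq_ltn_trans _ h).
have Kn0 k : (0 < K k)%N by rewrite -(ltr0n R).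
have Nlo k : l k * m%:R * (K k)%:R ^+ 2 / 16 <= (N k)%:R by have [] := step k.
have N1 k : (1 < N k)%N.
  have [hk _ h hN _] := step k.
  rewrite -(ltr_nat R); apply: lt_le_trans hN.
  rewrite ltr_pdivlMr // mul1r expr2.
  have h1 : 16 <= l k * (K k)%:R by rewrite mulrC -ler_pdivrMr.
  have h2 : 16 <= (K k)%:R :> R.
    by apply: le_trans h; rewrite ler_peMr // invf_ge1 //; case/andP: (l01 k).
  have -> : l k * m%:R * ((K k)%:R * (K k)%:R) = (l k * (K k)%:R) * (m%:R * (K k)%:R) by ring.
  have h3 : 16 <= m%:R * (K k)%:R :> R by rewrite -[leLHS]mul1r ler_pM.
  have : 16 * 16 <= (l k * (K k)%:R) * (m%:R * (K k)%:R) by rewrite ler_pM.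
  lra.
have f_itv k (c : R) d : 0 <= c -> (d < N k)%N -> c < f k c d /\ f k c d + l k.+1 <= c + l k.
  move=> c0 dN; have [_ _ _ _ h] := step k; have [h1 _] := h c c0.
  have [/andP[h2 h3] _] := h1 d dN.
  by have [h4 _] := lens k; split=> //; lra.
have f_gap k (c : R) d d' : 0 <= c -> (d <= d' < N k)%N ->
    (d' - d)%:R * sigma k <= f k c d' - f k c d.
  by move=> c0 dd'; have [_ _ _ _ h] := step k; have [_ h1] := h c c0; exact: h1.
have l_sigma k : 2 * l k.+1 <= sigma k by case: (lens k).
exists (cantor_map N f); split=> [t t01|s s0 stau].
  split=> [|M].
    have /andP[_ h1] := cantor_map_bounds l0 N1 f_itv 0 t01.
    have /andP[h2 _] := cantor_map_bounds l0 N1 f_itv 1 t01.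
    have [dN _] := digit_bounds N1 0 t01.
    have [h3 _] := @f_itv 0%N 0 _ (lexx 0) dN.
    by move: h1 h2 => /= h1 h2; apply/andP; split; lra.
  have /andP[h1 h2] := cantor_map_bounds l0 N1 f_itv M.+1 t01.
  have [c0 u01] := orbit_bounds N1 f_itv M t01.
  have [dN _] := digit_bounds N1 M u01.
  have [hM _ _ _ h] := step M; have [h3 _] := h _ c0.
  have [_ [p [q [/andP[q1 q2] c1 c2 e]]]] := h3 _ dN.
  exists p, q; split=> //; first exact: leq_trans hM q1.
  have q0 : 0 < q%:R :> R by rewrite ltr0n (leq_ltn_trans _ (leq_trans hM q1)).
  rewrite -e -[f _ _ _]/((orbit N f t M.+1).1) ger0_norm ?subr_ge0 //.
  have : len (K M) <= q%:R `^ (- tau).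
    apply: le_trans (_ : (2 * (m * K M))%:R `^ (- tau) <= _).
      by rewrite /len ler_pdivrMr // ler_peMr ?powR_ge0 //; lra.
    rewrite !powRN lef_pV2 ?posrE ?powR_gt0 ?(lt_le_trans q0) ?ler_nat //.
    by apply: ge0_ler_powR; rewrite ?nnegrE ?ler_nat //; lra.
  by move: h2; rewrite lS; lra.
have s1 : s <= 1.
  rewrite leNgt; apply/negP => s1.
  have : 1 * 2 <= s * tau by rewrite ler_pM // ltW.
  lra.
pose base k := (\prod_(j < k) N j)%N.
have s01 : 0 <= s <= 1 by rewrite s0.
suff [C hC] : exists C : R, forall k, 2 / (base k)%:R * (2 / ((N k)%:R * sigma k)) `^ s <= C.
  exists C; last exact: (cantor_map_inverse_holder l0 N1 f_itv f_gap l_sigma s01 hC).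
  by apply: le_trans (hC 0%N); rewrite mulr_ge0 ?powR_ge0 // divr_ge0.
pose B := (256 * m%:R) `^ s * (2 * m%:R) `^ (tau * s).
have [k0 hk0] : exists k0 : nat, (2 - s * tau)^-1 <= k0.+1%:R.
  by exists (Num.truncn (2 - s * tau)^-1); exact/ltW/truncnS_gt.
(* At level j + 1 the product N sigma is at least l (j + 1) / (64 m), of order K_j^(-tau), whatever
   the new K is; and base (j + 1) >= N j is at least of order l_j K_j^2. The quantity is thus at
   most a constant times K_j^(1/(j+1) - (2 - s tau)), bounded once 1/(j + 1) <= 2 - s tau. *)
apply: (@eventually_bounded _ k0.+1 (32 * B)) => -[//|j]; rewrite ltnS => jk.
have Kj := K0 j.
have K1 : 1 <= (K j)%:R :> R by rewrite ler1n -(ltr_nat R).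
have base_ge : (N j)%:R <= (base j.+1)%:R :> R.
  rewrite ler_nat /base big_ord_recr /= leq_pmull // prodn_gt0 // => i.
  exact: ltnW.
have Njs : l j.+1 / (64 * m%:R) <= (N j.+1)%:R * sigma j.+1.
  rewrite /sigma ler_pdivlMr ?exprn_gt0 ?ltr0n ?muln_gt0 ?m0 ?Kn0 //.
  apply: le_trans (Nlo j.+1); rewrite le_eqVlt; apply/orP; left; apply/eqP.
  by rewrite !natrM; field; rewrite gt_eqF //; lra.
have t1 : (2 / ((N j.+1)%:R * sigma j.+1)) `^ s <= B * (K j)%:R `^ (tau * s).
  have -> : B * (K j)%:R `^ (tau * s) = (256 * m%:R * (2 * (m * K j))%:R `^ tau) `^ s.
    by rewrite mulnA [(_ * K j)%:R]natrM [(2 * m)%:R]natrM /B powR_mul3 ?mulr_ge0.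
  have ls : 2 / (l j.+1 / (64 * m%:R)) = 256 * m%:R * (2 * (m * K j))%:R `^ tau.
    rewrite lS /len powRN; set w := _ `^ tau.
    have w0 : 0 < w by rewrite powR_gt0 // ltr0n !muln_gt0 m0 Kn0.
    by field; rewrite !gt_eqF //; lra.
  have pos : 0 < l j.+1 / (64 * m%:R) by rewrite divr_gt0 // mulr_gt0 //; lra.
  rewrite -ls; apply: ge0_ler_powR => //; rewrite ?nnegrE ?divr_ge0 ?(ltW pos) //.
  by rewrite ler_pM2l // lef_pV2 ?posrE // (lt_le_trans pos).
have pN : 0 < l j * m%:R * (K j)%:R ^+ 2 / 16.
  by rewrite divr_gt0 // !mulr_gt0 ?exprn_gt0 //; lra.
have t2 : 2 / (base j.+1)%:R <= 32 * ((l j)^-1 / (K j)%:R ^+ 2).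
  apply: le_trans (_ : 2 / (l j * m%:R * (K j)%:R ^+ 2 / 16) <= _).
    rewrite ler_pM2l // lef_pV2 ?posrE // ?(le_trans (Nlo j)) //.
    by rewrite (lt_le_trans pN) // (le_trans (Nlo j)).
  have -> : 2 / (l j * m%:R * (K j)%:R ^+ 2 / 16) = 32 * ((l j)^-1 / (K j)%:R ^+ 2) / m%:R.
    by field; rewrite !gt_eqF //; lra.
  rewrite ler_pdivrMr ?ler_peMr // ?(lt_le_trans _ m1) //.
  by rewrite mulr_ge0 // divr_ge0 ?sqr_ge0 // invr_ge0 ltW.
have B0 : 0 <= B by rewrite mulr_ge0 ?powR_ge0.
apply: le_trans (ler_pM _ _ t2 t1) _; rewrite ?powR_ge0 ?divr_ge0 //.
have [_ lK _ _ _] := step j.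
have t3 : (l j)^-1 / (K j)%:R ^+ 2 * (K j)%:R `^ (tau * s) <= 1.
  rewrite -[(K j)%:R ^+ 2]powR_mulrn ?(ltW Kj) // -powRN -mulrA powR_add //.
  apply: le_trans (ler_wpM2r (powR_ge0 _ _) lK) _.
  rewrite powR_add // -[leRHS](powRr0 (K j)%:R) ler_powR //.
  have : j.+1%:R^-1 <= 2 - s * tau.
    rewrite -[leRHS]invrK lef_pV2 ?posrE ?invr_gt0 ?subr_gt0 //.
    by apply: le_trans hk0 _; rewrite ler_nat ltnS.
  by rewrite (mulrC s tau); move: (j.+1%:R^-1) (tau * s) => a b; lra.
have -> : 32 * ((l j)^-1 / (K j)%:R ^+ 2) * (B * (K j)%:R `^ (tau * s)) =
   32 * B * ((l j)^-1 / (K j)%:R ^+ 2 * (K j)%:R `^ (tau * s)) by ring.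
by rewrite ler_piMr // mulr_ge0.
Qed.

End JarnikMap.

Local Notation mu := lebesgue_measure.

(** * The spectrum *)

Section Spectrum.
Variable R : realType.

Lemma rational_not_badly_approx (x tau : R) : rational x -> ~ badly_approx x tau.
Proof.
move=> [r _ <-] [c c0 h].
have d0 : (0 < `|denq r|)%N by rewrite absz_gt0 denq_eq0.
have := h (numq r) `|denq r|%N d0.
have -> : (`|denq r|%N)%:R = (denq r)%:~R :> R by rewrite natr_absz gtr0_norm ?denq_gt0.
rewrite -[ratr r]/((numq r)%:~R / (denq r)%:~R) subrr normr0.
by rewrite leNgt mulr_gt0 // powR_gt0 // ltr0z denq_gt0.
Qed.

Lemma not_badly_approx_lt2 (x tau : R) : tau < 2 -> ~ badly_approx x tau.
Proof.
move=> tau2; have [ix|] := pselect (irrational x); last first.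
  by move=> /contrapT; exact: rational_not_badly_approx.
case=> c c0 h.
have [K K0 hK] := @good_approx_irrational R x 1 isT ix.
have [N hN] := @powR_nat_large R (K / c) (2 - tau) ltac:(lra).
have [p [q [Nq _ _ pq]]] := hK N.
have q0 : (0 < q)%N by rewrite (leq_ltn_trans _ Nq).
have q0' : 0 < q%:R :> R by rewrite ltr0n.
have := le_trans (h p q q0) pq.
have := hN q (ltnW Nq).
rewrite -powR_add // powR_mulrn ?(ltW q0') // ltr_pdivrMr // ler_pdivlMr ?exprn_gt0 //.
by set a := _ `^ _; lra.
Qed.

(** Lets the orders tau + 1/(k+1) decrease to tau in the lower bounds for the exponent. *)
Lemma inv_double_shift (t e : R) : 2 <= t -> 0 < e -> (2 * t)^-1 - e <= (2 * (t + e))^-1.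
Proof.
move=> t2 e0.
have -> : (2 * t)^-1 = (2 * (t + e))^-1 + e * (2 * t * (t + e))^-1.
  by field; rewrite !gt_eqF //; lra.
have h : 1 <= 2 * t * (t + e) by rewrite -[leLHS]mulr1 ler_pM //; lra.
have : e * (2 * t * (t + e))^-1 <= e.
  by rewrite ler_piMr ?(ltW e0) // invf_le1 // (lt_le_trans ltr01 h).
lra.
Qed.

Lemma hausdorff_measure_set0 (s : R) : 0 < s -> hausdorff_measure s (@set0 R) = 0%E.
Proof.
move=> s0; apply: (@hausdorff_measure_well_approx R (3 / s)) => //.
- by rewrite divr_gt0.
- by rewrite divfK ?gt_eqF //; lra.
Qed.

Variables (P : {poly int}) (alpha : R).
Hypothesis degP : size P = 3%N.
Hypothesis leadP : 0 < lead_coef P.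
Hypothesis alpha_gt1 : 1 < alpha.
Hypothesis alpha_le2 : alpha <= 2.
Let F := poly_fourier P alpha.
Let level beta := holder_level F (beta + (alpha - 1) / 2).

Lemma exponent_badly_approx (x tau : R) : 2 <= tau -> badly_approx x tau ->
  (((alpha - 1) / 2 + (2 * tau)^-1)%:E <= holder_exponent F x)%E.
Proof.
move=> tau2 bx.
have -> : (2 * tau)^-1 = tau^-1 / 2 by rewrite invfM mulrC.
apply: exponent_ge => //.
- by rewrite invr_ge0 lef_pV2 ?posrE; lra.
- by move=> s s0; exact: badly_approx_sums_small.
Qed.

Lemma exponent_irrational (x : R) : x \in `[0, 1] -> irrational x ->
  (holder_exponent F x <= ((alpha - 1) / 2 + 4^-1)%:E)%E.
Proof.
rewrite in_itv /= => /andP[x0 x1] ix.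
have ne01 (i : int) : x <> i%:~R.
  by move=> xi; apply: ix; exists i%:~R => //; rewrite ratr_int.
have x01 : 0 < x < 1.
  rewrite !lt_neqAle x0 x1 !andbT eq_sym.
  by apply/andP; split; apply/eqP; [exact: ne01 0|exact: ne01 1].
have m0 : (0 < 2 * lead_nat P)%N by rewrite muln_gt0 lead_nat_gt0.
have [K K0 hK] := good_approx_irrational m0 ix.
have := @exponent_le_good R P alpha degP leadP alpha_gt1 alpha_le2 x 2 K x01 (lexx 2) K0.
have -> : 2 * 2 = 4 :> R by ring.
apply=> N; have [p [q [Nq c1 c2 e]]] := hK N; exists p, q; split=> //.
by rewrite powRN powR_mulrn.
Qed.

(** For s <= 1 the order 2 / s' with s' between 4 beta and s is at least 2; a point badly
    approximable to that order has exponent at least (alpha - 1) / 2 + s' / 4, too large for the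
    level. For s > 1 an order below 2 is taken, to which no point is badly approximable. *)
Lemma level_null (beta s : R) : 0 <= beta <= 4^-1 -> 4 * beta < s ->
  hausdorff_measure s (level beta) = 0%E.
Proof.
move=> /andP[b0 b1] bs; have s0 : 0 < s by lra.
have [s1|s1] := ltP 1 s.
  apply: (@hausdorff_measure_well_approx R (s^-1 + 1)) => //.
  - by rewrite addr_gt0 // invr_gt0.
  - by rewrite mulrDl mulVf ?gt_eqF //; lra.
  - by move=> x [].
  - move=> x _; apply: not_badly_approx_lt2.
    by have : s^-1 < 1; [rewrite invf_lt1|lra].
set s' := (4 * beta + s) / 2.
have s'0 : 0 < s' by rewrite /s'; lra.
have s's : s' < s by rewrite /s'; lra.
apply: (@hausdorff_measure_well_approx R (2 / s')) => //.
- by rewrite divr_gt0.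
- by rewrite mulrAC ltr_pdivlMr // ltr_pM2l.
- by move=> x [].
move=> x [_ xE] bx.
have := @exponent_badly_approx x (2 / s') ltac:(by rewrite ler_pdivlMr // ler_piMr //; lra) bx.
rewrite xE lee_fin.
have -> : (2 * (2 / s'))^-1 = s' / 4 by field; rewrite gt_eqF.
by rewrite /s'; lra.
Qed.

Lemma level_dim_le (beta : R) : 0 <= beta <= 4^-1 ->
  (hausdorff_dim (level beta) <= (4 * beta)%:E)%E.
Proof.
move=> b01; apply: hausdorff_dim_le => [|s]; last exact: level_null.
by case/andP: b01 => b0 _; rewrite mulr_ge0.
Qed.

Lemma level_not_null (beta s : R) : 0 < beta <= 4^-1 -> 0 <= s < 4 * beta ->
  hausdorff_measure s (level beta) <> 0%E.
Proof.
move=> /andP[b0 b1] /andP[s0 sb] null.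
pose tau := (2 * beta)^-1.
have tau2 : 2 <= tau by rewrite /tau -[leLHS]invrK lef_pV2 ?posrE ?invr_gt0; lra.
have tb : (2 * tau)^-1 = beta by rewrite /tau; field; rewrite gt_eqF.
have m0 : (0 < 2 * lead_nat P)%N by rewrite muln_gt0 lead_nat_gt0.
have om : ~~ odd (2 * lead_nat P) by rewrite oddM.
have [phi [approx hol]] := jarnik_map m0 om tau2.
pose T : set R := `[0, 1[%classic.
have inT t : T t -> 0 <= t < 1 by rewrite /T /= in_itv.
pose tauk (k : nat) : R := tau + k.+1%:R^-1.
have k0 (k : nat) : 0 < k.+1%:R^-1 :> R by rewrite invr_gt0.
pose A (k : nat) : set R := [set x | x \in `[0, 1] /\ ~ badly_approx x (tauk k)].
have negl (s' : R) (B : set R) : 0 <= s' -> s' * tau < 2 -> hausdorff_measure s' B = 0%E ->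
    mu.-negligible (T `&` phi @^-1` B).
  move=> s'0 s't null'; have [C C0 hC] := hol s' s'0 s't.
  by apply: (@negligible_preimage _ phi T B C s') => // t t' /inT h1 /inT h2; exact: hC.
have negA k : mu.-negligible (T `&` phi @^-1` (A k)).
  have [e e0 ek] : exists2 e : R, 0 < e & tauk k = tau + e by exists k.+1%:R^-1.
  have d0 : 0 < tau + e / 2 by lra.
  (* This dimension s' satisfies s' tau < 2, as phi requires, and s' (tau + e) > 2, as the null set
     requires. *)
  apply: (negl (2 / (tau + e / 2))).
  - by rewrite divr_ge0 // ltW.
  - by rewrite mulrAC ltr_pdivrMr // ltr_pM2l //; lra.
  - apply: (@hausdorff_measure_well_approx R (tauk k)).
    + by rewrite ek; lra.
    + by rewrite divr_gt0.
    + by rewrite ek mulrCA ltr_pMr // ltr_pdivlMr // mul1r; lra.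
    + by move=> x [].
    + by move=> x [].
have negL : mu.-negligible (T `&` phi @^-1` (level beta)).
  apply: (negl s) => //; rewrite /tau -[_ * _^-1]/(_ / _) ltr_pdivrMr; lra.
apply: (@not_negligible_itv01 R).
(* The map phi is controlled on [0, 1[ only, so the endpoint 1 is discarded. *)
have neg1 : mu.-negligible [set 1 : R].
  by exists [set 1 : R]; split=> //; exact: lebesgue_measure_set1.
have := negligibleU (negligibleU negL neg1) (negligible_bigcup negA).
apply: negligibleS => t; rewrite /= in_itv /= => /andP[t0 t1].
have [->|tn1] := eqVneq t 1; first by left; right.
have t01 : 0 <= t < 1 by rewrite t0 lt_neqAle tn1.
have Tt : T t by rewrite /T /= in_itv.
have [phi01 happ] := approx t t01.
have xi01 : phi t \in `[0, 1] by rewrite in_itv /=; case/andP: phi01 => h1 h2; rewrite !ltW.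
have [[k nk]|allb] := pselect (exists k, ~ badly_approx (phi t) (tauk k)).
  by right; exists k => //; split.
left; left; split=> //; split=> //; apply/eqP; rewrite eq_le; apply/andP; split.
  have := @exponent_le_good R P alpha degP leadP alpha_gt1 alpha_le2 (phi t) tau 1 phi01 tau2 ltr01.
  rewrite tb addrC; apply=> N.
  by have [p [q [Nq c1 c2 e]]] := happ N; exists p%:Z, q; split=> //; rewrite mul1r.
have low k : (((alpha - 1) / 2 + (2 * tauk k)^-1)%:E <= holder_exponent F (phi t))%E.
  apply: exponent_badly_approx; first by rewrite (le_trans tau2) // /tauk lerDl ltW.
  by apply: contrapT => nk; apply: allb; exists k.
case: (holder_exponent F (phi t)) low => [r| |] low.
- rewrite lee_fin leNgt; apply/negP => rb.
  pose d := beta + (alpha - 1) / 2 - r.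
  have d0 : 0 < d by rewrite /d subr_gt0.
  pose k := Num.truncn d^-1.
  have kd : k.+1%:R^-1 < d.
    by rewrite -[ltRHS]invrK ltf_pV2 ?posrE ?invr_gt0 // truncnS_gt.
  have := low k; rewrite lee_fin /tauk; have hk := k0 k.
  set e := k.+1%:R^-1 in kd hk *.
  have := inv_double_shift tau2 hk.
  by rewrite tb; move: kd; rewrite /d; lra.
- by rewrite leey.
- by have := low 0%N; rewrite leeNy_eq.
Qed.

(** The point 1 / (2a + 1) has a denominator coprime to 2a, so its exponent is at most (alpha - 1) /
    2; the trivial bound on Weyl sums gives the converse at every point. *)
Lemma level0_nonempty : level 0 !=set0.
Proof.
pose q := (2 * lead_nat P).+1.
have q1 : 1 < q%:R :> R by rewrite ltr1n /q ltnS muln_gt0 lead_nat_gt0.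
have x01 : 0 < (1%:~R / q%:R : R) < 1.
  by rewrite mul1r invr_gt0 invf_lt1 ?q1 ?andbT; lra.
exists (1%:~R / q%:R); split.
  by case/andP: x01 => h1 h2; rewrite in_itv /= !ltW.
apply/eqP; rewrite eq_le; apply/andP; split.
  by rewrite add0r; apply: exponent_le_rational => //; [rewrite coprimenS | rewrite /coprimez gcd1z].
have := @exponent_ge R P alpha degP leadP alpha_gt1 alpha_le2 (1%:~R / q%:R) 0.
rewrite add0r mul0r addr0; apply; first by lra.
by move=> s; exact: sums_small0.
Qed.

Lemma hausdorff_dim_ge0 (A : set R) : (0 <= hausdorff_dim A)%E.
Proof. by apply: hausdorff_dim_ge => s s0; rewrite ltNge s0. Qed.

(** For beta > 0 an empty level would be null in dimension 2 beta, below the 4 beta up to which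
    [level_not_null] applies. *)
Lemma level_nonempty (beta : R) : 0 <= beta <= 4^-1 -> level beta <> set0.
Proof.
move=> /andP[]; rewrite le_eqVlt => /orP[/eqP <- _|b0 b1].
  by have [x lx] := level0_nonempty => e; rewrite e in lx.
move=> e; have h : 0 <= 2 * beta < 4 * beta by lra.
apply: (level_not_null _ h); first by rewrite b0.
by rewrite e; apply: hausdorff_measure_set0; rewrite mulr_gt0.
Qed.

Lemma level_dim_ge (beta : R) : 0 <= beta <= 4^-1 ->
  ((4 * beta)%:E <= hausdorff_dim (level beta))%E.
Proof.
move=> /andP[]; rewrite le_eqVlt => /orP[/eqP <- _|b0 b1].
  by rewrite mulr0 hausdorff_dim_ge0.
apply: hausdorff_dim_ge => s s0 sb; apply: level_not_null; first by rewrite b0.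
by rewrite s0.
Qed.

(** Only rationals can have so large an exponent, and they are badly approximable to no order, so
    the order 3 / s is available for every s > 0. *)
Lemma level_dim_eq0 (beta : R) : 4^-1 < beta -> hausdorff_dim (level beta) = 0%E.
Proof.
move=> b4; apply/eqP; rewrite eq_le hausdorff_dim_ge0 andbT.
apply: hausdorff_dim_le => // s s0.
apply: (@hausdorff_measure_well_approx R (3 / s)) => //.
- by rewrite divr_gt0.
- by rewrite divfK ?gt_eqF //; lra.
- by move=> x [].
move=> x [x01 xE]; apply: rational_not_badly_approx; apply: contrapT => ix.
have := exponent_irrational x01 ix.
by rewrite xE lee_fin; lra.
Qed.

End Spectrum.

Theorem theorem2p3 (R : realType) (P : {poly int}) (alpha : R)
    (degP : size P = 3%N) (leadP : 0 < lead_coef P)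
    (alpha_gt1 : 1 < alpha) (alpha_le2 : alpha <= 2) :
  let F := poly_fourier P alpha in
  [/\ forall beta : R, 0 <= beta <= 4^-1 ->
        spectrum F (beta + (alpha - 1) / 2) = Some (4 * beta)%:E,
      forall x : R, x \in `[0, 1] -> irrational x ->
        (holder_exponent F x <= ((alpha - 1) / 2 + 4^-1)%:E)%E
    & forall beta : R, 4^-1 < beta ->
        spectrum F (beta + (alpha - 1) / 2) = Some 0%:E \/
        spectrum F (beta + (alpha - 1) / 2) = None].
Proof.
move=> F; split=> [beta b01|x|beta b4].
- rewrite /spectrum; case: asboolP => [e|_].
    by exfalso; exact: (level_nonempty degP leadP alpha_gt1 alpha_le2 b01 e).
  by congr Some; apply/eqP; rewrite eq_le level_dim_le ?level_dim_ge.
- exact: exponent_irrational.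
- rewrite /spectrum; case: asboolP => [_|_]; first by right.
  by left; congr Some; exact: level_dim_eq0.
Qed.
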